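(* Let $c_* := \frac{\pi}{2\sqrt{2}}$. There exists $c_\infty \in (c_*,\infty)$ such that the following hold for the equation $$(c^2 - 2\eta)\,\eta'' - (\eta')^2 + \eta = 0, \qquad u \in \mathbb{T}. \qquad ( * )$$ (i) For every $c \in (1,c_* )$, equation $( * )$ admits a unique single-lobe solution with profile $\eta \in C^\infty_{\rm per}(\mathbb{T})$, and along this family $\|\eta\|_{L^\infty} \to 0$ as $c \to 1$. (ii) For every $c \in (c_*,c_\infty)$, equation $( * )$ admits a single-lobe solution with profile $\eta \in C^0_{\rm per}(\mathbb{T})$ satisfying $$\eta(u) = \frac{c^2}{2} - A(c)\,|u|^{2/3} + \mathcal{O}(|u|^{4/3}) \quad \text{as } u \to 0,$$ for some constant $A(c) > 0$. (iii) At $c = c_*$, there exists a unique single-lobe solution of $( * )$ with profile $\eta \in C^0_{\rm per}(\mathbb{T}) \cap W^{1,\infty}(\mathbb{T})$, and it is given explicitly by $$\eta(u) = \frac{1}{16}\left(\pi^2 - 4\pi |u| + 2u^2\right), \qquad u \in [-\pi,\pi],$$ extended as a $2\pi$-periodic function on $\mathbb{T}$.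
   Context: $\mathbb{T} = \mathbb{R}/(2\pi\mathbb{Z})$, and $C^k_{\rm per}(\mathbb{T})$ denotes $2\pi$-periodic functions of class $C^k$. The number $c>0$ is the wave speed, and $\eta = \eta(u)$ is a real-valued $2\pi$-periodic function required to satisfy the constraint $\int_{\mathbb{T}} \left[\eta + (\eta')^2\right] du = 0$ (which is automatic for smooth solutions). A single-lobe solution is a solution whose profile $\eta$ is even in $u$ and possesses a single maximum on $\mathbb{T}$, placed at $u = 0$. A profile in $C^\infty_{\rm per}(\mathbb{T})$ satisfies the equation at every $u \in \mathbb{T}$; a profile that is not smooth at its maximum satisfies the equation classically (as a $C^2$ function) at every $u \in \mathbb{T}\setminus\{0\}$, together with the integral constraint above. *)

(* Defs.v *)
(* Functions on the torus R/(2 pi Z) are represented by the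
   2 pi-periodic functions R -> R, so that equality of functions on the torus
   is equality of the representatives. *)
From HB Require Import structures.
From mathcomp Require Import all_boot all_order all_algebra.
From mathcomp Require Import all_classical all_reals all_analysis.

Set Implicit Arguments.
Unset Strict Implicit.
Unset Printing Implicit Defensive.

Import Order.TTheory GRing.Theory Num.Theory.
Import numFieldNormedType.Exports.

Local Open Scope classical_set_scope.
Local Open Scope ring_scope.

Section torus.
Context {R : realType}.
Implicit Types (f g eta phi : R -> R) (c u : R) (k n : nat) (D : set R).

(* The representatives of the point 0 of the torus. *)
Definition crests : set R := [set 2 * pi * k%:~R | k in [set: int]].

Definition period_cell : set R := `[- pi, pi].

(* Meaningful for an open set D only: derive1n takes two-sided derivatives in R. *)
Definition class_C k D f := forall u, D u ->
  (forall n, (n < k)%N -> derivable (derive1n n f) u 1) /\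
  (forall n, (n <= k)%N -> {for u, continuous (derive1n n f)}).

Definition C_per k f := periodic f (2 * pi) /\ class_C k setT f.

Definition Cinfty_per f := forall k, C_per k f.

(* Extending f by 0 outside of one period does not change the essential
   supremum of `|f|. *)
Definition Linfty_norm f : \bar R :=
  'N[lebesgue_measure]_+oo[EFin \o (f \_ period_cell)].

Definition in_Linfty f :=
  measurable_fun period_cell f /\ (Linfty_norm f < +oo)%E.

Definition weak_derivative f g := forall phi, Cinfty_per phi ->
  \int[lebesgue_measure]_(u in period_cell) (f u * derive1 phi u) =
  - \int[lebesgue_measure]_(u in period_cell) (g u * phi u).

Definition in_W1infty f :=
  in_Linfty f /\ exists2 g, in_Linfty g & weak_derivative f g.

Definition wave_eq c eta u :=
  (c ^+ 2 - 2 * eta u) * derive1n 2 eta u - (derive1 eta u) ^+ 2 + eta u = 0.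

(* If eta is not differentiable on crests, the value there of the total
   function derive1 eta is irrelevant, as crests is a null set. *)
Definition integral_constraint eta :=
  let F u := eta u + (derive1 eta u) ^+ 2 in
  lebesgue_measure.-integrable period_cell (EFin \o F) /\
  \int[lebesgue_measure]_(u in period_cell) F u = 0.

Definition is_local_max eta u := \forall v \near u, eta v <= eta u.

(* The maximum is the only local maximum on the torus; for a continuous
   periodic function it is then also the unique global one. *)
Definition single_lobe eta :=
  (forall u, eta (- u) = eta u) /\
  (forall u, is_local_max eta u <-> crests u).

Definition smooth_single_lobe_solution c eta :=
  [/\ Cinfty_per eta, forall u, wave_eq c eta u,
      integral_constraint eta & single_lobe eta].

Definition singular_single_lobe_solution c eta :=
  [/\ C_per 0 eta,
      class_C 2 (~` crests) eta,
      forall u, (~` crests) u -> wave_eq c eta u,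
      integral_constraint eta & single_lobe eta].

Definition c_star : R := pi / (2 * Num.sqrt 2).

End torus.

(* Main.v *)
Require Import Defs.
From HB Require Import structures.
From mathcomp Require Import all_boot all_order all_algebra.
From mathcomp Require Import all_classical all_reals all_analysis.
From mathcomp Require Import measurable_realfun ess_sup_inf.
From mathcomp Require Import ring lra zify.

Set Implicit Arguments.
Unset Strict Implicit.
Unset Printing Implicit Defensive.

Import Order.TTheory GRing.Theory Num.Theory.
Import numFieldNormedType.Exports.

Local Open Scope classical_set_scope.
Local Open Scope ring_scope.

(** Write w = c^2 - 2 eta.  The equation has the first integral
w eta'^2 + eta^2 = E, and solving it amounts to inverting an integral.

Place the trough of the wave at u = pi, put v = u - pi, and look for
eta = - a cos tau(v) with a = m c^2 / 2.  Then w = c^2 (1 + m cos tau), and the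
first integral with E = a^2 becomes c sqrt(1 + m cos tau) tau' = 1.  So the
phase tau is the inverse of c * period_int m, where period_int m is the
primitive of sqrt(1 + m cos t), and the wave has period 2 pi exactly when
c * half_period m = pi, where half_period m is the integral from 0 to pi.  The
square root is extended by 0 to negative numbers, so that this covers three
cases:
- m < 1: the phase passes the crest smoothly and the wave is smooth;
- m = 1: half_period 1 = 2 sqrt 2 gives c = c_star, the integral is elementary,
  and the wave is the explicit peaked parabola;
- m > 1: the phase stops when eta reaches the critical level c^2 / 2, with
  infinite slope, and the wave has a cusped crest.

The theorem then rests on the behaviour of half_period.  It is continuous
(half_period_dist), it decreases strictly on [0, 1] from pi to 2 sqrt 2
(half_period_decr), and half_period (sqrt 2) < 2 sqrt 2
(half_period_sqrt2_lt).  The intermediate value theorem gives a parameter m in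
]0, 1[ for each speed in ]1, c_star[, and a parameter above 1 for each speed
between c_star and c_infty = pi / half_period (sqrt 2).  The quantitative
decrease on [0, 1] also bounds the amplitude m c^2 / 2 by a function of c that
tends to 0 as c tends to 1.

Regularity away from singular crests (jet): eta, q = sqrt w * eta' and
kappa = 1 / sqrt w satisfy a polynomial system of first order, so all
derivatives of eta exist; the wave equation, and the fact that the flux
- w eta' is a primitive of eta + eta'^2, are consequences of that system.  The
flux vanishes at the crest and at the trough, hence the integral constraint;
the fundamental theorem of calculus is needed there for an integrand that may
be unbounded, but only from above (FTC_lower_bounded).

Asymptotics (crest_asymptotics): with z = sqrt w one has
(z^3)' = 3 sqrt(a^2 - eta^2), which tends to 3 Q, Q = sqrt(a^2 - c^4 / 4) > 0.
So z^3 behaves like 3 Q u, and c^2 - 2 eta like (3 Q u)^(2/3).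

Uniqueness.  A single-lobe solution decreases strictly on [0, pi]
(single_lobe_decreasing).  If it is smooth, its slope vanishes at the crest too,
so eta(0) = - eta(pi) = a; its phase acos(- eta / a) then satisfies the equation
above, the period condition determines m, and m determines the wave
(smooth_solution_unique).  At the speed c_star the solution may be singular at
the crest, and three values of the energy E = eta(pi)^2 have to be told apart
(critical_solution).  If E = c^4 / 4, a factor cancels from the first integral
and eta is the parabola.  Otherwise, the integral constraint forces the flux to
vanish at the crest: either the crest is a turning point, and the wave would
have a parameter m < 1 with half_period m = half_period 1, or w vanishes at the
crest while E > c^4 / 4, and the slope is unbounded there.  The latter
contradicts the bound that a bounded weak derivative gives when tested against
functions concentrating at the crest (W1infty_derivative_bound). *)

(** * Derivatives of real functions *)

Section calculus.
Context {R : realType}.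
Implicit Types (f g F G : R -> R) (a b x : R).

Lemma derD f g x a b : is_derive x 1 f a -> is_derive x 1 g b ->
  is_derive x 1 (fun t => f t + g t) (a + b).
Proof. exact: is_deriveD. Qed.

Lemma derB f g x a b : is_derive x 1 f a -> is_derive x 1 g b ->
  is_derive x 1 (fun t => f t - g t) (a - b).
Proof. exact: is_deriveB. Qed.

Lemma derN f x a : is_derive x 1 f a -> is_derive x 1 (fun t => - f t) (- a).
Proof. exact: is_deriveN. Qed.

Lemma derC (k x : R) : is_derive x 1 (fun _ : R => k) 0.
Proof. exact: is_derive_cst. Qed.

Lemma der_id x : is_derive x 1 (fun t : R => t) 1.
Proof. exact: is_derive_id. Qed.

Lemma derM f g x a b : is_derive x 1 f a -> is_derive x 1 g b ->
  is_derive x 1 (fun t => f t * g t) (a * g x + f x * b).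
Proof.
move=> df dg; apply: (@is_derive_eq _ _ _ _ _ _ _ _ (is_deriveM df dg)).
by rewrite /GRing.scale /= addrC mulrC.
Qed.

Lemma derX f x a n : is_derive x 1 f a ->
  is_derive x 1 (fun t => f t ^+ n.+1) (n.+1%:R * f x ^+ n * a).
Proof.
move=> df; have := is_deriveX n.+1 df.
by rewrite exprfctE.
Qed.

Lemma derZ (k : R) f x a : is_derive x 1 f a ->
  is_derive x 1 (fun t => k * f t) (k * a).
Proof.
move=> df; apply: (is_derive_eq (derM (derC k x) df)).
by rewrite mul0r add0r.
Qed.

Lemma derV f x a : f x != 0 -> is_derive x 1 f a ->
  is_derive x 1 (fun t => (f t)^-1) (- a / f x ^+ 2).
Proof.
move=> fx df; apply: (is_derive_eq (is_deriveV fx df)).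
by rewrite /GRing.scale /= !mulNr mulrC.
Qed.

Lemma dercomp f g x a b : is_derive x 1 f a -> is_derive (f x) 1 g b ->
  is_derive x 1 (fun t => g (f t)) (b * a).
Proof.
move=> df dg; rewrite [X in is_derive _ _ X](_ : _ = g \o f)//.
by apply: (is_derive_eq (is_derive1_comp dg df)).
Qed.

Lemma dersqrt f x a : 0 < f x -> is_derive x 1 f a ->
  is_derive x 1 (fun t => Num.sqrt (f t)) (a / (2 * Num.sqrt (f x))).
Proof.
move=> fx df; apply: (is_derive_eq (dercomp df (is_derive1_sqrt fx))).
by rewrite mulrC.
Qed.

Lemma is_derive_continuous f x a : is_derive x 1 f a -> {for x, continuous f}.
Proof. by case=> fx _; apply/differentiable_continuous/derivable1_diffP. Qed.

Lemma is_derive_derive1E f x a : is_derive x 1 f a -> derive1 f x = a.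
Proof. by move=> df; rewrite derive1E derive_val. Qed.

Lemma derivable_is_derive1 f x : derivable f x 1 -> is_derive x 1 f (derive1 f x).
Proof. by rewrite derive1E; exact: derivableP. Qed.

Lemma der_within f g a b : (forall x, x \in `[a, b] -> is_derive x 1 f (g x)) ->
  {within `[a, b], continuous f}.
Proof.
by move=> df; apply: derivable_within_continuous => x /df [].
Qed.

Lemma der_withinT f g a b : (forall x, is_derive x 1 f (g x)) ->
  {within `[a, b], continuous f}.
Proof. by move=> df; apply: continuous_subspaceT => x; exact: is_derive_continuous (df x). Qed.

(** Derivatives are compared in the open interval only: the functions below
may fail to be differentiable at a crest, which is always an end point. *)
Lemma der_le F G f g a b : a <= b ->
  {within `[a, b], continuous F} -> {within `[a, b], continuous G} ->
  (forall x, x \in `]a, b[ -> is_derive x 1 F (f x)) ->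
  (forall x, x \in `]a, b[ -> is_derive x 1 G (g x)) ->
  (forall x, x \in `]a, b[ -> f x <= g x) ->
  F b - F a <= G b - G a.
Proof.
move=> ab cF cG dF dG fg.
have cGF : {within `[a, b], continuous (fun x => G x - F x)}.
  by move=> x; apply: continuousB; [exact: cG|exact: cF].
case: (ltgtP a b) ab => // [ab _|-> _]; last by rewrite !subrr.
have [x xab|//|c cab] := @MVT _ (fun x => G x - F x) (fun x => g x - f x) a b ab.
  by apply: derB; [exact: dG|exact: dF].
have := fg c cab; rewrite -subr_ge0 => fgc E.
have : 0 <= (g c - f c) * (b - a) by rewrite mulr_ge0// subr_ge0 ltW.
by rewrite -E; lra.
Qed.

Lemma der_ge0 F f a b : a <= b -> {within `[a, b], continuous F} ->
  (forall x, x \in `]a, b[ -> is_derive x 1 F (f x)) ->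
  (forall x, x \in `]a, b[ -> 0 <= f x) -> F a <= F b.
Proof.
move=> ab cF dF f0; rewrite -subr_ge0.
have c0 : {within `[a, b], continuous (fun _ : R => 0 : R)}.
  by move=> x; exact: cst_continuous.
by have := der_le ab c0 cF (fun x _ => derC 0 x) dF f0; rewrite subrr.
Qed.

Lemma der_cst F a b : a <= b ->
  {within `[a, b], continuous F} ->
  (forall x, x \in `]a, b[ -> is_derive x 1 F 0) -> F b = F a.
Proof.
move=> ab cF dF.
have h1 : F a <= F b by exact: (der_ge0 ab cF dF (fun _ _ => lexx 0)).
have cN : {within `[a, b], continuous (fun x => - F x)}.
  by move=> x; apply: continuousN; exact: cF.
have dN x : x \in `]a, b[ -> is_derive x 1 (fun x => - F x) 0.
  by move=> /dF /derN; rewrite oppr0.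
have h2 : - F a <= - F b by exact: (der_ge0 ab cN dN (fun _ _ => lexx 0)).
by move: h1 h2; lra.
Qed.

Lemma der_cst_cc F a b : a <= b ->
  (forall x, x \in `[a, b] -> is_derive x 1 F 0) -> F b = F a.
Proof.
move=> ab dF.
have cF := @der_within F (fun=> 0) a b dF.
have dF' x : x \in `]a, b[ -> is_derive x 1 F 0.
  move=> xab.
  have xab' : x \in `[a, b] by move: xab; rewrite !in_itv/= => /andP[/ltW-> /ltW->].
  exact: (dF x xab').
exact: (@der_cst F a b ab cF dF').
Qed.

(** Smoothness without computing a higher derivative: when A is stable under
derivation on D, induction shows that the n-th derivative of a member of A
coincides on D with a member of A. *)
Lemma class_C_closed (A : (R -> R) -> Prop) (D : set R) k f g : open D ->
  (forall g, A g -> exists2 h, A h & forall u, D u -> is_derive u 1 g (h u)) ->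
  A g -> (forall u, D u -> f u = g u) -> class_C k D f.
Proof.
move=> oD AD Ag fg.
have derE n : exists2 h, A h & forall u, D u -> derive1n n f u = h u.
  elim: n => [|n [h Ah hE]]; first by exists g.
  have [h' Ah' dh] := AD _ Ah; exists h' => // u Du.
  rewrite derive1nS -(is_derive_derive1E (dh u Du)) !derive1E; apply: near_eq_derive.
  by apply: filterS (open_nbhs_nbhs (conj oD Du)) => v Dv; exact: hE.
have derE' n : exists h, forall u, D u -> is_derive u 1 (derive1n n f) (h u).
  have [h Ah hE] := derE n; have [h' _ dh] := AD _ Ah; exists h' => u Du.
  apply: near_eq_is_derive (dh u Du).
  apply: filterS (open_nbhs_nbhs (conj oD Du)) => v Dv; exact/esym/hE.
move=> u Du; split=> n _; have [h /(_ u Du) dh] := derE' n.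
  by case: dh.
exact: is_derive_continuous dh.
Qed.

Lemma class_CW k D f : class_C k.+1 D f -> class_C k D f.
Proof.
move=> C u Du; have [d c] := C u Du.
by split=> n nk; [apply: d; exact: ltnW|apply: c; exact: leqW].
Qed.

Lemma class_C_derive f D k : class_C k.+1 D f -> forall u, D u ->
  is_derive u 1 f (derive1 f u) /\ {for u, continuous (derive1 f)}.
Proof.
move=> h u /h[d c]; split; first by apply: derivable_is_derive1; exact: (d 0%N).
exact: (c 1%N).
Qed.

Lemma ge0_at_right g : continuous g -> (forall u, 0 < u < pi -> 0 <= g u) ->
  0 <= g 0.
Proof.
move=> cg g0; have pi0 := @pi_gt0 R; rewrite leNgt; apply/negP => gn.
have gn' : 0 < - g 0 by lra.
have /cvgrPdist_lt/(_ _ gn')/nbhs_ballP[e /= e0 he] := cg 0.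
pose u := Num.min (e / 2) (pi / 2).
have u0 : 0 < u by rewrite lt_min !divr_gt0.
have ue : u < e by rewrite gt_min; apply/orP; left; lra.
have upi : u < pi by rewrite gt_min; apply/orP; right; lra.
have : `|g 0 - g u| < - g 0.
  by apply: he; rewrite /ball/= sub0r normrN gtr0_norm.
have := g0 u; rewrite u0 upi => /(_ isT).
by rewrite ltr_norml => ? /andP[? ?]; lra.
Qed.

End calculus.

(** * The fundamental theorem of calculus for unbounded integrands *)

Section integration.
Context {R : realType}.
Notation mu := (@lebesgue_measure R).
Implicit Types (f g F G : R -> R) (a b x : R).

Lemma FTC_cc F f a b : a < b -> {within `[a, b], continuous f} ->
  {within `[a, b], continuous F} ->
  (forall x, x \in `]a, b[ -> is_derive x 1 F (f x)) ->
  (\int[mu]_(x in `[a, b]) (f x)%:E = (F b - F a)%:E)%E.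
Proof.
move=> ab cf /(continuous_within_itvP _ ab)[_ Fa Fb] dF.
rewrite (continuous_FTC2 ab cf (F := F)) ?EFinB//.
  by split=> // x /dF [].
by move=> x /dF /is_derive_derive1E.
Qed.

Lemma open_cts_within f a b c d : a < c -> d < b ->
  (forall x, x \in `]a, b[ -> {for x, continuous f}) ->
  {within `[c, d], continuous f}.
Proof.
move=> ac db cf; apply: continuous_in_subspaceT => x.
rewrite inE/= in_itv/= => /andP[cx xd]; apply: cf.
by rewrite in_itv/= (lt_le_trans ac cx) (le_lt_trans xd db).
Qed.

Lemma open_cts_measurable f a b :
  (forall x, x \in `]a, b[ -> {for x, continuous f}) ->
  measurable_fun `[a, b] f.
Proof.
move=> cf; apply: (@measurable_fun_itv_cc _ _ _ false true).
by apply: open_continuous_measurable_fun => // x; rewrite inE/=; exact: cf.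
Qed.

(** As f may blow up at the end points, its integrability is not known
beforehand.  The formula holds on an increasing sequence of compact subintervals,
and monotone convergence carries it over to the limit. *)
Lemma ge0_FTC_oo F f a b : a < b ->
  (forall x, x \in `]a, b[ -> 0 <= f x) ->
  (forall x, x \in `]a, b[ -> {for x, continuous f}) ->
  {within `[a, b], continuous F} ->
  (forall x, x \in `]a, b[ -> is_derive x 1 F (f x)) ->
  (\int[mu]_(x in `[a, b]) (f x)%:E = (F b - F a)%:E)%E.
Proof.
move=> ab f0 cf cF dF.
have mf : measurable_fun `]a, b[ f.
  by apply: measurable_funS (open_cts_measurable cf) => //; exact: subset_itv_oo_cc.
rewrite integral_itv_bndoo; last exact/measurable_EFinP.
(* any sequence decreasing to 0 and bounded by (b - a) / 3 would do *)
pose h n : R := (b - a) / 3 * harmonic n.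
pose A n := `[a + h n, b - h n]%classic.
have h0 n : 0 < h n.
  by rewrite /h mulr_gt0 ?harmonic_gt0//; lra.
have h1 n : h n <= (b - a) / 3.
  rewrite /h ler_piMr//; first lra.
  by rewrite /harmonic/= invf_le1 ?ltr0n// ler1n.
have AE : \bigcup_n A n = `]a, b[%classic.
  apply/seteqP; split=> x.
    move=> [n _]; rewrite /A /= !in_itv/= => /andP[ax xb].
    by apply/andP; split; have := h0 n; lra.
  rewrite /= in_itv/= => /andP[ax xb].
  have hc : h n @[n --> \oo] --> (b - a) / 3 * 0.
    by apply: cvgMr; exact: cvg_harmonic.
  rewrite mulr0 in hc.
  have d0 : 0 < Num.min (x - a) (b - x) by rewrite lt_min !subr_gt0 ax xb.
  have /cvgrPdist_lt/(_ _ d0)[N _ /(_ N (leqnn N))] := hc.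
  rewrite /= sub0r normrN gtr0_norm// lt_min => /andP[h2 h3].
  by exists N => //; rewrite /A/= in_itv/=; apply/andP; split; lra.
have AS n x : A n x -> x \in `]a, b[.
  move=> Anx; have : (\bigcup_n A n) x by exists n.
  by rewrite AE.
have ndA : nondecreasing_seq A.
  apply/nondecreasing_seqP => n; rewrite subsetEset; apply: subset_itv; rewrite bnd_simp.
  - rewrite lerD2l /h ler_wpM2l//; first lra.
    by rewrite /harmonic/= lef_pV2 ?posrE ?ltr0n// ler_nat.
  - rewrite lerD2l lerN2 /h ler_wpM2l//; first lra.
    by rewrite /harmonic/= lef_pV2 ?posrE ?ltr0n// ler_nat.
have := @ge0_nondecreasing_set_cvg_integral _ (measurableTypeR R) R A (EFin \o f) mu ndA
  (fun _ => measurable_itv _).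
rewrite AE => /(_ _ _)/cvg_lim <-//; last 2 first.
- move=> n; apply/measurable_EFinP; apply: measurable_funS mf => // x /AS.
  by rewrite /= !in_itv.
- by move=> n x /AS /f0; rewrite lee_fin.
have IA n : (\int[mu]_(x in A n) (EFin \o f) x = (F (b - h n) - F (a + h n))%:E)%E.
  have an : a + h n < b - h n by have := h1 n; lra.
  have cfn : {within `[a + h n, b - h n], continuous f}.
    by apply: open_cts_within cf; have := h0 n; lra.
  have cFn : {within `[a + h n, b - h n], continuous F}.
    apply: continuous_subspaceW cF.
    by apply: subset_itv; rewrite bnd_simp; have := h0 n; lra.
  have dFn x : x \in `]a + h n, b - h n[ -> is_derive x 1 F (f x).
    move=> xA; apply: dF; apply: (AS n).
    by move: xA; rewrite /A/= !in_itv/= => /andP[/ltW-> /ltW->].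
  exact: (FTC_cc an cfn cFn dFn).
have [_ Fa Fb] := (continuous_within_itvP _ ab).1 cF.
have cFa : F (a + h n) @[n --> \oo] --> F a.
  move/cvg_at_rightP : Fa; apply; split=> [n|].
    by rewrite ltrDl.
  rewrite -[X in _ --> X]addr0; apply: cvgD; first exact: cvg_cst.
  rewrite -[X in _ --> X](mulr0 ((b - a) / 3)).
  by apply: cvgMr; exact: cvg_harmonic.
have cFb : F (b - h n) @[n --> \oo] --> F b.
  move/cvg_at_leftP : Fb; apply; split=> [n|].
    by rewrite gtrBl.
  rewrite -[X in _ --> X]subr0; apply: cvgB; first exact: cvg_cst.
  rewrite -[X in _ --> X](mulr0 ((b - a) / 3)).
  by apply: cvgMr; exact: cvg_harmonic.
apply/cvg_lim => //.
under eq_cvg do rewrite IA.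
by apply: cvg_EFin; [exact: nearW|exact: cvgB].
Qed.

(** Subtracting k leaves a nonnegative integrand, and the integrability of f
follows from the formula itself, because F is finite at both end points.  The
lemma is meant for eta + eta'^2, which is bounded below by the minimum of eta
even where eta' is unbounded. *)
Lemma FTC_lower_bounded F f a b k : a < b ->
  (forall x, x \in `]a, b[ -> k <= f x) ->
  (forall x, x \in `]a, b[ -> {for x, continuous f}) ->
  {within `[a, b], continuous F} ->
  (forall x, x \in `]a, b[ -> is_derive x 1 F (f x)) ->
  mu.-integrable `[a, b] (EFin \o f) /\
  \int[mu]_(x in `[a, b]) f x = F b - F a.
Proof.
move=> ab fk cf cF dF.
have E : (\int[mu]_(x in `[a, b]) (f x - k)%:E =
          ((F b - k * b) - (F a - k * a))%:E)%E.
  apply: (@ge0_FTC_oo (fun x => F x - k * x) (fun x => f x - k)) => //.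
  - by move=> x /fk; rewrite subr_ge0.
  - by move=> x /cf cfx; apply: continuousB => //; exact: cst_continuous.
  - move=> x; apply: continuousB; first exact: cF.
    apply: continuous_subspaceT => y.
    apply: (@is_derive_continuous _ (fun x => k * x) y _); exact: (derZ k (der_id y)).
  - by move=> x xab; have := derB (dF x xab) (derZ k (der_id x)); rewrite mulr1.
have mf : measurable_fun `[a, b] f by exact: open_cts_measurable.
have ki : mu.-integrable `[a, b] (EFin \o cst k).
  apply: continuous_compact_integrable; first exact: segment_compact.
  by apply: continuous_subspaceT => y; exact: cst_continuous.
have fki : mu.-integrable `[a, b] (EFin \o (fun x => f x - k)).
  have mfk : measurable_fun `[a, b] (EFin \o (fun x => f x - k)).
    by apply/measurable_EFinP; apply: measurable_funB.
  apply/integrableP; split => //.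
  suff -> : (\int[mu]_(x in `[a, b]) `|(EFin \o (fun x => f x - k)%R) x| =
             \int[mu]_(x in `[a, b]) (f x - k)%:E)%E by rewrite E ltry.
  rewrite [LHS](@integral_itv_bndoo _ _ _ _ true false); last first.
    apply: (@measurable_funS _ _ _ _ `[a, b]) => //; first exact: subset_itv_oo_cc.
    exact: measurableT_comp.
  rewrite [RHS](@integral_itv_bndoo _ _ _ _ true false); last first.
    by apply: (@measurable_funS _ _ _ _ `[a, b]) => //; exact: subset_itv_oo_cc.
  apply: eq_integral => x; rewrite inE/= => /fk fkx.
  by rewrite ger0_norm// subr_ge0.
have fi : mu.-integrable `[a, b] (EFin \o f).
  have := integrableD _ fki ki => /(_ (measurable_itv _)).
  by apply: eq_integrable => // x _ /=; rewrite -EFinD subrK.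
split=> //.
have := E; rewrite [in RHS](_ : _ - _ = F b - F a - k * (b - a)); last by ring.
move=> /(congr1 fine); rewrite -[LHS]/(\int[mu]_(x in `[a, b]) (f x - k)).
rewrite (RintegralB _ fi ki)// Rintegral_cst//= lebesgue_measure_itv/= lte_fin ab /=.
by lra.
Qed.

(** The primitive that vanishes at 0.  The integrals start from - M, and not
from 0, so that one formula covers both signs of x. *)
Definition antiderivative f (M x : R) : R :=
  \int[mu]_(t in `[- M, x]) f t - \int[mu]_(t in `[- M, 0]) f t.

Lemma antiderivative0 f M : antiderivative f M 0 = 0.
Proof. exact: subrr. Qed.

Lemma is_derive_antiderivative f M x : continuous f -> x \in `]- M, M[ ->
  is_derive x 1 (antiderivative f M) (f x).
Proof.
move=> cf; rewrite in_itv/= => /andP[Mx xM].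
have fi : mu.-integrable `[- M, M] (EFin \o f).
  apply: continuous_compact_integrable; first exact: segment_compact.
  by apply: continuous_subspaceT => y; exact: cf.
have [] := continuous_FTC1_closed xM fi Mx (cf x).
move=> /derivable_is_derive1 + E; rewrite E => dF; rewrite -[f x]subr0.
by apply: derB => //; exact: derC.
Qed.

End integration.

(** * Inverse functions and periodic extensions *)

Section inverse.
Context {R : realType}.
Implicit Types (f g F G : R -> R) (a b x : R).

(** The derivative of F may vanish at a and at b; the inverse is then still
continuous there, with an infinite slope. *)
Lemma inverse_of_increasing F f a b : a < b ->
  {within `[a, b], continuous F} ->
  (forall x, x \in `]a, b[ -> is_derive x 1 F (f x)) ->
  (forall x, x \in `]a, b[ -> 0 < f x) ->
  exists G,
    [/\ {in `[a, b], cancel F G}, {in `[F a, F b], cancel G F},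
        {within `[F a, F b], continuous G},
        {in `[F a, F b], forall y, G y \in `[a, b]} &
        {in `]F a, F b[, forall y, (G y \in `]a, b[) /\
           is_derive y 1 G ((f (G y))^-1)}].
Proof.
move=> ab cF dF f0.
have Finc : {in `[a, b] &, {homo F : x y / x < y}}.
  apply: gtr0_derive1_lt_cc => //.
  - by move=> x /dF [].
  - by move=> x xab; rewrite (is_derive_derive1E (dF x xab)) f0.
have Fmono : {in `[a, b] &, {mono F : x y / x <= y}} by exact: le_mono_in.
have Fsurj y : y \in `[F a, F b] -> exists2 x, x \in `[a, b] & F x = y.
  rewrite in_itv/= => yab; apply: IVT => //; first exact: ltW.
  have := Finc a b; rewrite !in_itv/= !lexx (ltW ab) => /(_ isT isT ab) Fab.
  by rewrite (min_idPl (ltW Fab)) (max_idPr (ltW Fab)).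
pose G y := get [set x | x \in `[a, b] /\ F x = y].
have GP y : y \in `[F a, F b] -> G y \in `[a, b] /\ F (G y) = y.
  move=> /Fsurj[x xab Fxy].
  by have := @getI _ [set x | x \in `[a, b] /\ F x = y] x (conj xab Fxy).
have FI x : x \in `[a, b] -> F x \in `[F a, F b].
  move=> xab; have := xab; rewrite !in_itv/= => /andP[ax xb].
  by rewrite !Fmono ?ax ?xb// in_itv/= ?lexx ?(ltW ab).
have FK : {in `[a, b], cancel F G}.
  move=> x xab; have [GI FG] := GP _ (FI x xab).
  by apply: (inc_inj_in Fmono).
exists G; split=> //.
- by move=> y /GP[].
- exact: (segment_can_le_continuous (ltW ab) cF FK).
- by move=> y /GP[].
move=> y yab.
have yab' : y \in `[F a, F b] by move: yab; rewrite !in_itv/= => /andP[/ltW-> /ltW->].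
have [GI FG] := GP y yab'.
have Gab : G y \in `]a, b[.
  move: GI yab; rewrite !in_itv/= => /andP[aG Gb] /andP[ay yb].
  rewrite !lt_neqAle aG Gb !andbT; apply/andP; split; apply/negP => /eqP E.
    by move: ay; rewrite -FG -E ltxx.
  by move: yb; rewrite -FG E ltxx.
split=> //; rewrite -{1}FG; apply: is_derive_inverse => //.
- have : \forall x \near G y, x \in `]a, b[ by exact: near_in_itvoo.
  by apply: filterS => x xab; apply: FK; move: xab; rewrite !in_itv/= => /andP[/ltW-> /ltW->].
- have : \forall x \near G y, x \in `]a, b[ by exact: near_in_itvoo.
  by apply: filterS => x xab; exact: (is_derive_continuous (dF x xab)).
- exact: dF.
- by rewrite gt_eqF// f0.
Qed.

End inverse.

Section wrap.
Context {R : realType}.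
Implicit Types (f g F G : R -> R) (a b x : R).

(** acos (- cos u) is the distance from u to the nearest trough, the troughs
being the points of pi + 2 pi Z.  So wrap g is the even 2 pi-periodic function
whose value at distance v from the trough is g v. *)
Definition wrap g u := g (acos (- cos u)).

Lemma wrap_even g u : wrap g (- u) = wrap g u.
Proof. by rewrite /wrap cosN. Qed.

Lemma wrap_periodic g : periodic (wrap g) (2 * pi).
Proof. by move=> u; rewrite /wrap mulr_natl cosD2pi. Qed.

Lemma wrapE g u : 0 <= u <= 2 * pi -> wrap g u = g `|u - pi|.
Proof.
move=> /andP[u0 u2]; rewrite /wrap; congr g.
rewrite -[LHS](_ : acos (cos `|u - pi|) = _); last first.
  by rewrite cos_norm cosB cospi sinpi; congr acos; ring.
rewrite cosK// in_itv/= normr_ge0/= ler_norml.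
by apply/andP; split; lra.
Qed.

Lemma periodicz f k u : periodic f (2 * pi) -> f (u + 2 * pi * k%:~R) = f u.
Proof.
move=> pf; case: k => n.
  by rewrite -[n%:~R]/(n%:R) mulr_natr periodicn.
rewrite NegzE mulrNz mulrN -[n.+1%:~R]/(n.+1%:R) mulr_natr.
by rewrite -[in RHS](subrK (2 * pi *+ n.+1) u) periodicn.
Qed.

Lemma reduce_mod_period (u : R) : exists k : int, `|u - 2 * pi * k%:~R| <= pi.
Proof.
have pi0 := @pi_gt0 R.
exists (Num.floor ((u + pi) / (2 * pi))).
have /andP[h1 h2] := floor_itv ((u + pi) / (2 * pi)).
move: h1 h2; rewrite intrD ler_pdivlMr ?mulr_gt0// ltr_pdivrMr ?mulr_gt0//.
set k := (Num.floor _)%:~R; rewrite ler_norml => h1 h2.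
by apply/andP; split; lra.
Qed.

Lemma periodic_derive1 f : periodic f (2 * pi) -> periodic (derive1 f) (2 * pi).
Proof.
move=> pf u; rewrite /derive1; congr (lim _).
suff -> : (fun h : R => h^-1 *: (f (h + (u + 2 * pi)) - f (u + 2 * pi))) =
          (fun h : R => h^-1 *: (f (h + u) - f u)) by [].
by apply/funext => h; rewrite addrA !pf.
Qed.

Lemma periodic_derive1n f n : periodic f (2 * pi) -> periodic (derive1n n f) (2 * pi).
Proof.
by move=> pf; elim: n => // n IH; rewrite derive1nS; exact: periodic_derive1.
Qed.

Lemma periodic_derivable f k u : periodic f (2 * pi) ->
  derivable f u 1 -> derivable f (u + 2 * pi * k%:~R) 1.
Proof.
move=> pf; rewrite /derivable.
suff -> : (fun h : R => h^-1 *: (f (h *: 1 + (u + 2 * pi * k%:~R)) - f (u + 2 * pi * k%:~R))) =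
          (fun h : R => h^-1 *: (f (h *: 1 + u) - f u)) by [].
by apply/funext => h; rewrite addrA !periodicz.
Qed.

Lemma periodic_continuous f k u : periodic f (2 * pi) ->
  {for u, continuous f} -> {for u + 2 * pi * k%:~R, continuous f}.
Proof.
move=> pf cf.
rewrite [f](_ : _ = f \o (fun x => x - 2 * pi * k%:~R)); last first.
  apply/funext => x /=; rewrite -mulrN -mulrNz periodicz//.
apply: continuous_comp; last by rewrite addrK.
by apply: (@is_derive_continuous _ _ _ _); exact: (derB (der_id _) (derC _ _)).
Qed.

Lemma class_C_periodic k f (D E : set R) : periodic f (2 * pi) ->
  class_C k D f -> (forall u, E u -> exists j : int, D (u + 2 * pi * j%:~R)) ->
  class_C k E f.
Proof.
move=> pf CD ED u /ED[j] /CD[h1 h2].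
have uE : u = u + 2 * pi * j%:~R + 2 * pi * (- j)%:~R.
  by rewrite mulrNz mulrN addrK.
split=> n nk; rewrite uE.
  by apply: periodic_derivable; [exact: periodic_derive1n|exact: h1].
by apply: periodic_continuous; [exact: periodic_derive1n|exact: h2].
Qed.

Lemma wave_eq_periodic c f k u : periodic f (2 * pi) ->
  wave_eq c f (u + 2 * pi * k%:~R) -> wave_eq c f u.
Proof.
move=> pf; rewrite /wave_eq (periodicz _ _ pf).
rewrite (periodicz _ _ (periodic_derive1 pf)).
by rewrite (periodicz _ _ (periodic_derive1n 2 pf)).
Qed.

End wrap.

(** * The half period as a function of the parameter *)

Section halfperiod.
Context {R : realType}.
Implicit Types (m x t : R).

(** With eta = - (m c^2 / 2) cos tau, the first integral of the wave equation
reads c * period_density m tau * tau' = 1.  Num.sqrt is 0 on negative numbers,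
so for m > 1 the density vanishes on the phases beyond the critical level. *)
Definition period_density m t : R := Num.sqrt (1 + m * cos t).
(** The bound 3 pi leaves a margin around [- 2 pi, 2 pi], which contains all
the phases that occur. *)
Definition period_int m : R -> R := antiderivative (period_density m) (3 * pi).
(** The distance from the trough to the crest for the speed 1.  For the speed c
it is c * half_period m, which has to be pi. *)
Definition half_period m : R := period_int m pi.

Lemma continuous_period_density m : continuous (period_density m).
Proof.
move=> t; apply: (@continuous_comp _ _ _ (fun t => 1 + m * cos t) Num.sqrt).
  exact: (is_derive_continuous (derD (derC 1 t) (derZ m (is_derive_cos t)))).
exact: sqrt_continuous.
Qed.

Lemma period_density_ge0 m t : 0 <= period_density m t.
Proof. exact: sqrtr_ge0. Qed.

Lemma period_int0 m : period_int m 0 = 0.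
Proof. exact: antiderivative0. Qed.

Lemma der_period_int m x : - (3 * pi) < x < 3 * pi -> is_derive x 1 (period_int m) (period_density m x).
Proof.
move=> xp; apply: is_derive_antiderivative; last by rewrite in_itv.
exact: continuous_period_density.
Qed.

Lemma der_period_int_comp m (f : R -> R) x a : - (3 * pi) < f x < 3 * pi ->
  is_derive x 1 f a -> is_derive x 1 (fun t => period_int m (f t)) (period_density m (f x) * a).
Proof. by move=> fx df; apply: dercomp df _; exact: der_period_int. Qed.

Lemma period_int_within m a b : - (3 * pi) < a -> b < 3 * pi ->
  {within `[a, b], continuous (period_int m)}.
Proof.
move=> pa bp; apply: (@der_within _ _ (period_density m)) => x; rewrite in_itv/= => /andP[ax xb].
by apply: der_period_int; rewrite (lt_le_trans pa ax) (le_lt_trans xb bp).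
Qed.

Lemma period_int_odd m x : 0 <= x < 3 * pi -> period_int m (- x) = - period_int m x.
Proof.
move=> /andP[x0 xp].
have dF t : t \in `[0, x] -> is_derive t 1 (fun t => period_int m t + period_int m (- t)) 0.
  rewrite in_itv/= => /andP[t0 tx].
  have dn : is_derive t 1 (fun t : R => - t) (- 1) by exact: derN (der_id t).
  apply: is_derive_eq.
    by apply: derD; [apply: der_period_int|apply: der_period_int_comp dn]; apply/andP; split; lra.
  by rewrite /period_density cosN mulrN1 subrr.
have := der_cst_cc x0 dF; rewrite oppr0 period_int0 addr0 => E.
by apply/eqP; rewrite -addr_eq0 addrC E.
Qed.

Lemma period_int_reflect m x : 0 <= x <= 2 * pi ->
  period_int m (2 * pi - x) = 2 * half_period m - period_int m x.
Proof.
move=> /andP[x0 xp]; have pi0 := @pi_gt0 R.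
have dF t : t \in `[0, 2 * pi] ->
    is_derive t 1 (fun t => period_int m t + period_int m (2 * pi - t)) 0.
  rewrite in_itv/= => /andP[t0 tx].
  have dn : is_derive t 1 (fun t : R => 2 * pi - t) (0 - 1).
    exact: derB (derC _ t) (der_id t).
  apply: is_derive_eq.
    by apply: derD; [apply: der_period_int|apply: der_period_int_comp dn]; apply/andP; split; lra.
  have -> : period_density m (2 * pi - t) = period_density m t.
    by rewrite /period_density mulr_natl cosB cos2pi sin2pi mul1r mul0r addr0.
  by rewrite sub0r mulrN1 subrr.
have E y : 0 <= y <= 2 * pi ->
    period_int m y + period_int m (2 * pi - y) = period_int m 0 + period_int m (2 * pi - 0).
  move=> /andP[y0 yp].
  have dFy t : t \in `[0, y] ->
      is_derive t 1 (fun t => period_int m t + period_int m (2 * pi - t)) 0.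
    rewrite in_itv/= => /andP[t0 ty].
    have tpi : t \in `[0, 2 * pi] by rewrite in_itv/= t0 (le_trans ty).
    exact: (dF t tpi).
  exact: (der_cst_cc y0 dFy).
have := E x; have := E pi.
rewrite x0 xp (_ : 2 * pi - pi = pi :> R); last by lra.
move=> /(_ _)/[swap] /(_ isT) h1 /(_ _) h2.
have {h2} : period_int m pi + period_int m pi = period_int m 0 + period_int m (2 * pi - 0).
  by apply: h2; apply/andP; split; lra.
by rewrite /half_period; lra.
Qed.

Lemma period_int_le m (g G : R -> R) a b : - (3 * pi) < a -> a <= b -> b < 3 * pi ->
  (forall t, is_derive t 1 G (g t)) ->
  (forall t, a < t < b -> period_density m t <= g t) -> period_int m b - period_int m a <= G b - G a.
Proof.
move=> pa ab bp dG Kg.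
have cG : {within `[a, b], continuous G} by exact: (@der_withinT _ _ _ a b dG).
have dP x : x \in `]a, b[ -> is_derive x 1 (period_int m) (period_density m x).
  rewrite in_itv/= => /andP[ax xb]; apply: der_period_int.
  by rewrite (lt_trans pa ax) (lt_trans xb bp).
have dG' x : x \in `]a, b[ -> is_derive x 1 G (g x) by [].
apply: (der_le ab (period_int_within pa bp) cG dP dG') => x.
by rewrite in_itv/=; exact: Kg.
Qed.

Lemma period_int_ndecr m x y : - (3 * pi) < x -> x <= y -> y < 3 * pi ->
  period_int m x <= period_int m y.
Proof.
move=> x3 xy y3.
have dP t : t \in `]x, y[ -> is_derive t 1 (period_int m) (period_density m t).
  by rewrite in_itv/= => /andP[? ?]; apply: der_period_int; apply/andP; split; lra.
exact: (der_ge0 xy (period_int_within x3 y3) dP (fun t _ => period_density_ge0 m t)).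
Qed.

Lemma period_int_flat m x y : - (3 * pi) < x -> x <= y -> y < 3 * pi ->
  (forall t, x < t < y -> 1 + m * cos t <= 0) -> period_int m y = period_int m x.
Proof.
move=> x3 xy y3 neg.
have dP t : t \in `]x, y[ -> is_derive t 1 (period_int m) 0.
  rewrite in_itv/= => tI; rewrite -[X in is_derive _ _ _ X](ler0_sqrtr (neg t tI)).
  by apply: der_period_int; move: tI => /andP[? ?]; apply/andP; split; lra.
exact: (der_cst xy (period_int_within x3 y3) dP).
Qed.

Lemma half_period0 : half_period 0 = pi.
Proof.
have pi0 := @pi_gt0 R.
have dF t : t \in `[0, pi] -> is_derive t 1 (fun t => period_int 0 t - t) 0.
  rewrite in_itv/= => /andP[t0 tx]; apply: is_derive_eq.
    by apply: derB (der_id t); apply: der_period_int; apply/andP; split; lra.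
  by rewrite /period_density mul0r addr0 sqrtr1 subrr.
have := der_cst_cc (ltW pi0) dF; rewrite period_int0 subrr => E.
by apply/eqP; rewrite -subr_eq0; exact/eqP.
Qed.

Lemma period_density1E t : 0 <= t <= pi -> period_density 1 t = Num.sqrt 2 * cos (t / 2).
Proof.
move=> /andP[t0 tp].
have c0 : 0 <= cos (t / 2).
  by apply: cos_ge0_pihalf; apply/andP; split; have := @pi_gt0 R; lra.
rewrite /period_density mul1r -[X in cos X](_ : t / 2 *+ 2 = t); last by rewrite -mulr_natr; field.
rewrite cos_mulr2n addrC subrK -mulr_natl sqrtrM// sqrtr_sqr ger0_norm//.
Qed.

Lemma der_sin_half t : is_derive t 1 (fun t : R => sin (t / 2)) (cos (t / 2) / 2).
Proof.
have dh : is_derive t 1 (fun t : R => t / 2) (1 * 2^-1 + t * 0).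
  exact: derM (der_id t) (derC _ t).
by apply: (is_derive_eq (dercomp dh (is_derive_sin _))); field.
Qed.

Lemma period_int1E x : 0 <= x <= pi -> period_int 1 x = 2 * Num.sqrt 2 * sin (x / 2).
Proof.
move=> /andP[x0 xp]; have pi0 := @pi_gt0 R.
pose F t : R := period_int 1 t - 2 * Num.sqrt 2 * sin (t / 2).
have dF t : t \in `[0, x] -> is_derive t 1 F 0.
  rewrite in_itv/= => /andP[t0 tx].
  have tp : - (3 * pi) < t < 3 * pi by apply/andP; split; lra.
  apply: (is_derive_eq (derB (@der_period_int 1 t tp) (derZ (2 * Num.sqrt 2) (der_sin_half t)))).
  rewrite period_density1E; last by rewrite t0/=; lra.
  by field.
have := der_cst_cc x0 dF; rewrite /F period_int0 mul0r sin0 mulr0 subrr => E.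
by apply/eqP; rewrite -subr_eq0; exact/eqP.
Qed.

Lemma half_period1 : half_period 1 = 2 * Num.sqrt 2.
Proof.
rewrite /half_period period_int1E; last by rewrite lexx pi_ge0.
by rewrite sin_pihalf mulr1.
Qed.

(** The square of sqrt(1 + x) + sqrt(1 - x) is 2 + 2 sqrt(1 - x^2), which
decreases on [0, 1] at least as fast as - x^2. *)
Lemma sqrt_fold (y z : R) : 0 <= y -> y <= z -> z <= 1 ->
  (z ^+ 2 - y ^+ 2) / 4 <=
  (Num.sqrt (1 + y) + Num.sqrt (1 - y)) - (Num.sqrt (1 + z) + Num.sqrt (1 - z)).
Proof.
move=> y0 yz z1.
have sq (u : R) : 0 <= u -> 0 <= Num.sqrt u /\ Num.sqrt u ^+ 2 = u.
  by move=> u0; rewrite sqrtr_ge0 sqr_sqrtr.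
have [p0 pE] : 0 <= Num.sqrt (1 + y) /\ Num.sqrt (1 + y) ^+ 2 = 1 + y by apply: sq; lra.
have [q0 qE] : 0 <= Num.sqrt (1 - y) /\ Num.sqrt (1 - y) ^+ 2 = 1 - y by apply: sq; lra.
have [r0 rE] : 0 <= Num.sqrt (1 + z) /\ Num.sqrt (1 + z) ^+ 2 = 1 + z by apply: sq; lra.
have [s0 sE] : 0 <= Num.sqrt (1 - z) /\ Num.sqrt (1 - z) ^+ 2 = 1 - z by apply: sq; lra.
move: (Num.sqrt (1 + y)) (Num.sqrt (1 - y)) (Num.sqrt (1 + z)) (Num.sqrt (1 - z))
  p0 pE q0 qE r0 rE s0 sE => p q r s p0 pE q0 qE r0 rE s0 sE.
have pq2 : (p * q) ^+ 2 = 1 - y ^+ 2 by rewrite exprMn pE qE; ring.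
have rs2 : (r * s) ^+ 2 = 1 - z ^+ 2 by rewrite exprMn rE sE; ring.
have yz2 : y ^+ 2 <= z ^+ 2 by rewrite ler_sqr ?nnegrE//; lra.
have pqrs : r * s <= p * q.
  by rewrite -(ler_sqr (mulr_ge0 r0 s0) (mulr_ge0 p0 q0)) pq2 rs2; lra.
have pq1 : p * q <= 1.
  have : 0 <= (p - q) ^+ 2 by exact: sqr_ge0.
  by rewrite sqrrB pE qE -mulr_natl; lra.
have h1 : z ^+ 2 - y ^+ 2 <= 2 * (p * q - r * s).
  have -> : z ^+ 2 - y ^+ 2 = (p * q + r * s) * (p * q - r * s).
    by rewrite mulrC -subr_sqr pq2 rs2; ring.
  by rewrite ler_wpM2r ?subr_ge0//; lra.
have h2 : 2 * (p * q - r * s) = (p + q - (r + s)) * (p + q + r + s).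
  have -> : (p + q - (r + s)) * (p + q + r + s) =
    (p ^+ 2 + q ^+ 2) - (r ^+ 2 + s ^+ 2) + 2 * (p * q - r * s) by ring.
  by rewrite pE qE rE sE; ring.
have pq4 : p + q <= 2.
  have : 0 <= (p - q) ^+ 2 by exact: sqr_ge0.
  have : (p + q) ^+ 2 + (p - q) ^+ 2 = 2 * (p ^+ 2 + q ^+ 2) by ring.
  rewrite pE qE => h3 h4.
  by rewrite -ler_sqr ?nnegrE ?addr_ge0//; lra.
have rs4 : r + s <= 2.
  have : 0 <= (r - s) ^+ 2 by exact: sqr_ge0.
  have : (r + s) ^+ 2 + (r - s) ^+ 2 = 2 * (r ^+ 2 + s ^+ 2) by ring.
  rewrite rE sE => h3 h4.
  by rewrite -ler_sqr ?nnegrE ?addr_ge0//; lra.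
have rspq : r + s <= p + q.
  have e1 : (p + q) ^+ 2 = p ^+ 2 + q ^+ 2 + 2 * (p * q) by ring.
  have e2 : (r + s) ^+ 2 = r ^+ 2 + s ^+ 2 + 2 * (r * s) by ring.
  rewrite -(ler_sqr (addr_ge0 r0 s0) (addr_ge0 p0 q0)) e1 e2 pE qE rE sE; lra.
by nra.
Qed.

(** Folding t onto pi - t makes half_period m the integral over [0, pi / 2]
of sqrt(1 + x) + sqrt(1 - x) at x = m cos t, which decreases with m.  By
sqrt_fold the decrease is at least (m'^2 - m^2) / 4 times the integral of
(cos t)^2, which is pi / 4. *)
Lemma half_period_decr m m' : 0 <= m -> m <= m' -> m' <= 1 ->
  (m' ^+ 2 - m ^+ 2) * pi / 16 <= half_period m - half_period m'.
Proof.
move=> m0 mm' m1; have pi0 := @pi_gt0 R.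
(* L m is a primitive of the folded density, F of the lower bound of sqrt_fold *)
pose L m t : R := period_int m t - period_int m (pi - t).
have dL k t : t \in `[0, pi / 2] ->
    is_derive t 1 (L k) (Num.sqrt (1 + k * cos t) + Num.sqrt (1 - k * cos t)).
  rewrite in_itv/= => /andP[t0 tx].
  have dn : is_derive t 1 (fun t : R => pi - t) (0 - 1).
    exact: derB (derC _ t) (der_id t).
  apply: is_derive_eq.
    by apply: derB; [apply: der_period_int|apply: der_period_int_comp dn]; apply/andP; split; lra.
  rewrite /period_density cosB cospi sinpi; set c := cos t.
  by rewrite mul0r addr0 mulN1r mulrN; ring.
have LE k : L k (pi / 2) - L k 0 = half_period k.
  rewrite /L (_ : pi - pi / 2 = pi / 2 :> R); last by field.
  by rewrite period_int0 subr0 /half_period; ring.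
pose F t : R := (m' ^+ 2 - m ^+ 2) / 4 * ((t + sin t * cos t) / 2).
have dF t : is_derive t 1 F ((m' ^+ 2 - m ^+ 2) / 4 * cos t ^+ 2).
  apply: derZ.
  have d1 := derD (der_id t) (derM (is_derive_sin t) (is_derive_cos t)).
  apply: (is_derive_eq (derM d1 (derC 2^-1 t))).
  rewrite mulr0 addr0 (_ : sin t * - sin t = - sin t ^+ 2); last by ring.
  by rewrite sin2cos2; field.
have dLo k t : t \in `]0, pi / 2[ ->
    is_derive t 1 (L k) (Num.sqrt (1 + k * cos t) + Num.sqrt (1 - k * cos t)).
  move=> tx; apply: dL; move: tx; rewrite !in_itv/= => /andP[/ltW-> /ltW->] //.
have cF : {within `[0, pi / 2], continuous F}.
  exact: (@der_withinT _ _ _ 0 (pi / 2) dF).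
have cL : {within `[0, pi / 2], continuous (fun t => L m t - L m' t)}.
  exact: (@der_within _ (fun t => L m t - L m' t) _ _ _ (fun x xab => derB (dL m x xab) (dL m' x xab))).
have p2 : 0 <= pi / 2 :> R by lra.
have : F (pi / 2) - F 0 <= (L m (pi / 2) - L m' (pi / 2)) - (L m 0 - L m' 0).
  apply: (der_le p2 cF cL (fun t _ => dF t)
    (fun t tx => derB (dLo m t tx) (dLo m' t tx))) => t.
  rewrite in_itv/= => /andP[t0 tp].
  have c0 : 0 <= cos t by apply: cos_ge0_pihalf; apply/andP; split; lra.
  have c1 := @cos_le1 R t.
  have := @sqrt_fold (m * cos t) (m' * cos t).
  rewrite !exprMn => /(_ (mulr_ge0 m0 c0) (ler_wpM2r c0 mm')) h.
  have h1 : m' * cos t <= 1 by rewrite mulr_ile1//; lra.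
  by apply: le_trans (h h1); rewrite -mulrBl; lra.
rewrite /F sin_pihalf cos_pihalf sin0 => h.
by have := LE m; have := LE m'; lra.
Qed.

(** The square root extended by 0 to negative numbers is still
1/2-Hoelder with constant 1. *)
Lemma sqrt_dist (x y : R) : Num.sqrt x <= Num.sqrt y + Num.sqrt `|x - y|.
Proof.
have [x0|x0] := leP x 0; first by rewrite (ler0_sqrtr x0) addr_ge0// sqrtr_ge0.
have s0 : 0 <= Num.sqrt y + Num.sqrt `|x - y| by rewrite addr_ge0// sqrtr_ge0.
rewrite -ler_sqr ?nnegrE ?sqrtr_ge0// (sqr_sqrtr (ltW x0)) sqrrD (sqr_sqrtr (normr_ge0 _)).
have h1 : 0 <= Num.sqrt y * Num.sqrt `|x - y| by rewrite mulr_ge0// sqrtr_ge0.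
have h2 : y <= Num.sqrt y ^+ 2.
  have [y0|y0] := leP y 0; first by rewrite (le_trans y0)// sqr_ge0.
  by rewrite sqr_sqrtr// ltW.
have h3 := ler_norm (x - y).
by rewrite mulr2n; lra.
Qed.

(** The Hoelder bound on the square root is uniform in its argument, so that
nothing special happens at m = 1, from where on the density has a zero. *)
Lemma half_period_dist m m' : half_period m - half_period m' <= pi * Num.sqrt `|m - m'|.
Proof.
have pi0 := @pi_gt0 R; set d := Num.sqrt `|m - m'|.
have dP k x : x \in `[0, pi] -> is_derive x 1 (period_int k) (period_density k x).
  by rewrite in_itv/= => /andP[x0 xp]; apply: der_period_int; apply/andP; split; lra.
have dPo k x : x \in `]0, pi[ -> is_derive x 1 (period_int k) (period_density k x).
  by rewrite in_itv/= => /andP[x0 xp]; apply: der_period_int; apply/andP; split; lra.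
have dG x : x \in `]0, pi[ ->
    is_derive x 1 (fun t => period_int m' t + d * t) (period_density m' x + d * 1).
  by move=> xp; exact: (derD (dPo m' x xp) (derZ d (der_id x))).
have cG : {within `[0, pi], continuous (fun t => period_int m' t + d * t)}.
  exact: (@der_within _ (fun t => period_int m' t + d * t) _ _ _ (fun x xp => derD (dP m' x xp) (derZ d (der_id x)))).
suff : period_int m pi - period_int m 0 <= period_int m' pi + d * pi - (period_int m' 0 + d * 0).
  by rewrite !period_int0 /half_period; lra.
apply: (der_le (ltW pi0) (der_within (dP m)) cG (dPo m) dG) => x _.
  rewrite mulr1; apply: le_trans (sqrt_dist _ (1 + m' * cos x)) _.
  rewrite lerD2l ler_wsqrtr// (_ : _ - _ = (m - m') * cos x); last by ring.
  by rewrite normrM ler_piMr// cos_max.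
Qed.

Lemma continuous_half_period : continuous half_period.
Proof.
move=> m; apply/cvgrPdist_lt => e e0.
have pi0 := @pi_gt0 R.
have d0 : 0 < (e / pi) ^+ 2 by rewrite exprn_gt0// divr_gt0.
near=> m'.
have md : `|m - m'| < (e / pi) ^+ 2.
  by near: m'; exact: (@cvgr_dist_lt _ _ _ (nbhs m) _ id m (@cvg_id _ _) _ d0).
have sd : Num.sqrt `|m - m'| < e / pi.
  rewrite -(@ger0_norm _ (e / pi)); last by rewrite ltW// divr_gt0.
  by rewrite -[`|e / pi|]sqrtr_sqr ltr_sqrt.
have h1 := half_period_dist m m'; have := half_period_dist m' m; rewrite distrC => h2.
have : pi * Num.sqrt `|m - m'| < e by rewrite mulrC -ltr_pdivlMr.
by rewrite ltr_norml => h; apply/andP; split; lra.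
Unshelve. all: by end_near. Qed.

Lemma der_le_from0 (F G f g : R -> R) x : 0 <= x ->
  (forall t, is_derive t 1 F (f t)) -> (forall t, is_derive t 1 G (g t)) ->
  (forall t, 0 < t -> f t <= g t) -> F x - F 0 <= G x - G 0.
Proof.
move=> x0 dF dG fg.
have cF : {within `[0, x], continuous F} by exact: (@der_withinT _ _ _ 0 x dF).
have cG : {within `[0, x], continuous G} by exact: (@der_withinT _ _ _ 0 x dG).
apply: (der_le x0 cF cG (fun t _ => dF t) (fun t _ => dG t)) => t.
by rewrite in_itv/= => /andP[t0 _]; exact: fg.
Qed.

(** Obtained from cos <= 1 by integrating four times. *)
Lemma cos_le_taylor x : 0 <= x -> cos x <= 1 - x ^+ 2 / 2 + x ^+ 4 / 24.
Proof.
have dm t : is_derive t 1 (fun t : R => - cos t) (sin t).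
  by rewrite -[sin t]opprK; apply: derN; exact: is_derive_cos.
have dp (k : R) n t : is_derive t 1 (fun t : R => t ^+ n.+1 * k) (n.+1%:R * t ^+ n * k).
  apply: (is_derive_eq (derM (derX n (der_id t)) (derC k t))); ring.
have sin_le t : 0 <= t -> sin t <= t.
  move=> t0; have := @der_le_from0 sin id cos (fun=> 1) t t0 (@is_derive_sin R) der_id
    (fun t _ => cos_le1 t).
  by rewrite sin0 !subr0.
have cos_ge t : 0 <= t -> 1 - t ^+ 2 / 2 <= cos t.
  move=> t0; have := @der_le_from0 _ _ _ _ t t0 dm (dp 2^-1 1%N).
  rewrite cos0 expr0n /= mul0r subr0 => h.
  suff : - cos t - -1 <= t ^+ 2 / 2 by lra.
  apply: h => s s0; rewrite expr1; have := sin_le s (ltW s0); lra.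
have sin_ge t : 0 <= t -> t - t ^+ 3 / 6 <= sin t.
  move=> t0; have := @der_le_from0 _ _ _ _ t t0
    (fun s => derB (der_id s) (dp 6^-1 2%N s)) (@is_derive_sin R).
  rewrite sin0 expr0n /= mul0r !subr0; apply => s s0.
  have := cos_ge s (ltW s0); lra.
move=> x0; have := @der_le_from0 _ _ _ _ x x0
  (fun s => derB (dp 2^-1 1%N s) (dp 24^-1 3%N s)) dm.
rewrite cos0 !expr0n /= !mul0r !subr0 => h.
suff : x ^+ 2 / 2 - x ^+ 4 / 24 <= - cos x - -1 by lra.
apply: h => s s0; rewrite expr1; have := sin_ge s (ltW s0); lra.
Qed.

Lemma cos_pi4 : 0 < cos (pi / 4 : R) /\ 2 * cos (pi / 4 : R) ^+ 2 = 1.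
Proof.
have pi0 := @pi_gt0 R; split.
  by apply: cos_gt0_pihalf; apply/andP; split; lra.
have := @cos_mulr2n R (pi / 4).
rewrite (_ : pi / 4 *+ 2 = pi / 2); last by rewrite -mulr_natr; field.
by rewrite cos_pihalf -mulr_natl; lra.
Qed.

(** The Taylor bound gives 2 cos(0.79)^2 < 1 = 2 cos(pi / 4)^2, so
pi / 4 < 0.79. *)
Lemma pi_lt316 : (pi : R) < 316 / 100.
Proof.
rewrite ltNge; apply/negP => h.
have [c0 c2] := cos_pi4.
have := @cos_le_taylor (79 / 100); rewrite (_ : 0 <= 79 / 100 :> R); last by lra.
move=> /(_ isT) h1.
have : cos (pi / 4 : R) <= cos (79 / 100).
  have pi0 := @pi_gt0 R; rewrite le_eqVlt.
  have [->|ne] := eqVneq (pi / 4 : R) (79 / 100); first by rewrite eqxx.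
  apply/orP; right; rewrite ltr_cos ?in_itv/=; try by apply/andP; split; lra.
  by rewrite lt_neqAle eq_sym ne/=; lra.
by nra.
Qed.

Lemma sqrt2_bound : 1414 / 1000 < Num.sqrt (2 : R) /\ Num.sqrt (2 : R) ^+ 2 = 2.
Proof.
have s2 : Num.sqrt (2 : R) ^+ 2 = 2 by rewrite sqr_sqrtr.
by split=> //; rewrite -ltr_sqr ?nnegrE ?sqrtr_ge0 ?s2; lra.
Qed.

(** This inequality makes the interval of speeds of the cusped waves
nonempty.  For m = sqrt 2 the density vanishes beyond 3 pi / 4, and up to there
it is bounded by means of sqrt x <= (x / k + k) / 2 with k = 6 / 5, a value of
the order of the mean of sqrt x.  The resulting bound is less than 2 sqrt 2
because pi < 3.16. *)
Lemma half_period_sqrt2_lt : half_period (Num.sqrt 2) < 2 * Num.sqrt 2.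
Proof.
have pi0 := @pi_gt0 R; have [c0 c2] := cos_pi4; have pi3 := pi_lt316.
have [s1 s2] := sqrt2_bound.
have sc : Num.sqrt 2 * cos (pi / 4) = 1 :> R.
  have : (Num.sqrt 2 * cos (pi / 4)) ^+ 2 = 1 :> R by rewrite exprMn s2.
  have : 0 < Num.sqrt 2 * cos (pi / 4) :> R by rewrite mulr_gt0//; lra.
  by nra.
have E : 3 * pi / 4 = pi - pi / 4 :> R by field.
have s3 : sin (3 * pi / 4) = cos (pi / 4) :> R.
  rewrite E sinB sinpi cospi mul0r sub0r mulN1r opprK.
  rewrite (_ : pi / 4 = pi / 2 - pi / 4 :> R); last by field.
  rewrite [LHS]sinB sin_pihalf cos_pihalf mul1r mul0r subr0.
  by congr cos; field.
have c3 : cos (3 * pi / 4) = - cos (pi / 4) :> R.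
  by rewrite E cosB sinpi cospi mul0r addr0 mulN1r.
(* g is the bound (x / k + k) / 2 at x = 1 + sqrt 2 cos t, and G its primitive *)
pose g t : R := (1 + Num.sqrt 2 * cos t) * (5 / 12) + 3 / 5.
pose G t : R := (t + Num.sqrt 2 * sin t) * (5 / 12) + t * (3 / 5).
have dG t : is_derive t 1 G (g t).
  have d1 := derD (der_id t) (derZ (Num.sqrt 2) (is_derive_sin t)).
  apply: (is_derive_eq (derD (derM d1 (derC (5 / 12) t)) (derM (der_id t) (derC (3 / 5) t)))).
  by rewrite /g; ring.
have h1 : period_int (Num.sqrt 2) (3 * pi / 4) - period_int (Num.sqrt 2) 0 <= G (3 * pi / 4) - G 0.
  apply: period_int_le dG _; [lra|lra|lra|] => t _; rewrite /g /period_density.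
  set x := 1 + _; have [x0|x0] := leP x 0.
    have c1 := @cos_geN1 R t.
    have sc2 : Num.sqrt 2 <= 3 / 2 :> R by nra.
    have sct : - (3 / 2) <= Num.sqrt 2 * cos t by nra.
    by rewrite (ler0_sqrtr x0) /x; lra.
  have := sqr_ge0 (Num.sqrt x - 6 / 5); rewrite sqrrB (sqr_sqrtr (ltW x0)).
  by rewrite -mulr_natl; lra.
have h2 : period_int (Num.sqrt 2) pi = period_int (Num.sqrt 2) (3 * pi / 4).
  apply: period_int_flat; [lra|lra|lra|] => t /andP[t1 t2].
  have : cos t < cos (3 * pi / 4).
    by rewrite ltr_cos ?in_itv//=; apply/andP; split; lra.
  by rewrite c3 => h; nra.
move: h1 h2; rewrite /half_period /G period_int0 sin0 s3 sc; lra.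
Qed.

End halfperiod.

(** * Regularity from a polynomial first order system; the phase *)

Section jets.
Context {R : realType}.
Implicit Types (f g eta q kappa : R -> R) (a b c m t u v x : R) (D : set R).

(** The functions obtained from those of S and the constants by sums and
products.  By the product rule, they are stable under derivation as soon as the
derivatives of the functions of S are among them. *)
Inductive generated (S : set (R -> R)) : (R -> R) -> Prop :=
| generated_gen g : S g -> generated S g
| generated_cst k : generated S (fun=> k)
| generated_add g h : generated S g -> generated S h ->
    generated S (fun u => g u + h u)
| generated_mul g h : generated S g -> generated S h ->
    generated S (fun u => g u * h u).

Lemma generated_der (S : set (R -> R)) D :
  (forall g, S g -> exists2 h, generated S h & forall u, D u -> is_derive u 1 g (h u)) ->
  forall g, generated S g ->
    exists2 h, generated S h & forall u, D u -> is_derive u 1 g (h u).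
Proof.
move=> SD g; elim=> {g}.
- exact: SD.
- by move=> k; exists (fun=> 0); [exact: generated_cst|move=> u _; exact: derC].
- move=> g h _ [g' Sg' dg] _ [h' Sh' dh].
  exists (fun u => g' u + h' u); first exact: generated_add.
  by move=> u Du; exact: (derD (dg u Du) (dh u Du)).
- move=> g h Sg [g' Sg' dg] Sh [h' Sh' dh].
  exists (fun u => g' u * h u + g u * h' u).
    by apply: generated_add; exact: generated_mul.
  by move=> u Du; exact: (derM (dg u Du) (dh u Du)).
Qed.

(** The wave equation as a polynomial system of first order in eta,
q = sqrt(c^2 - 2 eta) eta' and kappa = 1 / sqrt(c^2 - 2 eta). *)
Definition jet c D eta q kappa := forall u, D u ->
  [/\ is_derive u 1 eta (q u * kappa u),
      is_derive u 1 q (- eta u * kappa u),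
      is_derive u 1 kappa (q u * kappa u ^+ 4),
      0 < kappa u &
      (c ^+ 2 - 2 * eta u) * kappa u ^+ 2 = 1].

Lemma jet_eq c D eta eta' q kappa : open D ->
  (forall u, D u -> eta' u = eta u) -> jet c D eta q kappa -> jet c D eta' q kappa.
Proof.
move=> oD E J u Du; have [d1 d2 d3 k0 w] := J u Du.
split; rewrite ?E//; apply: near_eq_is_derive d1.
by apply: filterS (open_nbhs_nbhs (conj oD Du)) => v /E.
Qed.

(** The algebra generated by eta, q and kappa is stable under derivation. *)
Lemma jet_class_C c D eta q kappa k : open D -> jet c D eta q kappa ->
  class_C k D eta.
Proof.
move=> oD J; pose S : set (R -> R) := [set eta; q; kappa].
have Seta : generated S eta by apply: generated_gen; left; left.
have Sq : generated S q by apply: generated_gen; left; right.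
have Sk : generated S kappa by apply: generated_gen; right.
apply: (@class_C_closed _ (generated S) D k eta eta oD) => //.
apply: generated_der => g [[->|->]|->].
- exists (fun u => q u * kappa u); first exact: generated_mul.
  by move=> u /J[].
- exists (fun u => -1 * (eta u * kappa u)).
    by apply: generated_mul; [exact: generated_cst|exact: generated_mul].
  by move=> u /J[_ + _ _ _]; rewrite mulN1r mulNr.
- exists (fun u => q u * ((kappa u * kappa u) * (kappa u * kappa u))).
    by do ?apply: generated_mul.
  move=> u /J[_ _ + _ _].
  by rewrite (_ : kappa u ^+ 4 = kappa u * kappa u * (kappa u * kappa u))//; ring.
Qed.

Lemma jet_derive1 c D eta q kappa u : jet c D eta q kappa -> D u ->
  derive1 eta u = q u * kappa u.
Proof. by move=> J /J[/is_derive_derive1E]. Qed.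

Lemma jet_wave_eq c D eta q kappa u : open D -> jet c D eta q kappa -> D u ->
  wave_eq c eta u.
Proof.
move=> oD J Du; rewrite /wave_eq.
have [d1 d2 d3 k0 w] := J u Du.
have d4 := derM d2 d3.
have -> : derive1n 2 eta u = - eta u * kappa u * kappa u + q u * (q u * kappa u ^+ 4).
  apply: is_derive_derive1E; apply: near_eq_is_derive d4.
  apply: filterS (open_nbhs_nbhs (conj oD Du)) => v Dv.
  by rewrite /= (jet_derive1 J).
rewrite (jet_derive1 J Du).
set W := c ^+ 2 - 2 * eta u in w *.
rewrite (_ : W * _ = (W * kappa u ^+ 2) * (- eta u + q u ^+ 2 * kappa u ^+ 2)); last by ring.
by rewrite w; ring.
Qed.

(** The flux - (c^2 - 2 eta) eta' equals - q / kappa, and the wave equation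
makes it a primitive of the integrand of the constraint. *)
Lemma jet_flux c D eta q kappa u : jet c D eta q kappa -> D u ->
  is_derive u 1 (fun u => - (q u / kappa u)) (eta u + derive1 eta u ^+ 2).
Proof.
move=> J Du; rewrite (jet_derive1 J Du); have [d1 d2 d3 k0 w] := J u Du.
have kn : kappa u != 0 by rewrite gt_eqF.
apply: (is_derive_eq (derN (derM d2 (derV kn d3)))).
by field.
Qed.

End jets.

Section profile.
Context {R : realType}.
Implicit Types (f g eta q kappa : R -> R) (a b c m t u v x : R) (D : set R).

(** tau is the inverse of c * period_int m, from [- B, B] onto [- b, b].
At - b and b the density may vanish, and then tau is not differentiable at
- B and B; this is why the derivative is given inside the interval only. *)
Definition is_phase c m b B (tau : R -> R) :=
  [/\ {in `[- b, b], forall t, tau (c * period_int m t) = t},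
      {in `[- B, B], forall v, c * period_int m (tau v) = v /\ tau v \in `[- b, b]},
      {within `[- B, B], continuous tau},
      {in `]- B, B[, forall v, (tau v \in `]- b, b[) /\
         is_derive v 1 tau ((c * period_density m (tau v))^-1)} &
      {in `[- B, B], forall v, tau (- v) = - tau v}].

(** The inverse of an increasing odd function is continuous and odd. *)
Lemma phase_exists c m b : 0 < c -> 0 < b < 3 * pi ->
  (forall t, - b < t < b -> 0 < 1 + m * cos t) ->
  exists tau, is_phase c m b (c * period_int m b) tau.
Proof.
move=> c0 /andP[b0 bp] K0.
have bb : - b < b by lra.
have cP : {within `[- b, b], continuous (fun t => c * period_int m t)}.
  have dP t : t \in `[- b, b] -> is_derive t 1 (fun t => c * period_int m t) (c * period_density m t).
    rewrite in_itv/= => /andP[h1 h2].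
    have tp : - (3 * pi) < t < 3 * pi by apply/andP; split; lra.
    exact: (derZ c (@der_period_int _ m t tp)).
  exact: (@der_within _ (fun t => c * period_int m t) _ _ _ dP).
have dP t : t \in `]- b, b[ -> is_derive t 1 (fun t => c * period_int m t) (c * period_density m t).
  rewrite in_itv/= => /andP[h1 h2].
  have tp : - (3 * pi) < t < 3 * pi by apply/andP; split; lra.
  exact: (derZ c (@der_period_int _ m t tp)).
have P0 t : t \in `]- b, b[ -> 0 < c * period_density m t.
  by rewrite in_itv/= => tb; rewrite mulr_gt0// sqrtr_gt0 K0.
have [tau [h1 h2 h3 h4 h5]] := inverse_of_increasing bb cP dP P0.
have Eb : c * period_int m (- b) = - (c * period_int m b).
  by rewrite period_int_odd ?mulrN// (ltW b0).
rewrite Eb in h2 h3 h4 h5.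
exists tau; split=> //.
- by move=> v vB; split; [exact: h2|exact: h4].
- move=> v vB.
  have vB' : - v \in `[- (c * period_int m b), (c * period_int m b)].
    by move: vB; rewrite !in_itv/= => /andP[? ?]; apply/andP; split; lra.
  have tb := h4 _ vB; have E := h2 _ vB.
  have ntb : - tau v \in `[- b, b].
    by move: tb; rewrite !in_itv/= => /andP[? ?]; apply/andP; split; lra.
  rewrite -[RHS](h1 _ ntb); congr tau; rewrite -[v in LHS]E.
  have Podd t : t \in `[- b, b] -> period_int m (- t) = - period_int m t.
    rewrite in_itv/= => /andP[t1 t2].
    have [t0|t0] := leP 0 t; first by apply: period_int_odd; rewrite t0; lra.
    have := @period_int_odd _ m (- t); rewrite opprK => ->; first by rewrite opprK.
    by apply/andP; split; lra.
  by rewrite Podd// mulrN.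
Qed.

Lemma phase_incr c m b B tau : 0 < c -> 0 < b < 3 * pi -> is_phase c m b B tau ->
  {in `[- B, B] &, {homo tau : v w / v < w}}.
Proof.
move=> c0 /andP[b0 bp] [_ h2 _ _ _] v w vB wB vw.
have [Ev tv] := h2 v vB; have [Ew tw] := h2 w wB.
rewrite ltNge; apply/negP => tw_le.
suff : w <= v by lra.
rewrite -Ev -Ew ler_pM2l//.
move: tv tw; rewrite !in_itv/= => /andP[? ?] /andP[? ?].
by apply: period_int_ndecr; lra.
Qed.

(** v is the abscissa measured from the trough. *)
Definition profile a (tau : R -> R) v := - (a * cos (tau v)).

Lemma phase_jet c m b B tau : 0 < c -> is_phase c m b B tau ->
  (forall t, - b < t < b -> 0 < 1 + m * cos t) ->
  let a := m * c ^+ 2 / 2 in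
  jet c `]pi - B, pi + B[%classic (fun u => profile a tau (u - pi))
    (fun u => a * sin (tau (u - pi))) (fun u => (c * period_density m (tau (u - pi)))^-1).
Proof.
move=> c0 [_ _ _ dtau _] K0 a u; rewrite /= in_itv/= => /andP[u1 u2].
have uB : u - pi \in `]- B, B[ by rewrite in_itv/=; apply/andP; split; lra.
have [tb dt] := dtau _ uB.
have {}K0 : 0 < 1 + m * cos (tau (u - pi)) by apply: K0; move: tb; rewrite in_itv.
have dT0 : is_derive u 1 (fun u => u - pi) (1 - 0) by exact: derB (der_id u) (derC pi u).
have dT := dercomp dT0 dt; rewrite subr0 mulr1 in dT.
set T := tau (u - pi) in tb dt dT K0 *.
have k0 : 0 < period_density m T by rewrite sqrtr_gt0.
have k2 : period_density m T ^+ 2 = 1 + m * cos T by rewrite sqr_sqrtr// ltW.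
have dc := dercomp dT (is_derive_cos (tau (u - pi))).
have ds := dercomp dT (is_derive_sin (tau (u - pi))).
rewrite -/T in dc ds.
have dk0 := @dersqrt _ (fun t => 1 + m * cos (tau (t - pi))) u _ K0 (derD (derC 1 u) (derZ m dc)).
have kn : c * period_density m T != 0 by rewrite mulf_neq0// gt_eqF.
have dk := @derV _ (fun t => c * Num.sqrt (1 + m * cos (tau (t - pi)))) u _ kn (derZ c dk0).
have Kn : period_density m T != 0 by rewrite gt_eqF.
have cn : c != 0 by rewrite gt_eqF.
rewrite -/(period_density m T) in dk.
split.
- apply: (is_derive_eq (derN (derZ a dc))).
  by rewrite -/T mulNr mulrN opprK mulrA.
- apply: (is_derive_eq (derZ a ds)).
  by rewrite /profile -/T opprK mulrA.
- apply: (is_derive_eq dk).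
  by rewrite -/T /a; field; rewrite cn Kn.
- by rewrite invr_gt0 mulr_gt0.
- rewrite /profile -/T exprVn exprMn k2 /a.
  by field; rewrite gt_eqF// cn.
Qed.

End profile.

(** * Crests, single lobes and the integral constraint *)

Section lobes.
Context {R : realType}.
Notation mu := (@lebesgue_measure R).
Implicit Types (f g eta q kappa : R -> R) (a b c m t u v x : R) (D : set R).

Lemma within_comp (A B : set R) f g : {within A, continuous f} ->
  {within B, continuous g} -> (forall y, B y -> A (g y)) ->
  {within B, continuous (f \o g)}.
Proof.
move=> /subspace_continuousP cf /subspace_continuousP cg BA.
apply/subspace_continuousP => x Bx.
apply: (@cvg_comp _ _ _ g f _ (within A (nbhs (g x)))); last exact: (cf _ (BA _ Bx)).
move=> P AP; have Pg := cg x Bx _ AP.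
have {}Pg : nbhs x [set y | B y -> A (g y) -> P (g y)] by exact: Pg.
suff : nbhs x [set y | B y -> P (g y)] by [].
by apply: filterS Pg => y h By; exact: (h By (BA y By)).
Qed.

Lemma within_comp_continuous (A : set R) f g x : {within A, continuous f} ->
  continuous g -> (forall y, A (g y)) -> {for x, continuous (f \o g)}.
Proof.
move=> cf cg Ag.
have : {within setT, continuous (f \o g)}.
  by apply: (within_comp cf) => //; exact: continuous_subspaceT.
by move=> h; exact: ((continuous_subspace_setT _).2 h x).
Qed.

Lemma acos_within : {within `[(-1 : R), 1], continuous acos}.
Proof.
have := @segment_can_ge_continuous R 0 pi cos acos (@pi_ge0 R).
rewrite cos0 cospi; apply; last exact: cosK.
by apply: continuous_subspaceT; exact: continuous_cos.
Qed.

Lemma wrap_continuous g : {within `[0, pi], continuous g} -> continuous (wrap g).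
Proof.
move=> cg x.
have c1 : {within `[(-1 : R), 1], continuous (g \o acos)}.
  apply: (within_comp cg acos_within) => y; rewrite /= !in_itv/= => y1.
  by rewrite acos_ge0// acos_lepi.
apply: (@within_comp_continuous _ _ (fun u => - cos u) x c1).
  by move=> y; apply: (is_derive_continuous (derN (is_derive_cos y))).
by move=> y; rewrite /= in_itv/= lerN2 cos_le1 lerNl cos_geN1.
Qed.

Lemma is_crest (k : int) : crests (2 * pi * k%:~R : R).
Proof. by exists k. Qed.

Lemma crest_opp u : crests u -> crests (- u).
Proof. by move=> [k _ <-]; exists (- k) => //; rewrite mulrNz mulrN. Qed.

Lemma not_crest u : 0 < u < 2 * pi -> (~` crests) u.
Proof.
move=> /andP[u0 u2] [k _ E]; have pi0 := @pi_gt0 R.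
have k0 : (0 : R) < k%:~R.
  by rewrite -(pmulr_rgt0 _ (_ : 0 < 2 * pi)) ?E// mulr_gt0.
have k1 : (k%:~R : R) < 1.
  by rewrite -(ltr_pM2l (_ : 0 < 2 * pi)) ?E ?mulr1// mulr_gt0.
by move: k0 k1; rewrite ltr0z ltrz1; lia.
Qed.

Lemma reduce_off_crest u : (~` crests) u ->
  exists j : int, 0 < u + 2 * pi * j%:~R < 2 * pi.
Proof.
move=> nu; have pi0 := @pi_gt0 R; have [k] := reduce_mod_period u.
rewrite ler_norml => /andP[h1 h2].
have [v0|v0|v0] := ltgtP (u - 2 * pi * k%:~R) 0.
- by exists (1 - k); rewrite intrB; apply/andP; split; lra.
- by exists (- k); rewrite mulrNz mulrN; apply/andP; split; lra.
- exfalso; apply: nu; have -> : u = 2 * pi * k%:~R by lra.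
  exact: is_crest.
Qed.

(** From a point that is not a crest, the function increases in the
direction of the nearest crest, so that the point is not a local maximum. *)
Lemma decreasing_single_lobe eta : (forall u, eta (- u) = eta u) ->
  periodic eta (2 * pi) ->
  (forall x y, 0 <= x -> x < y -> y <= pi -> eta y < eta x) ->
  single_lobe eta.
Proof.
move=> ev pe decr; split=> // u.
have shiftE (k : int) v : eta v = eta (v - 2 * pi * k%:~R).
  by rewrite -mulrN -mulrNz periodicz.
split; last first.
  move=> [k _ <-]; suff G v : eta v <= eta (2 * pi * k%:~R).
    by apply/nbhs_ballP; exists 1 => //= v _; exact: G.
  rewrite (shiftE k (2 * pi * _)) subrr.
  have [j] := reduce_mod_period v; rewrite (shiftE j v); set w := v - _ => wpi.
  have -> : eta w = eta `|w| by case: ger0P => // _; rewrite ev.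
  have [->//|w0] := eqVneq `|w| 0.
  by apply: ltW; apply: decr => //; rewrite lt_neqAle eq_sym w0 normr_ge0.
move=> loc; have [k] := reduce_mod_period u; set w := u - _ => wpi.
have [w0|wn0] := eqVneq w 0.
  have -> : u = 2 * pi * k%:~R by rewrite -[u](subrK (2 * pi * k%:~R)) -/w w0 add0r.
  exact: is_crest.
exfalso; move: loc => /nbhs_ballP[e /= e0 loc].
have n0 : 0 < `|w| by rewrite normr_gt0.
pose h := Num.min (e / 2) (`|w| / 2).
have h0 : 0 < h by rewrite lt_min !divr_gt0.
have he : h <= e / 2 by rewrite ge_min lexx.
have hw : h <= `|w| / 2 by rewrite ge_min lexx orbT.
have step z : `|z - w| = h -> eta w < eta z -> False.
  move=> zw; rewrite ltNge => /negP; apply.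
  have := loc (z + 2 * pi * k%:~R); rewrite periodicz// => le_.
  rewrite -(shiftE k u : eta u = eta w); apply: le_.
  rewrite /ball/= (_ : u - _ = - (z - w)); last by rewrite /w; ring.
  by rewrite normrN zw; lra.
have [w0|w0] := leP 0 w.
- rewrite ger0_norm// in n0 hw wpi.
  apply: (step (w - h)).
    by rewrite (_ : w - h - w = - h); [rewrite normrN gtr0_norm|ring].
  by apply: decr => //; lra.
- rewrite ltr0_norm// in n0 hw wpi.
  apply: (step (w + h)).
    by rewrite (_ : w + h - w = h); [rewrite gtr0_norm|ring].
  rewrite -(ev w) -(ev (w + h)).
  by apply: decr => //; lra.
Qed.

Lemma integrable_concat f a b c : a <= b -> b <= c ->
  mu.-integrable `[a, b] (EFin \o f) -> mu.-integrable `[b, c] (EFin \o f) ->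
  mu.-integrable `[a, c] (EFin \o f) /\
  \int[mu]_(x in `[a, c]) f x =
  \int[mu]_(x in `[a, b]) f x + \int[mu]_(x in `[b, c]) f x.
Proof.
move=> ab bc fab fbc.
have E : `[a, c]%classic = `[a, b]%classic `|` `]b, c]%classic.
  by apply: itv_bndbnd_setU; rewrite bnd_simp.
have dAB : [disjoint `[a, b]%classic & `]b, c]%classic].
  apply/disj_setPS => y [/=]; rewrite 2!in_itv/= => /andP[_ yx] /andP[].
  by rewrite ltNge yx.
have fbc' : mu.-integrable `]b, c] (EFin \o f).
  by apply: integrableS fbc => //; exact: subset_itv_oc_cc.
have fac : mu.-integrable `[a, c] (EFin \o f).
  move/integrableP : fab => [m1 i1]; move/integrableP : fbc' => [m2 i2].
  have m3 : measurable_fun (`[a, b] `|` `]b, c]) (EFin \o f).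
    by apply/measurable_funU => //; split.
  rewrite E; apply/integrableP; split => //.
  rewrite ge0_integral_setU//; first exact: lte_add_pinfty.
  by apply: measurableT_comp.
split=> //; rewrite E Rintegral_setU// -?E//.
congr (_ + _); exact: Rintegral_itv_obnd_cbnd.
Qed.

(** The integral over half a period is the variation of the flux Q between
a crest and a trough, and Q vanishes at both.  The bound k on eta is what makes
the fundamental theorem applicable without a bound on the derivative. *)
Lemma integral_constraint_of_flux eta Q k : periodic eta (2 * pi) ->
  (forall u, k <= eta u) ->
  let F u := eta u + derive1 eta u ^+ 2 in
  (forall u, u \in `]0, 2 * pi[ -> {for u, continuous F}) ->
  {within `[0, 2 * pi], continuous Q} ->
  (forall u, u \in `]0, 2 * pi[ -> is_derive u 1 Q (F u)) ->
  Q 0 = 0 -> Q pi = 0 -> Q (2 * pi) = 0 -> integral_constraint eta.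
Proof.
move=> pe ek F cF cQ dQ Q0 Qpi Q2pi; have pi0 := @pi_gt0 R.
have Fk u : k <= F u by rewrite /F (le_trans (ek u))// lerDl sqr_ge0.
have pF u : F (u + 2 * pi) = F u by rewrite /F pe (periodic_derive1 pe).
have [i1 e1] : mu.-integrable `[0, pi] (EFin \o F) /\
    \int[mu]_(x in `[0, pi]) F x = Q pi - Q 0.
  have sub x : x \in `]0, pi[ -> x \in `]0, 2 * pi[.
    by rewrite !in_itv/= => /andP[? ?]; apply/andP; split; lra.
  have cQ1 : {within `[0, pi], continuous Q}.
    by apply: continuous_subspaceW cQ; apply: subset_itvl; rewrite bnd_simp; lra.
  exact: (FTC_lower_bounded pi0 (fun x _ => Fk x) (fun x xI => cF x (sub x xI))
    cQ1 (fun x xI => dQ x (sub x xI))).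
(* on [- pi, 0] the flux is the translate by one period of Q on [pi, 2 pi] *)
pose S u : R := u + 2 * pi.
have dS u : is_derive u 1 S (1 + 0) by exact: derD (der_id u) (derC _ u).
have cS : continuous S by move=> u; exact: is_derive_continuous (dS u).
have [i2 e2] : mu.-integrable `[- pi, 0] (EFin \o F) /\
    \int[mu]_(x in `[- pi, 0]) F x = (Q \o S) 0 - (Q \o S) (- pi).
  have sub x : x \in `]- pi, 0[ -> S x \in `]0, 2 * pi[.
    by rewrite /S !in_itv/= => /andP[? ?]; apply/andP; split; lra.
  have cF2 x : x \in `]- pi, 0[ -> {for x, continuous F}.
    move=> /sub SI; rewrite (_ : F = F \o S); last by apply/funext => y; rewrite /= pF.
    by apply: continuous_comp; [exact: cS|exact: cF].
  have cQ2 : {within `[- pi, 0], continuous (Q \o S)}.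
    apply: (within_comp cQ); first exact: continuous_subspaceT.
    by move=> y; rewrite /S /= !in_itv/= => /andP[? ?]; apply/andP; split; lra.
  have dQ2 x : x \in `]- pi, 0[ -> is_derive x 1 (Q \o S) (F x).
    by move=> /sub SI; have := dercomp (dS x) (dQ _ SI); rewrite pF addr0 mulr1.
  have np : - pi < 0 :> R by rewrite oppr_lt0.
  exact: (FTC_lower_bounded np (fun x _ => Fk x) cF2 cQ2 dQ2).
have [] := @integrable_concat F (- pi) 0 pi _ _ i2 i1.
- by rewrite oppr_le0 ltW.
- exact: ltW.
move=> i3 e3; split=> //.
rewrite e3 e1 e2 /= /S add0r Q0 Qpi Q2pi.
by rewrite (_ : - pi + 2 * pi = pi :> R) ?Qpi ?subrr ?addr0//; ring.
Qed.

End lobes.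

(** * Existence of the waves *)

Section existence.
Context {R : realType}.
Implicit Types (f g eta q kappa : R -> R) (a b c m t u v x : R) (D : set R).

Lemma jet_sub c D D' eta q kappa : (forall u, D' u -> D u) ->
  jet c D eta q kappa -> jet c D' eta q kappa.
Proof. by move=> DD J u /DD /J. Qed.

Lemma open_oo a b : open (`]a, b[%classic : set R).
Proof. exact: interval_open. Qed.

(** The wave of a given phase.  For m < 1 the phase extends beyond the crest
(pi < B) and sin (tau pi) = 0; for m >= 1 it stops at the crest (B = pi), where
the density vanishes.  In both cases the flux is zero at the crest, and this is
all that the integral constraint requires. *)
Section wave.
Variables (c m b B : R) (tau : R -> R).
Hypotheses (c0 : 0 < c) (m0 : 0 < m) (b0 : 0 < b < 3 * pi) (piB : pi <= B).
Hypothesis P : is_phase c m b B tau.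
Hypothesis K0 : forall t, - b < t < b -> 0 < 1 + m * cos t.
Hypothesis taupi : tau pi <= pi.
Hypothesis flux0 : sin (tau pi) * period_density m (tau pi) = 0.

Let a := m * c ^+ 2 / 2.
Let eta := wrap (profile a tau).
Let q u := a * sin (tau (u - pi)).
Let kappa u := (c * period_density m (tau (u - pi)))^-1.

Let a_gt0 : 0 < a.
Proof. by rewrite /a !mulr_gt0// exprn_gt0. Qed.

Let inB v : - pi <= v <= pi -> v \in `[- B, B].
Proof.
by rewrite in_itv/= => /andP[? ?]; have h := piB; apply/andP; split; lra.
Qed.

Lemma phase_odd v : - pi <= v <= pi -> tau (- v) = - tau v.
Proof. by case: P => _ _ _ _ h /inB /h. Qed.

Lemma phase0 : tau 0 = 0.
Proof.
have pi0 := @pi_gt0 R; have := @phase_odd 0.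
rewrite oppr0 => /(_ _) h; have {}h : tau 0 = - tau 0.
  by apply: h; apply/andP; split; lra.
by lra.
Qed.

Lemma phase_lt v w : - pi <= v -> v < w -> w <= pi -> tau v < tau w.
Proof.
move=> v1 vw w1; apply: (phase_incr c0 b0 P) => //; apply: inB;
  by apply/andP; split; lra.
Qed.

Lemma waveE u : 0 <= u <= 2 * pi -> eta u = profile a tau (u - pi).
Proof.
move=> u2; rewrite /eta wrapE// /profile.
case: (ger0P (u - pi)) => h //.
by rewrite phase_odd ?cosN//; move: u2 => /andP[? ?]; apply/andP; split; lra.
Qed.

Lemma wave_jet : jet c `]0, 2 * pi[%classic eta q kappa.
Proof.
have pB := piB; apply: (@jet_eq _ _ _ (fun u => profile a tau (u - pi))).
- exact: open_oo.
- move=> u; rewrite /= in_itv/= => /andP[u0 u1]; apply: waveE.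
  by rewrite !ltW.
- apply: jet_sub (phase_jet c0 P K0) => u; rewrite /= !in_itv/= => /andP[? ?].
  by apply/andP; split; lra.
Qed.

Lemma wave_decreasing x y : 0 <= x -> x < y -> y <= pi -> eta y < eta x.
Proof.
move=> x0 xy ypi; have pi0 := @pi_gt0 R.
rewrite !waveE; try by apply/andP; split; lra.
rewrite /profile ltrN2 ltr_pM2l//.
rewrite -[cos (tau (x - pi))]cosN -[cos (tau (y - pi))]cosN -!phase_odd;
  try by apply/andP; split; lra.
have t0 z : 0 <= z <= pi -> 0 <= tau z <= pi.
  move=> /andP[z0 zpi]; apply/andP; split.
    have [->|z1] := eqVneq z 0; first by rewrite phase0.
    by rewrite -phase0 ltW// phase_lt//; [lra|rewrite lt_neqAle eq_sym z1].
  have [->//|z1] := eqVneq z pi.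
  by apply: le_trans taupi; rewrite ltW// phase_lt//; [lra|rewrite lt_neqAle z1].
rewrite ltr_cos ?in_itv/=; first by apply: phase_lt; lra.
- by apply: t0; apply/andP; split; lra.
- by apply: t0; apply/andP; split; lra.
Qed.

Lemma wave_bound u : - a <= eta u <= a.
Proof.
rewrite /eta /wrap /profile; set T := tau _.
have h1 := cos_le1 T; have h2 := cos_geN1 T.
have a0 := ltW a_gt0; apply/andP; split; first by rewrite lerN2 ler_piMr.
by rewrite lerNl -mulrN1 ler_wpM2l.
Qed.

Lemma wave_continuous : continuous eta.
Proof.
apply: wrap_continuous; have [_ _ ctau _ _] := P.
have ctau' : {within `[0, pi], continuous tau}.
  by apply: continuous_subspaceW ctau; apply: subset_itv; rewrite bnd_simp;
    have := @pi_gt0 R; have := piB; lra.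
have cg : continuous (fun t => - (a * cos t)).
  by move=> t; exact: (is_derive_continuous (derN (derZ a (is_derive_cos t)))).
have cg' : {within setT, continuous (fun t => - (a * cos t))}.
  exact: continuous_subspaceT.
exact: (within_comp cg' ctau').
Qed.

Lemma wave_integral_constraint : integral_constraint eta.
Proof.
have pi0 := @pi_gt0 R.
have pe : periodic eta (2 * pi) by exact: wrap_periodic.
have CC := jet_class_C 1 (@open_oo _ _) wave_jet.
pose Q u := - (q u / kappa u).
have lb u : - a <= eta u by have /andP[] := wave_bound u.
have cF u : u \in `]0, 2 * pi[ ->
    {for u, continuous (fun u => eta u + derive1 eta u ^+ 2)}.
  move=> uI; have [_ cu] := CC u uI.
  have c1 : {for u, continuous eta} by exact: (cu 0%N isT).
  have c2 : {for u, continuous (derive1 eta)} by exact: (cu 1%N isT).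
  by apply: continuousD => //; apply: continuousM.
have cQ : {within `[0, 2 * pi], continuous Q}.
  have [_ _ ctau _ _] := P.
  have -> : Q = (fun y => - (a * sin y * (c * period_density m y))) \o (tau \o (fun u => u - pi)).
    by apply/funext => u; rewrite /Q /q /kappa invrK.
  have cG : continuous (fun y => - (a * sin y * (c * period_density m y))).
    move=> y; apply: cvgN; apply: cvgM.
      by apply: cvgM; [exact: cvg_cst|exact: continuous_sin].
    by apply: cvgM; [exact: cvg_cst|exact: continuous_period_density].
  have cG' : {within setT, continuous (fun y => - (a * sin y * (c * period_density m y)))}.
    exact: continuous_subspaceT.
  apply: (within_comp cG') => //; apply: (within_comp ctau).
    apply: continuous_subspaceT => u.
    exact: (is_derive_continuous (derB (der_id u) (derC pi u))).
  move=> u; rewrite /= !in_itv/= => /andP[? ?]; have pB := piB.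
  by apply/andP; split; lra.
have dQ u : u \in `]0, 2 * pi[ -> is_derive u 1 Q (eta u + derive1 eta u ^+ 2).
  by move=> uI; exact: (jet_flux wave_jet uI).
apply: (integral_constraint_of_flux pe lb cF cQ dQ).
- rewrite /Q /q /kappa invrK sub0r phase_odd; last by apply/andP; split; lra.
  have KN : period_density m (- tau pi) = period_density m (tau pi) by rewrite /period_density cosN.
  rewrite KN sinN (_ : _ * _ = - (a * c) * (sin (tau pi) * period_density m (tau pi))); last by ring.
  by rewrite flux0 mulr0 oppr0.
- by rewrite /Q /q subrr phase0 sin0 mulr0 mul0r oppr0.
- rewrite /Q /q /kappa invrK (_ : 2 * pi - pi = pi); last by ring.
  rewrite (_ : _ * _ = (a * c) * (sin (tau pi) * period_density m (tau pi))); last by ring.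
  by rewrite flux0 mulr0 oppr0.
Qed.

Lemma wave_single_lobe : single_lobe eta.
Proof.
apply: decreasing_single_lobe.
- exact: wrap_even.
- exact: wrap_periodic.
- exact: wave_decreasing.
Qed.

Lemma wave_singular : singular_single_lobe_solution c eta.
Proof.
have pe : periodic eta (2 * pi) by exact: wrap_periodic.
split.
- split=> // u _; split=> // n; rewrite leqn0 => /eqP ->; exact: wave_continuous.
- have CC := jet_class_C 2 (@open_oo _ _) wave_jet.
  apply: class_C_periodic pe CC _ => u /reduce_off_crest[j uj]; exists j.
  by rewrite /= in_itv.
- move=> u /reduce_off_crest[j uj]; apply: (@wave_eq_periodic _ _ _ j) => //.
  by apply: (jet_wave_eq (@open_oo _ _) wave_jet); rewrite /= in_itv.
- exact: wave_integral_constraint.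
- exact: wave_single_lobe.
Qed.

End wave.

(** Beyond the angle b at which m cos b = - 1 the density vanishes, so the
half period is attained at b already. *)
Lemma crest_angle m : 1 <= m -> exists b, [/\ 0 < b <= pi, m * cos b = - 1,
  (forall t, - b < t < b -> 0 < 1 + m * cos t) & period_int m b = half_period m].
Proof.
move=> m1; have pi0 := @pi_gt0 R; have m0 : 0 < m by lra.
have mi0 : 0 < m^-1 by rewrite invr_gt0.
have mi : m^-1 <= 1 by rewrite invf_le1.
have i1 : -1 <= - m^-1 <= 1 by apply/andP; split; lra.
have bpi : 0 <= acos (- m^-1) <= pi by rewrite acos_ge0// acos_lepi.
have cb : cos (acos (- m^-1)) = - m^-1 by rewrite acosK// in_itv.
set b := acos (- m^-1) in bpi cb *; exists b.
have mcb : m * cos b = - 1 by rewrite cb mulrN divff// gt_eqF.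
have b0 : 0 < b by apply: acos_gt0; apply/andP; split; lra.
have [b0' bpi'] := andP bpi.
split=> //; first by rewrite b0.
- move=> t /andP[tb1 tb2]; rewrite -(cos_norm t).
  have tb : `|t| < b by rewrite ltr_norml tb1.
  have : cos b < cos `|t|.
    by rewrite ltr_cos ?in_itv//= ?normr_ge0//=; rewrite (le_trans (ltW tb)).
  by rewrite -(ltr_pM2l m0) mcb; lra.
apply/esym/period_int_flat; [lra|lra|lra|] => t /andP[t1 t2].
have : cos t < cos b.
  by rewrite ltr_cos ?in_itv//=; apply/andP; split; lra.
by rewrite -(ltr_pM2l m0) mcb; lra.
Qed.

(** The phase is stopped at the angle of crest_angle.  The condition on c
says that this happens exactly at distance pi from the trough. *)
Lemma singular_wave_exists c m : 0 < c -> 1 <= m -> c * half_period m = pi ->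
  exists tau, [/\ 0 < tau pi <= pi, m * cos (tau pi) = -1,
    is_phase c m (tau pi) pi tau,
    (forall t, - tau pi < t < tau pi -> 0 < 1 + m * cos t) &
    singular_single_lobe_solution c (wrap (profile (m * c ^+ 2 / 2) tau))].
Proof.
move=> c0 m1 cH; have pi0 := @pi_gt0 R.
have [b [b0 mcb K0 PE]] := crest_angle m1.
have b3 : 0 < b < 3 * pi by move: b0 => /andP[? ?]; apply/andP; split; lra.
have [tau P] := phase_exists c0 b3 K0; rewrite PE cH in P.
have tb : tau pi = b.
  have [h1 _ _ _ _] := P; rewrite -(h1 b); first by rewrite PE cH.
  by rewrite in_itv/= lexx andbT; lra.
exists tau; rewrite tb; split=> //.
apply: (wave_singular c0 _ b3 _ P) => //; first lra.
- by rewrite tb; case/andP: b0.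
- by rewrite tb /period_density mcb subrr sqrtr0 mulr0.
Qed.

(** The density is positive everywhere, so the phase goes on through the
crest.  By its symmetry about the crest, the periodic wave coincides with the
profile of the phase on both sides of the crest and not only up to it; the crest
is then an interior point of an interval on which the system of first order
holds. *)
Lemma smooth_wave_exists c m : 0 < c -> 0 < m < 1 -> c * half_period m = pi ->
  exists eta, smooth_single_lobe_solution c eta /\
    forall u, `|eta u| <= m * c ^+ 2 / 2.
Proof.
move=> c0 /andP[m0 m1] cH; have pi0 := @pi_gt0 R.
have K0 t : - (2 * pi) < t < 2 * pi -> 0 < 1 + m * cos t.
  by move=> _; have := cos_geN1 t; have := cos_le1 t; nra.
have b3 : 0 < 2 * @pi R < 3 * @pi R.
  by apply/andP; split; lra.
have [tau P] := phase_exists c0 b3 K0.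
have EB : c * period_int m (2 * pi) = 2 * pi.
  have := @period_int_reflect _ m 0; rewrite subr0 period_int0 subr0 => ->; last by apply/andP; split; lra.
  by rewrite mulrCA cH.
rewrite EB in P.
have piB : pi <= 2 * pi :> R by lra.
have [h1 h2 _ _ _] := P.
have inI x : - (2 * pi) <= x <= 2 * pi -> x \in `[- (2 * pi), 2 * pi] by rewrite in_itv.
have tpi : tau pi = pi.
  by rewrite -{1}cH -/(half_period m) h1// inI//; apply/andP; split; lra.
have tle : tau pi <= pi by rewrite tpi.
have fl : sin (tau pi) * period_density m (tau pi) = 0 by rewrite tpi sinpi mul0r.
set a := m * c ^+ 2 / 2; pose eta := wrap (profile a tau).
have a0 : 0 < a by rewrite /a !mulr_gt0// exprn_gt0.
have pe : periodic eta (2 * pi) by exact: wrap_periodic.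
(* the phase is symmetric about the crest *)
have refl v : 0 <= v <= 2 * pi -> tau (2 * pi - v) = 2 * pi - tau v.
  move=> /andP[v0 v1].
  have vI : - (2 * pi) <= v <= 2 * pi by apply/andP; split; lra.
  have [Ev tv] := h2 v (inI v vI); move: tv; rewrite in_itv/= => /andP[tv1 tv2].
  have tv0 : 0 <= tau v.
    rewrite leNgt; apply/negP => tn.
    have := @period_int_odd _ m (- tau v); rewrite opprK => PN.
    have nn : 0 <= period_int m (- tau v).
      by rewrite -(period_int0 m); apply: period_int_ndecr; lra.
    have E0 : period_int m (tau v) = - period_int m (- tau v) by apply: PN; apply/andP; split; lra.
    have v00 : v = 0.
      have : 0 <= c * period_int m (- tau v) by rewrite mulr_ge0// ltW.
      by move: Ev; rewrite E0 mulrN; lra.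
    by move: tn; rewrite v00 (phase0 piB P) ltxx.
  have tr : 0 <= tau v <= 2 * pi by rewrite tv0.
  rewrite -[RHS]h1; last by rewrite inI//; apply/andP; split; lra.
  by congr tau; rewrite period_int_reflect// mulrBr Ev// mulrCA cH.
exists eta.
have etaE u : - pi < u < 2 * pi -> eta u = profile a tau (u - pi).
  move=> /andP[u1 u2]; have [u0|u0] := leP 0 u.
    by rewrite /eta (waveE piB P)//; apply/andP; split; lra.
  rewrite /eta -(wrap_even (profile a tau)) wrapE; last by apply/andP; split; lra.
  rewrite ler0_norm; last lra.
  have -> : - (- u - pi) = u + pi by ring.
  rewrite /profile; congr (- (_ * _)).
  have -> : u - pi = - (2 * pi - (u + pi)) by ring.
  have [_ _ _ _ odd] := P.
  rewrite odd; last by rewrite inI//; apply/andP; split; lra.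
  rewrite refl; last by apply/andP; split; lra.
  by rewrite cosN mulr_natl cosB cos2pi sin2pi mul1r mul0r addr0.
have oD : open (`]- pi, 2 * pi[%classic : set R) by exact: open_oo.
have J : jet c `]- pi, 2 * pi[%classic eta (fun u => a * sin (tau (u - pi)))
    (fun u => (c * period_density m (tau (u - pi)))^-1).
  have sub u : `]- pi, 2 * pi[%classic u -> `]pi - 2 * pi, pi + 2 * pi[%classic u.
    by rewrite /= !in_itv/= => /andP[? ?]; apply/andP; split; lra.
  have E u : `]- pi, 2 * pi[%classic u -> eta u = profile a tau (u - pi).
    by rewrite /= in_itv; exact: etaE.
  exact: (jet_eq oD E (jet_sub sub (phase_jet c0 P K0))).
have red (u : R) : exists j : int, `]- pi, 2 * pi[%classic (u + 2 * pi * j%:~R).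
  have [k] := reduce_mod_period u; rewrite ler_norml => /andP[r1 r2].
  have [r3|r3] := leP (u - 2 * pi * k%:~R) (- pi).
    by exists (1 - k); rewrite /= in_itv/= intrB; apply/andP; split; lra.
  by exists (- k); rewrite /= in_itv/= mulrNz mulrN; apply/andP; split; lra.
split.
  split.
  - move=> k; split=> //.
    exact: (class_C_periodic pe (jet_class_C k oD J) (fun u _ => red u)).
  - move=> u; have [j uj] := red u; apply: (@wave_eq_periodic _ _ _ j) => //.
    exact: (jet_wave_eq oD J uj).
  - exact: (wave_integral_constraint c0 m0 piB P K0 fl).
  - exact: (wave_single_lobe c0 m0 b3 piB P tle).
by move=> u; rewrite ler_norml; exact: (wave_bound tau c0 m0 u).
Qed.

End existence.

(** * The cusped crest and the peaked profile *)

Section crest.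
Context {R : realType}.
Implicit Types (f g eta q kappa : R -> R) (a b c m t u v x : R) (D : set R).

(** From z^3 - y^3 >= (z - y) z^2 one gets z - y <= C u. *)
Lemma cube_root_estimate (z y C u : R) : 0 <= y -> 0 < z -> 0 <= u -> 0 <= C ->
  y ^+ 3 <= z ^+ 3 -> z ^+ 3 <= y ^+ 3 + C * z ^+ 2 * u ->
  0 <= z ^+ 2 - y ^+ 2 <= 2 * C * u * z.
Proof.
move=> y0 z0 u0 C0 h1 h2.
have yz : y <= z.
  by rewrite -(@ler_pXn2r _ 3) ?nnegrE// ltW.
have zn := ltW z0.
have h3 : (z - y) * z ^+ 2 <= C * u * z ^+ 2.
  have : (z - y) * z ^+ 2 <= z ^+ 3 - y ^+ 3.
    rewrite subrXX !big_ord_recr big_ord0 /= add0r.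
    rewrite ler_wpM2l ?subr_ge0// expr0 !mulr1 mul1r !expr1.
    by rewrite -addrA lerDl addr_ge0// ?mulr_ge0// ?exprn_ge0.
  by move=> h; apply: (le_trans h); lra.
have h4 : z - y <= C * u by rewrite -(ler_pM2r (exprn_gt0 2 z0)).
have Cu : 0 <= C * u by rewrite mulr_ge0.
rewrite subr_sqr; apply/andP; split; first by rewrite mulr_ge0 ?subr_ge0// addr_ge0.
apply: (@le_trans _ _ (C * u * (z + y))).
  by rewrite ler_wpM2r// addr_ge0.
rewrite (_ : 2 * C * u * z = C * u * (z + z)); last by ring.
by rewrite ler_wpM2l// lerD2l.
Qed.

(** A concave function lies below its tangent, here at Q^2. *)
Lemma sqrt_tangent (Q s x : R) : 0 < Q -> 0 <= s -> 0 <= x ->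
  s ^+ 2 <= Q ^+ 2 + x -> s <= Q + x / (2 * Q).
Proof.
move=> Q0 s0 x0 h.
have e0 : 0 <= Q + x / (2 * Q) by rewrite addr_ge0// ?divr_ge0// ltW// mulr_gt0.
rewrite -(ler_sqr s0 e0) (le_trans h)//.
have -> : (Q + x / (2 * Q)) ^+ 2 = Q ^+ 2 + x + (x / (2 * Q)) ^+ 2.
  by field; rewrite gt_eqF.
by rewrite lerDl sqr_ge0.
Qed.

Lemma powR_third (k : R) : 0 <= k -> (k `^ (1 / 3)) ^+ 3 = k.
Proof.
move=> k0; rewrite -powR_mulrn ?powR_ge0// -powRrM.
by rewrite (_ : 1 / 3 * 3%:R = 1); [rewrite powRr1|field].
Qed.

Lemma powR_third_sqr (k : R) : 0 <= k -> (k `^ (1 / 3)) ^+ 2 = k `^ (2 / 3).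
Proof.
move=> k0; rewrite -powR_mulrn ?powR_ge0// -powRrM.
by congr (_ `^ _); field.
Qed.

Lemma powR_four_thirds (k : R) : 0 < k -> k * k `^ (1 / 3) = k `^ (4 / 3).
Proof.
move=> k0; rewrite -[X in X * _](powRr1 (ltW k0)) -powRD; last by rewrite gt_eqF// implybT.
by congr (_ `^ _); field.
Qed.

(** z^3 equals 3 Q u up to a relative error of order z^2, so z^2 equals
(3 Q u)^(2/3) up to an error of order u z; and z is of order u^(1/3). *)
Lemma crest_estimate (c a Q z s e u : R) : 0 < c -> 0 < a -> 0 < Q -> 0 < u ->
  0 < z -> 0 <= s -> s <= a -> Q <= s -> s <= Q + z ^+ 2 * c ^+ 2 / 2 / (2 * Q) ->
  z ^+ 2 = c ^+ 2 - 2 * e -> z ^+ 3 = 3 * s * u ->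
  `|e - (c ^+ 2 / 2 - (3 * Q) `^ (2 / 3) / 2 * u `^ (2 / 3))| <=
  3 * c ^+ 2 / (4 * Q) * (3 * a) `^ (1 / 3) * u `^ (4 / 3).
Proof.
move=> c0 a0 Q0 u0 z0 s0 sa Qs sQ w E.
have u0' := ltW u0.
have a3 : 0 <= 3 * a by rewrite mulr_ge0// ltW.
have Q3 : 0 <= 3 * Q by rewrite mulr_ge0// ltW.
have Qu : 0 <= 3 * Q * u by rewrite mulr_ge0.
pose C := 3 * c ^+ 2 / (4 * Q).
have C0 : 0 <= C by rewrite ltW// divr_gt0 ?mulr_gt0// exprn_gt0.
have y0 : 0 <= (3 * Q * u) `^ (1 / 3) by exact: powR_ge0.
have h1 : (3 * Q * u) `^ (1 / 3) ^+ 3 <= z ^+ 3.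
  by rewrite powR_third// E ler_pM2r// ler_pM2l.
have h2 : z ^+ 3 <= (3 * Q * u) `^ (1 / 3) ^+ 3 + C * z ^+ 2 * u.
  rewrite powR_third// E -mulrDl ler_pM2r//.
  have -> : C * z ^+ 2 = 3 * (z ^+ 2 * c ^+ 2 / 2 / (2 * Q)).
    by rewrite /C; field; rewrite gt_eqF.
  by rewrite -mulrDr ler_pM2l.
have /andP[h3 h4] := cube_root_estimate y0 z0 u0' C0 h1 h2.
have z3 : z <= (3 * a) `^ (1 / 3) * u `^ (1 / 3).
  have au : 0 <= 3 * a * u by rewrite mulr_ge0.
  rewrite -powRM// -(@ler_pXn2r _ 3) ?nnegrE ?powR_ge0 ?(ltW z0)//.
  by rewrite (powR_third au) E ler_pM2r// ler_pM2l.
have h5 : 2 * C * u * z <= 2 * (C * (3 * a) `^ (1 / 3) * u `^ (4 / 3)).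
  rewrite -powR_four_thirds//.
  rewrite (_ : 2 * (C * _ * _) = 2 * C * u * ((3 * a) `^ (1 / 3) * u `^ (1 / 3)));
    last by ring.
  exact: (ler_wpM2l (mulr_ge0 (mulr_ge0 (ler0n _ 2) C0) u0') z3).
rewrite powR_third_sqr// powRM// in h3 h4.
rewrite -/C; set Y := _ `^ (4 / 3) in h5 *; set B := (3 * a) `^ _ in h5 *.
set q := (3 * Q) `^ _ in h3 h4 *; set v := u `^ _ in h3 h4 *.
have -> : e - (c ^+ 2 / 2 - q / 2 * v) = - ((z ^+ 2 - q * v) / 2).
  by rewrite w; field.
by rewrite normrN ger0_norm; lra.
Qed.

(** s^2 = Q^2 + (b^2 - w^2), where b^2 - w^2 <= b^2 - e^2 <= 2 b (b - e),
so the upper bound is that of sqrt_tangent.  It is stated with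
b = c^2 / 2 and 2 b - 2 e = z^2 in view of crest_estimate. *)
Lemma turning_slope_bounds (a b w s e Q : R) : 0 <= b -> 0 < Q ->
  Q ^+ 2 = a ^+ 2 - b ^+ 2 -> 0 <= s -> 0 <= e -> e <= w -> w <= b ->
  s ^+ 2 = a ^+ 2 - w ^+ 2 ->
  Q <= s <= Q + (2 * b - 2 * e) * (2 * b) / 2 / (2 * Q).
Proof.
move=> b0 Q0 QE s0 e0 ew wb sE.
have w2 : w ^+ 2 <= b ^+ 2 by rewrite ler_pXn2r// nnegrE; lra.
have e2 : e ^+ 2 <= w ^+ 2 by rewrite ler_pXn2r// nnegrE; lra.
apply/andP; split.
  by rewrite -(ler_sqr (ltW Q0) s0) QE sE; lra.
apply: (sqrt_tangent Q0 s0); first by rewrite divr_ge0// mulr_ge0//; lra.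
rewrite QE sE.
have := sqr_ge0 (b - e).
rewrite (_ : (b - e) ^+ 2 = b ^+ 2 - 2 * (b * e) + e ^+ 2); last by ring.
rewrite (_ : (2 * b - 2 * e) * (2 * b) / 2 = 2 * b ^+ 2 - 2 * (b * e)); last by field.
lra.
Qed.

(** sqrt(c^2 - 2 eta) is not differentiable at a cusped crest, but its cube
is: by the first integral the derivative is 3 s with s = sqrt(a^2 - eta^2).
The mean value theorem for the cube gives z^3 = 3 s u, where s is taken at some
point between the crest and u and is therefore close to its value Q at the
crest, which is positive because m > 1. *)
Lemma crest_asymptotics c m tau : 0 < c -> 1 < m ->
  0 < tau pi <= pi -> m * cos (tau pi) = -1 -> is_phase c m (tau pi) pi tau ->
  (forall t, - tau pi < t < tau pi -> 0 < 1 + m * cos t) ->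
  exists2 A : R, 0 < A &
    wrap (profile (m * c ^+ 2 / 2) tau) =
    (fun u => c ^+ 2 / 2 - A * `|u| `^ (2 / 3)) +O_ (0 : R)
      (fun u => `|u| `^ (4 / 3)).
Proof.
move=> c0 m1 tpi mc P K0; have pi0 := @pi_gt0 R.
have e1 : (2 / 3 : R) != 0 by apply/eqP; lra.
have e2 : (4 / 3 : R) != 0 by apply/eqP; lra.
have m0 : 0 < m by lra.
set a := m * c ^+ 2 / 2; pose eta := wrap (profile a tau).
have b3 : 0 < tau pi < 3 * pi by move: tpi => /andP[? ?]; apply/andP; split; lra.
have tle : tau pi <= pi by case/andP: tpi.
have J := wave_jet c0 (lexx pi) P K0; rewrite -/a -/eta in J.
set q := (fun u => a * sin (tau (u - pi))) in J.
set kappa := (fun u => (c * period_density m (tau (u - pi)))^-1) in J.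
have decr := wave_decreasing c0 m0 b3 (lexx pi) P tle.
have cont := wave_continuous (m := m) (lexx pi) P; rewrite -/a -/eta in decr cont.
have c20 : 0 < c ^+ 2 by rewrite exprn_gt0.
have a2 : c ^+ 2 / 2 < a by rewrite /a; nra.
have a0 : 0 < a by lra.
have b0 : 0 < c ^+ 2 / 2 by lra.
have Q20 : 0 < a ^+ 2 - (c ^+ 2 / 2) ^+ 2.
  by rewrite subr_gt0 ltr_pXn2r// ?nnegrE ltW.
pose Q := Num.sqrt (a ^+ 2 - (c ^+ 2 / 2) ^+ 2).
have Q0 : 0 < Q by rewrite sqrtr_gt0.
have QE : Q ^+ 2 = a ^+ 2 - (c ^+ 2 / 2) ^+ 2 by rewrite sqr_sqrtr// ltW.
have eta0 : eta 0 = c ^+ 2 / 2.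
  rewrite /eta (waveE (lexx pi) P) ?sub0r; last by apply/andP; split; lra.
  rewrite /profile (phase_odd (lexx pi) P) ?cosN; last by apply/andP; split; lra.
  rewrite (_ : - _ = - (c ^+ 2 / 2) * (m * cos (tau pi))); last by rewrite /a; ring.
  by rewrite mc mulrN1 opprK.
(* z is the square root of c^2 - 2 eta; its cube is differentiable up to the crest *)
pose z u := c * period_density m (tau (u - pi)).
have zk u : z u = (kappa u)^-1 by rewrite /kappa invrK.
have zcont x : x <= pi -> {within `[0, x], continuous (fun u => z u ^+ 3)}.
  move=> xpi; have [_ _ ctau _ _] := P.
  have cG : {within setT, continuous (fun y => (c * period_density m y) ^+ 3)}.
    apply: continuous_subspaceT => y.
    apply: (@continuous_comp _ _ _ (fun y => c * period_density m y) (fun x => x ^+ 3)).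
      by apply: cvgM; [exact: cvg_cst|exact: continuous_period_density].
    exact: exprn_continuous.
  rewrite [X in {within _, continuous X}](_ : _ =
    (fun y => (c * period_density m y) ^+ 3) \o (tau \o (fun u => u - pi))); last by [].
  apply: (within_comp cG) => //; apply: (within_comp ctau).
    apply: continuous_subspaceT => u.
    exact: (is_derive_continuous (derB (der_id u) (derC pi u))).
  by move=> u; rewrite /= !in_itv/= => /andP[? ?]; apply/andP; split; lra.
have z0 : z 0 ^+ 3 = 0.
  rewrite /z sub0r (phase_odd (lexx pi) P); last by apply/andP; split; lra.
  by rewrite /period_density cosN mc subrr sqrtr0 mulr0 expr0n.
have inI u : 0 < u -> u < pi -> (`]0, 2 * pi[%classic : set R) u.
  by move=> ? ?; rewrite /= in_itv/=; apply/andP; split; lra.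
have dz u : 0 < u -> u < pi ->
    is_derive u 1 (fun u => z u ^+ 3) (3 * (- q u)).
  move=> u0 u1; have [_ _ d3 k0 w] := J u (inI u u0 u1).
  have kn : kappa u != 0 by rewrite gt_eqF.
  have -> : z = (fun u => (kappa u)^-1) by apply/funext => y; exact: zk.
  apply: (is_derive_eq (derX 2 (derV kn d3))).
  by field.
have wE u : 0 < u -> u < pi -> 0 < z u /\ z u ^+ 2 = c ^+ 2 - 2 * eta u.
  move=> u0 u1; have [_ _ _ k0 w] := J u (inI u u0 u1).
  have kn : kappa u != 0 by rewrite gt_eqF.
  split; first by rewrite zk invr_gt0.
  by apply: (mulIf (expf_neq0 2 kn)); rewrite w zk exprVn mulVf ?expf_neq0.
have sq u : 0 < u -> u < pi -> 0 <= - q u /\ (- q u) ^+ 2 = a ^+ 2 - eta u ^+ 2.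
  move=> u0 u1; rewrite /q /eta (waveE (lexx pi) P); last by apply/andP; split; lra.
  rewrite /profile !sqrrN !exprMn sin2cos2; split; last by ring.
  rewrite -mulrN -sinN mulr_ge0 ?(ltW a0)//.
  rewrite -(phase_odd (lexx pi) P); last by apply/andP; split; lra.
  apply: sin_ge0_pi; apply/andP; split.
    rewrite -(phase0 (lexx pi) P) ltW//.
    by apply: (phase_lt c0 b3 (lexx pi) P); lra.
  apply: (le_trans _ tle); rewrite ltW//.
  by apply: (phase_lt c0 b3 (lexx pi) P); lra.
pose A := (3 * Q) `^ (2 / 3) / 2; exists A.
  by rewrite /A divr_gt0// powR_gt0// mulr_gt0.
pose C := 3 * c ^+ 2 / (4 * Q) * (3 * a) `^ (1 / 3).
have half u : 0 < u -> u < pi -> 0 <= eta u ->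
    `|eta u - (c ^+ 2 / 2 - A * u `^ (2 / 3))| <= C * u `^ (4 / 3).
  move=> u0 u1 eu.
  have dz' x : x \in `]0, u[ -> is_derive x 1 (fun u => z u ^+ 3) (3 * (- q x)).
    by rewrite in_itv/= => /andP[x0 xu]; apply: dz => //; exact: lt_trans u1.
  have [th thI] := MVT u0 dz' (zcont u (ltW u1)).
  rewrite z0 !subr0 => E; move: thI; rewrite in_itv/= => /andP[th0 thu].
  have th1 : th < pi by exact: lt_trans u1.
  have [s0 sE] := sq th th0 th1; have [zu w2] := wE u u0 u1.
  have eth : eta u < eta th by apply: decr => //; exact: ltW.
  have etc : eta th < c ^+ 2 / 2 by rewrite -eta0; apply: decr => //; exact: ltW.
  have /andP[Qs sQ] := turning_slope_bounds (ltW b0) Q0 QE s0 eu (ltW eth) (ltW etc) sE.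
  have sa : - q th <= a.
    rewrite -(ler_sqr s0 (ltW a0)) sE; have h := sqr_ge0 (eta th).
    by rewrite gerBl.
  apply: (crest_estimate c0 a0 Q0 u0 zu s0 sa Qs _ w2 E).
  by move: sQ; rewrite w2 (_ : 2 * (c ^+ 2 / 2) = c ^+ 2)//; field.
apply/eqaddOP; near=> k; near=> u.
have kC : C <= k by near: k; apply: nbhs_pinfty_ge; exact: num_real.
have etaN : eta u = eta `|u| by case: ger0P => // _; rewrite /eta wrap_even.
rewrite (ger0_norm (powR_ge0 _ _)); apply: (@le_trans _ _ (C * `|u| `^ (4 / 3))); last first.
  by rewrite ler_wpM2r// powR_ge0.
rewrite -[(_ - _) u]/(eta u - (c ^+ 2 / 2 - A * `|u| `^ (2 / 3))) etaN.
have u1 : `|u| < pi.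
  near: u; apply/nbhs_ballP; exists pi => //= y.
  by rewrite /ball/= sub0r normrN.
have eu : 0 <= eta `|u|.
  rewrite -etaN; near: u.
  have := cont 0; rewrite /continuous_at eta0 => /cvgrPdist_lt/(_ _ b0).
  apply: filterS => u; rewrite ltr_norml => /andP[_ h].
  by rewrite ltW// -(ltrD2r (- eta u)) add0r; lra.
have [->|un0] := eqVneq `|u| 0.
  by rewrite (powR0 e1) (powR0 e2) eta0 !mulr0 subr0 subrr normr0.
by apply: half => //; rewrite lt_neqAle eq_sym un0 normr_ge0.
Unshelve. all: by end_near. Qed.

Lemma c_star_half_period : c_star * half_period 1 = pi :> R.
Proof. by rewrite half_period1 /c_star divfK// mulf_neq0// gt_eqF// sqrtr_gt0. Qed.

Lemma c_star_gt0 : 0 < c_star :> R.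
Proof. by rewrite /c_star divr_gt0 ?pi_gt0// mulr_gt0// sqrtr_gt0. Qed.

Lemma c_star_sqr : c_star ^+ 2 = pi ^+ 2 / 8 :> R.
Proof.
by rewrite /c_star exprMn exprVn exprMn sqr_sqrtr//; field.
Qed.

(** For m = 1 the density is sqrt 2 * cos (t / 2), so the phase at distance
v from the trough satisfies pi * sin (tau / 2) = v, and
- cos tau = 2 sin(tau / 2)^2 - 1 is a quadratic polynomial in v. *)
Lemma peaked_profile tau u : 0 < tau pi <= pi ->
  is_phase c_star 1 (tau pi) pi tau -> - pi <= u <= pi ->
  wrap (profile (1 * c_star ^+ 2 / 2) tau) u =
  (pi ^+ 2 - 4 * pi * `|u| + 2 * u ^+ 2) / 16.
Proof.
move=> /andP[t0 tpi] P upi; have pi0 := @pi_gt0 R.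
have -> : wrap (profile (1 * c_star ^+ 2 / 2) tau) u =
          wrap (profile (1 * c_star ^+ 2 / 2) tau) `|u|.
  by case: ger0P => // _; rewrite wrap_even.
have u2 : u ^+ 2 = `|u| ^+ 2 by rewrite real_normK// num_real.
have : 0 <= `|u| <= pi by rewrite normr_ge0 ler_norml.
rewrite u2; move: `|u| => {upi u2 u} u /andP[u0 upi].
rewrite (waveE (lexx pi) P); last by apply/andP; split; lra.
have vI : pi - u \in `[- pi, pi] by rewrite in_itv/=; apply/andP; split; lra.
have -> : profile (1 * c_star ^+ 2 / 2) tau (u - pi) =
          profile (1 * c_star ^+ 2 / 2) tau (pi - u).
  rewrite /profile (_ : u - pi = - (pi - u)); last by ring.
  by rewrite (phase_odd (lexx pi) P) ?cosN//; apply/andP; split; lra.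
have [_ h2 _ _ _] := P; have [E] := h2 _ vI.
have b3 : 0 < tau pi < 3 * pi by rewrite t0; lra.
rewrite in_itv/= => /andP[_ tv1].
have tv0 : 0 <= tau (pi - u).
  have [->|h] := eqVneq (pi - u) 0; first by rewrite (phase0 (lexx pi) P).
  rewrite -(phase0 (lexx pi) P) ltW//.
  apply: (phase_lt c_star_gt0 b3 (lexx pi) P); [lra| |lra].
  by rewrite lt_neqAle eq_sym h; lra.
have {}E : pi * sin (tau (pi - u) / 2) = pi - u.
  have tv2 : 0 <= tau (pi - u) <= pi by rewrite tv0/=; lra.
  by move: E; rewrite (period_int1E tv2) mulrA -half_period1 c_star_half_period.
have -> : profile (1 * c_star ^+ 2 / 2) tau (pi - u) =
          (- pi ^+ 2 + 2 * (pi * sin (tau (pi - u) / 2)) ^+ 2) / 16.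
  rewrite /profile -[X in cos X](_ : tau (pi - u) / 2 *+ 2 = _); last first.
    by rewrite -mulr_natr; field.
  by rewrite cos_mulr2n cos2sin2 c_star_sqr -mulr_natl; field.
by rewrite E; field.
Qed.

End crest.

(** * The sup norm and W^{1,oo} *)

Section function_spaces.
Context {R : realType}.
Notation mu := (@lebesgue_measure R).
Implicit Types (f g eta phi : R -> R) (a b c t u v x : R) (D : set R).

Lemma mu_setT_gt0 : (0 < mu [set: R])%E.
Proof. by rewrite -set_itvNyy lebesgue_measure_itv/= ltry. Qed.

Lemma Linfty_normE f :
  Linfty_norm f = ess_sup mu (abse \o (EFin \o (f \_ period_cell))).
Proof. by rewrite /Linfty_norm unlock mu_setT_gt0. Qed.

Lemma Linfty_norm_le f k : 0 <= k -> (forall u, period_cell u -> `|f u| <= k) ->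
  (Linfty_norm f <= k%:E)%E.
Proof.
move=> k0 fk; rewrite Linfty_normE; apply/ess_supP; apply: aeW => u /=.
rewrite patchE; case: ifPn => [|_]; rewrite lee_fin ?normr0//.
by rewrite inE; exact: fk.
Qed.

Lemma Linfty_norm_ge0 f : (0 <= Linfty_norm f)%E.
Proof. exact: Lnorm_ge0. Qed.

Lemma in_Linfty_bound g : in_Linfty g ->
  exists2 k, 0 <= k & {ae mu, forall u, period_cell u -> `|g u| <= k}.
Proof.
move=> [_ gfin]; exists (fine (Linfty_norm g)).
  exact/fine_ge0/Linfty_norm_ge0.
have : (Linfty_norm g <= (fine (Linfty_norm g))%:E)%E.
  by rewrite fineK// ge0_fin_numE// Linfty_norm_ge0.
rewrite {1}Linfty_normE => /ess_supP; apply: filterS => u /= + uc.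
by rewrite patchE mem_set// lee_fin.
Qed.

Lemma bounded_in_Linfty f k : 0 <= k -> measurable_fun period_cell f ->
  (forall u, period_cell u -> `|f u| <= k) -> in_Linfty f.
Proof.
move=> k0 mf fk; split=> //.
by rewrite (le_lt_trans (Linfty_norm_le k0 fk))// ltry.
Qed.

Lemma cell_measurable f :
  (forall u, u \in `]- pi, 0[ -> {for u, continuous f}) ->
  (forall u, u \in `]0, pi[ -> {for u, continuous f}) ->
  measurable_fun period_cell f.
Proof.
move=> c1 c2; have pi0 := @pi_gt0 R.
have -> : period_cell = `[- pi, 0]%classic `|` `]0, pi]%classic :> set R.
  by apply: itv_bndbnd_setU; rewrite bnd_simp; lra.
apply/measurable_funU => //; split; first exact: open_cts_measurable.
by apply: measurable_funS (open_cts_measurable c2) => //; exact: subset_itv_oc_cc.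
Qed.

Lemma continuous_bounded f a b : a <= b -> continuous f ->
  exists2 k, 0 <= k & forall u, u \in `[a, b] -> `|f u| <= k.
Proof.
move=> ab cf; have cfw : {within `[a, b], continuous (fun u => `|f u|)}.
  apply: continuous_subspaceT => u; apply: (@continuous_comp _ _ _ f Num.norm).
    exact: cf.
  exact: norm_continuous.
by have [v _ h] := EVT_max ab cfw; exists `|f v|.
Qed.

Lemma not_crest_neg u : u \in `]- pi, 0[ -> (~` crests) u.
Proof.
rewrite in_itv/= => /andP[u1 u2] /crest_opp.
by apply: not_crest; apply/andP; split; have := @pi_gt0 R; lra.
Qed.

Lemma not_crest_pos u : u \in `]0, pi[ -> (~` crests) u.
Proof.
rewrite in_itv/= => /andP[u1 u2].
by apply: not_crest; apply/andP; split; have := @pi_gt0 R; lra.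
Qed.

Lemma C_per0_continuous f : C_per 0 f -> continuous f.
Proof. by move=> [_ h] u; have [_ /(_ 0%N)] := h u I; apply. Qed.

Lemma Cinfty_per_derive phi : Cinfty_per phi -> 
  (forall u, is_derive u 1 phi (derive1 phi u)) /\ continuous (derive1 phi).
Proof.
move=> /(_ 1%N)[_ h]; split=> u; by have [] := class_C_derive h (u := u) I.
Qed.

(** Integration by parts on each half of the period.  As f is continuous at
the crest, no boundary term arises there, and those at - pi and pi cancel by
periodicity. *)
Lemma bounded_derivative_in_W1infty f M : C_per 0 f -> class_C 1 (~` crests) f ->
  (forall u, (~` crests) u -> `|derive1 f u| <= M) -> in_W1infty f.
Proof.
move=> Cf C1 bM; have pi0 := @pi_gt0 R; have pipi : - pi <= pi :> R by lra.
have cf := C_per0_continuous Cf; have pf : periodic f (2 * pi) by case: Cf.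
have dC := class_C_derive C1.
pose M' := Num.max 0 M.
(* the value of derive1 f at the crest is arbitrary, so it is replaced by 0 *)
pose g u := if u == 0 then 0 else derive1 f u.
have gE u : u != 0 -> g u = derive1 f u by rewrite /g => /negbTE ->.
have ne0 (u : R) : (~` crests) u -> u != 0.
  move=> nu; apply/eqP => u0; apply: nu.
  by rewrite u0; have := @is_crest R 0; rewrite mulr0.
have gM u : u \in `[- pi, pi] -> `|g u| <= M'.
  rewrite in_itv/= => /andP[u1 u2]; rewrite /g; case: eqVneq => [_|u0].
    by rewrite normr0 /M' le_max lexx.
  apply: le_trans (bM u _) _; last by rewrite /M' le_max lexx orbT.
  have [up|up|/eqP] := ltgtP u 0; last by rewrite (negbTE u0).
    by move=> /crest_opp; apply: not_crest; apply/andP; split; lra.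
  by apply: not_crest; apply/andP; split; lra.
have dg u : (~` crests) u -> is_derive u 1 f (g u).
  by move=> nu; rewrite gE ?ne0//; have [] := dC u nu.
have cg u : (~` crests) u -> {for u, continuous g}.
  move=> nu; have [_ c1] := dC u nu.
  have un0 := ne0 u nu.
  rewrite /prop_for /continuous_at gE//.
  apply: cvg_trans c1; apply: near_eq_cvg.
  have : nbhs u [set v : R | v != 0].
    by apply: open_nbhs_nbhs; split => //; exact: open_neq.
  by apply: filterS => v /= v0; rewrite gE.
have cg1 u : u \in `]- pi, 0[ -> {for u, continuous g}.
  by move=> uI; apply: cg; exact: not_crest_neg.
have cg2 u : u \in `]0, pi[ -> {for u, continuous g}.
  by move=> uI; apply: cg; exact: not_crest_pos.
have M0 : 0 <= M' by rewrite /M' le_max lexx.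
split.
  have [k k0 fk] := continuous_bounded pipi cf.
  by apply: (bounded_in_Linfty k0) => //; apply: cell_measurable => u _; exact: cf.
exists g.
  by apply: (bounded_in_Linfty M0) => //; exact: cell_measurable.
move=> phi Cphi; have [dphi cdphi] := Cinfty_per_derive Cphi.
have cphi u : {for u, continuous phi} by exact: is_derive_continuous (dphi u).
have pphi : periodic phi (2 * pi) by case: (Cphi 0%N).
have [kf kf0 fk] := continuous_bounded pipi cf.
have [kp kp0 pk] := continuous_bounded pipi cphi.
have [kd kd0 dk] := continuous_bounded pipi cdphi.
pose h u := g u * phi u + f u * derive1 phi u.
pose F u := f u * phi u.
have hk u : u \in `[- pi, pi] -> - (M' * kp + kf * kd) <= h u.
  move=> uI; have : `|h u| <= M' * kp + kf * kd.
    rewrite /h (le_trans (ler_normD _ _))// !normrM lerD//.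
      by rewrite ler_pM// ?gM ?pk.
    by rewrite ler_pM// ?fk ?dk.
  by rewrite ler_norml => /andP[].
have ch u : {for u, continuous g} -> {for u, continuous h}.
  move=> cgu; apply: cvgD.
    by apply: cvgM; [exact: cgu|exact: cphi].
  by apply: cvgM; [exact: cf|exact: cdphi].
have dF u : (~` crests) u -> is_derive u 1 F (h u).
  by move=> nu; exact: (derM (dg u nu) (dphi u)).
have cF : continuous F by move=> u; apply: cvgM; [exact: cf|exact: cphi].
have cFw x y : {within `[x, y], continuous F} by exact: continuous_subspaceT.
have s1 u : u \in `]- pi, 0[ -> u \in `[- pi, pi].
  by rewrite !in_itv/= => /andP[? ?]; apply/andP; split; lra.
have s2 u : u \in `]0, pi[ -> u \in `[- pi, pi].
  by rewrite !in_itv/= => /andP[? ?]; apply/andP; split; lra.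
have np : - pi < 0 :> R by lra.
have [i1 e1] := FTC_lower_bounded np (fun u uI => hk u (s1 u uI))
  (fun u uI => ch u (cg1 u uI)) (cFw _ _) (fun u uI => dF u (not_crest_neg uI)).
have [i2 e2] := FTC_lower_bounded pi0 (fun u uI => hk u (s2 u uI))
  (fun u uI => ch u (cg2 u uI)) (cFw _ _) (fun u uI => dF u (not_crest_pos uI)).
have [i3 e3] := integrable_concat (ltW np) (ltW pi0) i1 i2.
have e4 : \int[mu]_(u in `[- pi, pi]) h u = 0.
  rewrite e3 e1 e2 /F.
  have -> : f pi = f (- pi) by rewrite -[RHS]pf; congr f; ring.
  have -> : phi pi = phi (- pi) by rewrite -[RHS]pphi; congr phi; ring.
  by ring.
have i4 : mu.-integrable `[- pi, pi] (EFin \o (fun u => f u * derive1 phi u)).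
  apply: continuous_compact_integrable; first exact: segment_compact.
  apply: continuous_subspaceT => u.
  by apply: cvgM; [exact: cf|exact: cdphi].
have i5 : mu.-integrable `[- pi, pi] (EFin \o (fun u => g u * phi u)).
  have := integrableB _ i3 i4 => /(_ (measurable_itv _)).
  by apply: eq_integrable => // u _ /=; rewrite /h -EFinB addrK.
have : \int[mu]_(u in `[- pi, pi]) h u =
    \int[mu]_(u in `[- pi, pi]) (g u * phi u) +
    \int[mu]_(u in `[- pi, pi]) (f u * derive1 phi u).
  by rewrite -(RintegralD _ i5 i4).
rewrite e4 => e5; apply/eqP; rewrite -addr_eq0 addrC; exact/eqP/esym.
Qed.

End function_spaces.

(** * Test functions concentrating at the crest *)

Section test_functions.
Context {R : realType}.
Notation mu := (@lebesgue_measure R).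
Implicit Types (f g eta phi : R -> R) (a b c t u v x : R) (D : set R).

(** Up to a negative factor, the derivative of ((1 + cos u) / 2)^(n + 1).
It is odd, nonnegative on [0, pi], and its mass concentrates at 0 as n grows. *)
Definition bump n u : R := sin u * ((1 + cos u) / 2) ^+ n.
Definition bump_int n u : R := - (2 / n.+1%:R * ((1 + cos u) / 2) ^+ n.+1).

Lemma der_bump_int n u : is_derive u 1 (bump_int n) (bump n u).
Proof.
have d0 : is_derive u 1 (fun u : R => (1 + cos u) / 2) (- sin u / 2).
  apply: (is_derive_eq (derM (derD (derC 1 u) (is_derive_cos u)) (derC 2^-1 u))).
  by rewrite mulr0 addr0 add0r.
apply: (is_derive_eq (derN (derZ (2 / n.+1%:R) (derX n d0)))).
rewrite /bump; set X := _ ^+ n.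
by field; rewrite (_ : 1 + n%:R = n.+1%:R :> R) ?pnatr_eq0// -natr1 addrC.
Qed.

Lemma bump_Cinfty n : Cinfty_per (bump n).
Proof.
pose S : set (R -> R) := [set sin; cos].
have Ss : generated S sin by apply: generated_gen; left.
have Sc : generated S cos by apply: generated_gen; right.
have [g Sg gE] : exists2 g, generated S g & forall u, g u = ((1 + cos u) / 2) ^+ n.
  elim: n => [|n [g Sg gE]].
    by exists (fun=> 1); [exact: generated_cst|move=> u; rewrite expr0].
  exists (fun u => (1 + cos u) * 2^-1 * g u).
    apply: generated_mul => //; apply: generated_mul; last exact: generated_cst.
    by apply: generated_add => //; exact: generated_cst.
  by move=> u; rewrite gE exprS.
move=> k; split.
  by move=> u; rewrite /bump mulr_natl sinD2pi cosD2pi.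
apply: (@class_C_closed _ (generated S) setT k (bump n) (fun u => sin u * g u)).
- exact: openT.
- apply: generated_der => h [->|->].
    by exists cos => // u _; exact: is_derive_sin.
  exists (fun u => -1 * sin u).
    by apply: generated_mul => //; exact: generated_cst.
  by move=> u _; rewrite mulN1r; exact: is_derive_cos.
- exact: generated_mul.
- by move=> u _; rewrite gE.
Qed.

Lemma bump_ge0 n u : 0 <= u <= pi -> 0 <= bump n u.
Proof.
by move=> uI; rewrite /bump mulr_ge0 ?sin_ge0_pi// exprn_ge0.
Qed.

Lemma bump_odd n u : bump n (- u) = - bump n u.
Proof. by rewrite /bump sinN cosN mulNr. Qed.

Lemma even_integral f : continuous f -> (forall u, f (- u) = f u) ->
  \int[mu]_(u in `[- pi, pi]) f u = 2 * \int[mu]_(u in `[0, pi]) f u.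
Proof.
move=> cf ev; have pi0 := @pi_gt0 R.
have i x y : mu.-integrable `[x, y] (EFin \o f).
  apply: continuous_compact_integrable; first exact: segment_compact.
  exact: continuous_subspaceT.
have np : - pi <= 0 :> R by lra.
have [_ ->] := integrable_concat np (ltW pi0) (i _ _) (i _ _).
have cfw : {within `[- pi, - 0], continuous f} by exact: continuous_subspaceT.
have := integration_by_substitution_oppr (ltW pi0) cfw.
rewrite oppr0 => E.
have -> : \int[mu]_(u in `[- pi, 0]) f u = \int[mu]_(u in `[0, pi]) f u.
  rewrite /Rintegral E; congr fine; apply: eq_integral => u _.
  by rewrite /= ev.
by rewrite mulr_natl mulr2n.
Qed.

Lemma Rintegral_FTC F f a b : a < b -> continuous f ->
  (forall x, is_derive x 1 F (f x)) -> \int[mu]_(x in `[a, b]) f x = F b - F a.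
Proof.
move=> ab cf dF.
have cfw : {within `[a, b], continuous f} by exact: continuous_subspaceT.
by rewrite /Rintegral (FTC_cc ab cfw (@der_withinT _ _ _ a b dF) (fun x _ => dF x)).
Qed.

Lemma bump_continuous n : continuous (bump n).
Proof.
have [_ h] := bump_Cinfty n 0 => u.
by have [_ c] := h u I; exact: (c 0%N).
Qed.

(** Let g be a weak derivative of f and test it with bump n.  By evenness
the pairing is twice that on [0, pi].  There f' <= 0, and f' <= - M on ]0, d[,
so its absolute value is at least M times the mass of the bump on ]0, d[, while
the L^oo bound on g makes it at most k times the mass on [0, pi].  The former
mass is the fraction 1 - p^(n + 1) of the latter, where p = (1 + cos d) / 2 < 1.
Hence M (1 - p^(n + 1)) <= k for all n. *)
Lemma W1infty_derivative_bound f : C_per 0 f -> (forall u, f (- u) = f u) ->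
  class_C 1 (~` crests) f -> (forall u, 0 < u < pi -> derive1 f u <= 0) ->
  in_W1infty f ->
  exists k, forall M d, 0 <= M -> 0 < d < pi ->
    (forall u, 0 < u < d -> derive1 f u <= - M) -> M <= k.
Proof.
move=> Cf ev C1 f'0 [_ [g gL wd]]; have pi0 := @pi_gt0 R.
have cf := C_per0_continuous Cf.
have dC := class_C_derive C1.
have [k k0 gk] := in_Linfty_bound gL.
exists k => M d M0 /andP[d0 dpi] f'M.
have df u : 0 < u < pi -> is_derive u 1 f (derive1 f u).
  move=> uI; have nu : (~` crests) u by apply: not_crest_pos; rewrite in_itv.
  by have [] := dC u nu.
pose p := (1 + cos d) / 2.
have cd1 : cos d < 1.
  by rewrite -cos0 ltr_cos ?in_itv/= ?lexx ?(ltW pi0) ?(ltW d0) ?(ltW dpi).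
have p0 : 0 <= p by rewrite /p; have := cos_geN1 d; lra.
have p1 : p < 1 by rewrite /p; lra.
have main n : M * (1 - p ^+ n.+1) <= k.
  have Cb := bump_Cinfty n; have [db cdb] := Cinfty_per_derive Cb.
  have cb := @bump_continuous n.
  have n1 : 0 < 2 / n.+1%:R :> R by rewrite divr_gt0.
  have I0 : bump_int n 0 = - (2 / n.+1%:R).
    by rewrite /bump_int cos0 (_ : (1 + 1) / 2 = 1); [rewrite expr1n mulr1|field].
  have Ipi : bump_int n pi = 0.
    by rewrite /bump_int cospi subrr mul0r expr0n mulr0 oppr0.
  have Id : bump_int n d = - (2 / n.+1%:R * p ^+ n.+1) by [].
  pose h u := f u * derive1 (bump n) u.
  have ch : continuous h by move=> u; apply: cvgM; [exact: cf|exact: cdb].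
  have evh u : h (- u) = h u.
    rewrite /h ev; congr (_ * _).
    have d1 : is_derive u 1 (fun u => - bump n (- u)) (derive1 (bump n) (- u)).
      have dn : is_derive u 1 (fun u : R => - u) (- 1) by exact: (derN (der_id u)).
      apply: (is_derive_eq (derN (dercomp dn (db (- u))))).
      by rewrite mulrN1 opprK.
    have E : (fun u => - bump n (- u)) = bump n.
      by apply/funext => v; rewrite bump_odd opprK.
    by rewrite E in d1; rewrite (is_derive_derive1E d1).
  pose J := antiderivative h (2 * pi).
  have dJ u : u \in `[0, pi] -> is_derive u 1 J (h u).
    rewrite in_itv/= => /andP[u0 u1]; apply: is_derive_antiderivative => //.
    by rewrite in_itv/=; apply/andP; split; lra.
  have JE : \int[mu]_(u in `[0, pi]) h u = J pi - J 0.
    have ch' : {within `[0, pi], continuous h} by exact: continuous_subspaceT.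
    have dJo u : u \in `]0, pi[ -> is_derive u 1 J (h u).
      move=> uI; have uI' : u \in `[0, pi].
        by move: uI; rewrite !in_itv/= => /andP[/ltW-> /ltW->].
      exact: dJ.
    by rewrite /Rintegral (FTC_cc pi0 ch' (der_within dJ) dJo).
  (* E is a primitive of - f' * bump n which is continuous at the crest, whether
     or not f' is integrable there *)
  pose E u := J u - f u * bump n u.
  have cE : {within `[0, pi], continuous E}.
    have cJ := der_within dJ; move=> u; apply: cvgB; first exact: cJ.
    have cc : continuous (fun u => f u * bump n u).
      by move=> v; apply: cvgM; [exact: cf|exact: cb].
    exact: (continuous_subspaceT cc).
  have dE u : 0 < u < pi -> is_derive u 1 E (- derive1 f u * bump n u).
    move=> uI; have uI' : u \in `[0, pi].
      by move: uI; rewrite in_itv/= => /andP[/ltW-> /ltW->].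
    apply: (is_derive_eq (derB (dJ u uI') (derM (df u uI) (db u)))).
    by rewrite /h; ring.
  have sub x y : 0 <= x -> y <= pi -> {within `[x, y], continuous E}.
    move=> x0 ypi; apply: continuous_subspaceW cE.
    by apply: subset_itv; rewrite bnd_simp.
  have E1 : M * bump_int n d - M * bump_int n 0 <= E d - E 0.
    have dP u : is_derive u 1 (fun u => M * bump_int n u) (M * bump n u).
      exact: (derZ M (der_bump_int n u)).
    have dEd u : u \in `]0, d[ -> is_derive u 1 E (- derive1 f u * bump n u).
      rewrite in_itv/= => /andP[u0 u1]; apply: dE.
      by apply/andP; split; lra.
    apply: (der_le (ltW d0) (@der_withinT _ _ _ _ _ dP) (sub 0 d (lexx 0) (ltW dpi))
      (fun u _ => dP u) dEd) => u.
    rewrite in_itv/= => uI; rewrite ler_wpM2r//.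
      by apply: bump_ge0; move: uI => /andP[? ?]; apply/andP; split; lra.
    by have := f'M u uI; lra.
  have E2 : E d <= E pi.
    have dEd u : u \in `]d, pi[ -> is_derive u 1 E (- derive1 f u * bump n u).
      rewrite in_itv/= => /andP[u0 u1]; apply: dE.
      by apply/andP; split; lra.
    apply: (der_ge0 (ltW dpi) (sub d pi (ltW d0) (lexx pi)) dEd) => u.
    rewrite in_itv/= => /andP[u1 u2]; have uI : 0 < u < pi by apply/andP; split; lra.
    rewrite mulr_ge0//; first by have := f'0 u uI; lra.
    by apply: bump_ge0; apply/andP; split; lra.
  have Epi : E pi = J pi by rewrite /E /bump sinpi mul0r mulr0 subr0.
  have E0 : E 0 = J 0 by rewrite /E /bump sin0 mul0r mulr0 subr0.
  have lhs : 2 * (M * (2 / n.+1%:R * (1 - p ^+ n.+1))) <=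
      \int[mu]_(u in period_cell) h u.
    rewrite even_integral// JE ler_pM2l//.
    move: E1 E2; rewrite Epi E0 I0 Id.
    set r := 2 / _; set X := p ^+ _ => E1 E2.
    rewrite (_ : M * (r * (1 - X)) = M * - (r * X) - M * - r); last by ring.
    by lra.
  have cab : continuous (fun u => `|bump n u|).
    move=> u; apply: (@continuous_comp _ _ _ (bump n) Num.norm); first exact: cb.
    exact: norm_continuous.
  have nI : \int[mu]_(u in period_cell) `|bump n u| = 2 * (2 / n.+1%:R).
    rewrite even_integral//; last by move=> u; rewrite bump_odd normrN.
    rewrite (_ : \int[mu]_(u in `[0, pi]) `|bump n u| =
      \int[mu]_(u in `[0, pi]) bump n u).
      by rewrite (Rintegral_FTC pi0 cb (der_bump_int n)) I0 Ipi sub0r opprK.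
    apply: eq_Rintegral => u; rewrite inE/= in_itv/= => uI.
    by rewrite ger0_norm// bump_ge0.
  have rhs : (- \int[mu]_(u in period_cell) (g u * bump n u)) <=
      k * \int[mu]_(u in period_cell) `|bump n u|.
    have mg : measurable_fun period_cell g by case: gL.
    have mb : measurable_fun period_cell (bump n).
      by apply: cell_measurable => u _; exact: cb.
    have mgb : measurable_fun period_cell (fun u => g u * bump n u).
      exact: measurable_funM.
    have inab : mu.-integrable period_cell (EFin \o (fun u => `|bump n u|)).
      apply: continuous_compact_integrable; first exact: segment_compact.
      exact: continuous_subspaceT.
    have inkab : mu.-integrable period_cell (EFin \o (fun u => k * `|bump n u|)).
      apply: continuous_compact_integrable; first exact: segment_compact.
      apply: continuous_subspaceT => u; apply: cvgM; first exact: cvg_cst.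
      exact: cab.
    have le1 : (\int[mu]_(u in period_cell) `|(g u * bump n u)%:E| <=
                \int[mu]_(u in period_cell) (k * `|bump n u|)%:E)%E.
      apply: ae_ge0_le_integral => //.
      - exact: measurable_itv.
      - by apply: measurableT_comp => //; exact/measurable_EFinP.
      - by move=> u _; rewrite lee_fin mulr_ge0.
      - by move/integrableP : inkab => [].
      - apply: (@filterS _ _ (ae_filter_ringOfSetsType mu) _ _ _ gk) => u h1 uc; rewrite lee_fin normrM ler_wpM2r//.
        exact: h1.
    have ingb : mu.-integrable period_cell (EFin \o (fun u => g u * bump n u)).
      apply/integrableP; split; first exact/measurable_EFinP.
      apply: (le_lt_trans le1).
      move/integrableP : inkab => [_]; apply: le_lt_trans.
      rewrite le_eqVlt; apply/orP; left; apply/eqP; apply: eq_integral => u _.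
      by rewrite /= (ger0_norm (mulr_ge0 k0 (normr_ge0 (bump n u)))).
    have h1 : `|\int[mu]_(u in period_cell) (g u * bump n u)| <=
              \int[mu]_(u in period_cell) `|g u * bump n u|.
      by apply: le_normr_Rintegral => //; exact: measurable_itv.
    have h2 : \int[mu]_(u in period_cell) `|g u * bump n u| <=
              \int[mu]_(u in period_cell) (k * `|bump n u|).
      apply: fine_le le1.
      - apply: integrable_fin_num => //; first exact: measurable_itv.
        exact: integrable_abse ingb.
      - by apply: integrable_fin_num => //; exact: measurable_itv.
    have -> : k * \int[mu]_(u in period_cell) `|bump n u| =
              \int[mu]_(u in period_cell) (k * `|bump n u|).
      by rewrite RintegralZl//; exact: measurable_itv.
    apply: le_trans h2; apply: le_trans h1.
    by rewrite lerNl; exact: lerNnormlW.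
  have := wd _ Cb; rewrite -/h => wE.
  move: lhs; rewrite wE => lhs.
  have := le_trans lhs rhs; rewrite nI => fin.
  have n2 : 0 < 2 * (2 / n.+1%:R) :> R by rewrite mulr_gt0.
  rewrite -(ler_pM2l n2); apply: le_trans (le_trans _ fin) _.
    by rewrite le_eqVlt; apply/orP; left; apply/eqP; ring.
  by rewrite mulrC.
have cp : M * (1 - p ^+ n) @[n --> \oo] --> M * (1 - 0).
  apply: cvgM; first exact: cvg_cst.
  apply: cvgB; first exact: cvg_cst.
  by apply: cvg_expr; rewrite ger0_norm.
rewrite -[M](_ : M * (1 - 0) = M); last by rewrite subr0 mulr1.
rewrite -(cvg_lim (@Rhausdorff R) cp).
apply: limr_le; first by apply/cvg_ex; eexists; exact: cp.
near=> n; have n0 : (0 < n)%N by near: n; exact: nbhs_infty_gt.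
by rewrite -(prednK n0); exact: main.
Unshelve. all: by end_near. Qed.

End test_functions.

(** * The first integral and the uniqueness of smooth waves *)

Section solutions.
Context {R : realType}.
Implicit Types (f g eta phi : R -> R) (a b c t u v x : R) (D : set R).

(** The derivative of the energy is 2 f' times the left-hand side of the wave
equation. *)
Lemma energy_constant c f (f' f'' : R -> R) u : is_derive u 1 f (f' u) ->
  is_derive u 1 f' (f'' u) ->
  (c ^+ 2 - 2 * f u) * f'' u - f' u ^+ 2 + f u = 0 ->
  is_derive u 1 (fun u => (c ^+ 2 - 2 * f u) * f' u ^+ 2 + f u ^+ 2) 0.
Proof.
move=> df df' E.
have d := derD (derM (derB (derC (c ^+ 2) u) (derZ 2 df)) (derX 1 df'))
  (derX 1 df).
apply: (is_derive_eq d); rewrite !expr1.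
transitivity (2 * f' u * ((c ^+ 2 - 2 * f u) * f'' u - f' u ^+ 2 + f u)); first by ring.
by rewrite E mulr0.
Qed.

(** If f x <= f y, consider the maximum of f on [x, 2 pi - x].  It is attained
at an interior point, namely y if it is the common value of f at the two ends;
that point is a local maximum and not a crest. *)
Lemma single_lobe_decreasing f : continuous f -> periodic f (2 * pi) ->
  single_lobe f -> forall x y, 0 <= x -> x < y -> y <= pi -> f y < f x.
Proof.
move=> cf pf [ev lmax] x y x0 xy ypi; have pi0 := @pi_gt0 R.
have refl u : f (2 * pi - u) = f u by rewrite addrC pf ev.
rewrite ltNge; apply/negP => fxy.
have x2 : x <= 2 * pi - x by lra.
have [|z zI zmax] := @EVT_max _ f x (2 * pi - x) x2.
  exact: continuous_subspaceT.
have interior z' : z' \in `]x, 2 * pi - x[ ->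
    (forall t, t \in `[x, 2 * pi - x] -> f t <= f z') -> False.
  move=> z'I z'max; have : is_local_max f z'.
    have : \forall t \near z', t \in `]x, 2 * pi - x[ by exact: near_in_itvoo.
    rewrite /is_local_max; apply: filterS => t.
    by rewrite in_itv/= => /andP[/ltW t1 /ltW t2]; apply: z'max; rewrite in_itv/= t1.
  move=> /lmax; apply: not_crest; move: z'I; rewrite in_itv/= => /andP[? ?].
  by apply/andP; split; lra.
have [zint|zend] := boolP (z \in `]x, 2 * pi - x[).
  exact: interior zint zmax.
apply: (interior y); first by rewrite in_itv/= xy/=; lra.
move=> t /zmax ft; apply: (le_trans ft); apply: le_trans fxy.
move: zI zend; rewrite !in_itv/= => /andP[z1 z2].
rewrite negb_and -!leNgt => /orP[z3|z3].
  by rewrite (_ : z = x)//; apply/eqP; rewrite eq_le z3.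
rewrite (_ : z = 2 * pi - x) ?refl//; apply/eqP; by rewrite eq_le z2.
Qed.

Section properties.
Variables (c : R) (f : R -> R).
Hypotheses (cf : continuous f) (pf : periodic f (2 * pi)).
Hypothesis C2 : class_C 2 (~` crests) f.
Hypothesis weq : forall u, (~` crests) u -> wave_eq c f u.
Hypothesis sl : single_lobe f.

Lemma sol_even u : f (- u) = f u. Proof. by case: sl. Qed.

Lemma sol_decr x y : 0 <= x -> x < y -> y <= pi -> f y < f x.
Proof. exact: (single_lobe_decreasing cf pf sl). Qed.

Lemma sol_le x y : 0 <= x -> x <= y -> y <= pi -> f y <= f x.
Proof.
move=> x0; rewrite le_eqVlt => /predU1P[->//|xy] ypi.
by apply: ltW; exact: sol_decr.
Qed.

Lemma sol_ge u : f pi <= f u.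
Proof.
have [k] := reduce_mod_period u; set v := u - _ => vpi.
have -> : f u = f `|v|.
  have -> : f u = f v by rewrite /v -mulrN -mulrNz periodicz.
  by case: ger0P => // _; rewrite sol_even.
by apply: sol_le.
Qed.

Lemma sol_der u : (~` crests) u -> is_derive u 1 f (derive1 f u).
Proof. by move=> nu; have [d _] := C2 nu; apply: derivable_is_derive1; exact: (d 0%N). Qed.

Lemma sol_der2 u : (~` crests) u -> is_derive u 1 (derive1 f) (derive1n 2 f u).
Proof. by move=> nu; have [d _] := C2 nu; apply: derivable_is_derive1; exact: (d 1%N). Qed.

Lemma sol_der_odd u : (~` crests) u -> derive1 f (- u) = - derive1 f u.
Proof.
move=> nu; have nu' : (~` crests) (- u).
  by move=> /crest_opp; rewrite opprK.
have dn : is_derive u 1 (fun u : R => - u) (- 1) by exact: (derN (der_id u)).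
have := dercomp dn (sol_der nu').
rewrite (_ : (fun t => f (- t)) = f); last by apply/funext => t; exact: sol_even.
by move/is_derive_derive1E => ->; rewrite mulrN1 opprK.
Qed.

Lemma pi_not_crest : (~` crests) (pi : R).
Proof. by apply: not_crest; have := @pi_gt0 R => ?; apply/andP; split; lra. Qed.

Lemma sol_der_pi : derive1 f pi = 0.
Proof.
have := sol_der_odd pi_not_crest.
have := periodic_derive1 pf (- pi).
rewrite (_ : - pi + 2 * pi = pi); last by ring.
by move=> <-; lra.
Qed.

(** By symmetry the slope vanishes at the trough, which gives the value of the
constant; the crests have to be excluded because the solution may be singular
there. *)
Lemma sol_energy u : 0 < u < 2 * pi ->
  (c ^+ 2 - 2 * f u) * derive1 f u ^+ 2 + f u ^+ 2 = f pi ^+ 2.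
Proof.
have pi0 := @pi_gt0 R; move=> /andP[u0 u1].
pose G u := (c ^+ 2 - 2 * f u) * derive1 f u ^+ 2 + f u ^+ 2.
have dG v : 0 < v < 2 * pi -> is_derive v 1 G 0.
  move=> vI; have nv := not_crest vI.
  exact: (energy_constant (sol_der nv) (sol_der2 nv) (weq nv)).
have Gpi : G pi = f pi ^+ 2 by rewrite /G sol_der_pi expr0n mulr0 add0r.
rewrite -Gpi -/(G u).
have [upi|upi] := leP u pi.
  have dG' v : v \in `[u, pi] -> is_derive v 1 G 0.
    rewrite in_itv/= => /andP[v1 v2].
    have vI : 0 < v < 2 * pi by apply/andP; split; lra.
    exact: dG.
  by rewrite (der_cst_cc upi dG').
have dG' v : v \in `[pi, u] -> is_derive v 1 G 0.
  rewrite in_itv/= => /andP[v1 v2].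
  have vI : 0 < v < 2 * pi by apply/andP; split; lra.
  exact: dG.
by rewrite (der_cst_cc (ltW upi) dG').
Qed.

Lemma sol_der_le0 u : 0 < u < pi -> derive1 f u <= 0.
Proof.
move=> uI; apply: (@decr_derive1_le0_itv _ f true false 0 pi).
- move=> v; rewrite inE => /not_crest_pos nv.
  by case: (sol_der nv).
- move=> x y; rewrite !in_itv/= => /andP[x0 xpi] /andP[y0 ypi] yx.
  exact: sol_decr.
- by rewrite in_itv.
Qed.

End properties.

Lemma period_int_incr m x y : 0 <= m <= 1 -> 0 <= x -> x < y -> y <= pi ->
  period_int m x < period_int m y :> R.
Proof.
move=> /andP[m0 m1] x0 xy ypi; have pi0 := @pi_gt0 R.
have dP t : t \in `[0, pi] -> is_derive t 1 (period_int m) (period_density m t).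
  by rewrite in_itv/= => /andP[? ?]; apply: der_period_int; apply/andP; split; lra.
have dPo t : t \in `]0, pi[ -> is_derive t 1 (period_int m) (period_density m t).
  by rewrite in_itv/= => /andP[? ?]; apply: der_period_int; apply/andP; split; lra.
apply: (@gtr0_derive1_lt_cc _ (period_int m) 0 pi).
- by move=> t /dPo [].
- move=> t tI; rewrite (is_derive_derive1E (dPo t tI)) sqrtr_gt0.
  move: tI; rewrite in_itv/= => /andP[t0 t1].
  have c1 : -1 < cos t.
    rewrite -cospi ltr_cos ?in_itv/= ?(ltW t0) ?(ltW t1) ?lexx ?(ltW pi0)//.
  have [c0|c0] := leP 0 (cos t).
    have : 0 <= m * cos t by rewrite mulr_ge0.
    lra.
  have : 0 <= (1 - m) * (- cos t) by rewrite mulr_ge0//; lra.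
  lra.
- exact: der_within dP.
- by rewrite in_itv/= x0/=; lra.
- by rewrite in_itv/= ypi andbT; lra.
- by [].
Qed.

(** By the first integral, th = acos (- f / a) satisfies
c * period_density m th * th' = - 1, so that c * period_int m th + u is
constant; it equals pi at the trough. *)
Lemma phase_of_solution c a f (f' : R -> R) : 0 < c -> 0 < a ->
  {within `[0, pi], continuous f} -> f 0 = a -> f pi = - a ->
  (forall u, 0 < u < pi -> [/\ is_derive u 1 f (f' u), f' u < 0,
     - a < f u < a, 0 < c ^+ 2 - 2 * f u &
     (c ^+ 2 - 2 * f u) * f' u ^+ 2 = a ^+ 2 - f u ^+ 2]) ->
  forall u, 0 <= u <= pi -> c * period_int (2 * a / c ^+ 2) (acos (- f u / a)) = pi - u.
Proof.
move=> c0 a0 cf f0 fpi data u /andP[u0 upi]; have pi0 := @pi_gt0 R.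
have an : a != 0 by rewrite gt_eqF.
have cn : c != 0 by rewrite gt_eqF.
have rg v : 0 <= v <= pi -> -1 <= - f v / a <= 1.
  move=> /andP[v0 vpi].
  have /andP[h1 h2] : - a <= f v <= a.
    have [->|vn0] := eqVneq v 0; first by rewrite f0 lexx andbT; lra.
    have [->|vnpi] := eqVneq v pi; first by rewrite fpi lexx; lra.
    have vI : 0 < v < pi by rewrite !lt_neqAle vnpi vpi v0 eq_sym vn0.
    by have [_ _ /andP[h1 h2] _ _] := data v vI; rewrite !ltW.
  by rewrite ler_pdivlMr// ler_pdivrMr//; apply/andP; split; lra.
pose m := 2 * a / c ^+ 2.
pose th v := acos (- f v / a).
pose G v := c * period_int m (th v) + v.
have cth : {within `[0, pi], continuous th}.
  apply: (within_comp acos_within).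
    have cl : {within setT, continuous (fun x => - x / a)}.
      apply: continuous_subspaceT => x.
      exact: (is_derive_continuous (derM (derN (der_id x)) (derC a^-1 x))).
    exact: (within_comp cl cf).
  by move=> v; rewrite /= !in_itv/=; exact: rg.
have cG : {within `[0, pi], continuous G}.
  have cP : {within `[0, pi], continuous (period_int m)} by apply: period_int_within; lra.
  have cPt : {within `[0, pi], continuous (period_int m \o th)}.
    apply: (within_comp cP cth) => v; rewrite /= !in_itv/= => vI.
    by rewrite acos_ge0 ?acos_lepi ?rg.
  move=> v; apply: cvgD; first by apply: cvgM; [exact: cvg_cst|exact: cPt].
  have cid : {within `[0, pi], continuous (fun x : R => x)}.
    by apply: continuous_subspaceT => x; exact: (is_derive_continuous (der_id x)).
  exact: cid.
have dG v : v \in `]0, pi[ -> is_derive v 1 G 0.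
  rewrite in_itv/= => vI; have [df f'0 /andP[fa1 fa2] w0 E] := data v vI.
  pose y := - f v / a.
  have yI : -1 < y < 1.
    by rewrite /y ltr_pdivlMr// ltr_pdivrMr//; apply/andP; split; lra.
  have dy : is_derive v 1 (fun v => - f v / a) (- f' v / a).
    by apply: (is_derive_eq (derM (derN df) (derC a^-1 v))); rewrite mulr0 addr0.
  have dth := dercomp dy (is_derive1_acos yI).
  have thI : - (3 * pi) < th v < 3 * pi.
    have yI' : -1 <= y <= 1 by case/andP: yI => ? ?; rewrite !ltW.
    have := acos_ge0 yI'; have := acos_lepi yI'; rewrite -/(th v) => h1 h2.
    by apply/andP; split; lra.
  have dPs := @der_period_int_comp _ m th v _ thI dth.
  apply: (is_derive_eq (derD (derZ c dPs) (der_id v))).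
  set Y := Num.sqrt (1 - y ^+ 2); set X := period_density m (th v).
  have yI' : -1 <= y <= 1 by case/andP: yI => ? ?; rewrite !ltW.
  have cy : cos (th v) = y by rewrite acosK// in_itv.
  have Y0 : 0 < 1 - y ^+ 2.
    have : 0 < (1 - y) * (1 + y) by case/andP: yI => ? ?; rewrite mulr_gt0//; lra.
    by rewrite (_ : (1 - y) * (1 + y) = 1 - y ^+ 2)//; ring.
  have Yp : 0 < Y by rewrite sqrtr_gt0.
  have Y2 : a ^+ 2 * Y ^+ 2 = a ^+ 2 - f v ^+ 2.
    by rewrite sqr_sqrtr ?(ltW Y0)// /y; field.
  have wX : c ^+ 2 * (1 + m * y) = c ^+ 2 - 2 * f v.
    by rewrite /m /y; field; rewrite cn an.
  have X0 : 0 < 1 + m * y.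
    by rewrite -(pmulr_rgt0 _ (_ : 0 < c ^+ 2)) ?wX// exprn_gt0.
  have Xp : 0 < X by rewrite /X /period_density cy sqrtr_gt0.
  have X2 : c ^+ 2 * X ^+ 2 = c ^+ 2 - 2 * f v.
    by rewrite /X /period_density cy sqr_sqrtr ?(ltW X0).
  (* the first integral, by comparing squares of nonnegative numbers *)
  have key : a * Y = c * X * - f' v.
    apply/eqP; rewrite -(@eqrXn2 _ 2) ?mulr_ge0 ?(ltW a0) ?(ltW Yp) ?(ltW c0) ?(ltW Xp)//; last by rewrite oppr_ge0 ltW.
    by rewrite exprMn Y2 !exprMn X2 sqrrN E.
  have Yn : Y != 0 by rewrite gt_eqF.
  have -> : c * (X * (- Y^-1 * (- f' v / a))) = - (c * X * - f' v) / (a * Y).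
    by field; rewrite an Yn.
  by rewrite -key mulNr divff ?mulf_neq0// addNr.
have Gpi : G pi = pi.
  by rewrite /G /th fpi opprK divff// acos1 period_int0 mulr0 add0r.
have cGu : {within `[u, pi], continuous G}.
  by apply: continuous_subspaceW cG; apply: subset_itvr; rewrite bnd_simp.
have dGu v : v \in `]u, pi[ -> is_derive v 1 G 0.
  move=> vI; have vI' : v \in `]0, pi[.
    by move: vI; rewrite !in_itv/= => /andP[v1 v2]; rewrite v2 andbT; lra.
  exact: dG.
have := der_cst upi cGu dGu.
rewrite Gpi /G -/m -/(th u); lra.
Qed.

Lemma energy_slope_lt0 a c f u (d : R) : - a < f u < a -> 0 < c ^+ 2 - 2 * f u ->
  (c ^+ 2 - 2 * f u) * d ^+ 2 = a ^+ 2 - f u ^+ 2 -> d <= 0 -> d < 0.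
Proof.
move=> /andP[h1 h2] w E; rewrite le_eqVlt => /predU1P[d0|//].
move: E; rewrite d0 expr0n mulr0 => E.
have : 0 < (a - f u) * (a + f u) by rewrite mulr_gt0//; lra.
by rewrite (_ : _ * _ = a ^+ 2 - f u ^+ 2); [rewrite -E ltxx|ring].
Qed.

Lemma half_period_inj m m' : 0 <= m <= 1 -> 0 <= m' <= 1 -> half_period m = half_period m' -> m = m' :> R.
Proof.
suff lt p q : 0 <= p -> p < q -> q <= 1 -> half_period q < half_period p :> R.
  move=> /andP[h1 h2] /andP[h3 h4] E.
  have [h|h|//] := ltgtP m m'.
  - by have := lt _ _ h1 h h4; rewrite E ltxx.
  - by have := lt _ _ h3 h h2; rewrite E ltxx.
move=> p0 pq q1; have pi0 := @pi_gt0 R.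
have := half_period_decr p0 (ltW pq) q1.
have : 0 < (q ^+ 2 - p ^+ 2) * pi / 16.
  rewrite divr_gt0// mulr_gt0// subr_gt0 ltr_pXn2r// nnegrE; lra.
lra.
Qed.

(** Smoothness forces the slope to vanish at the crest, hence the energy
relates the crest to the trough: eta(0)^2 = eta(pi)^2.  So the amplitude is
eta(0), and the phase equation evaluated at the crest is the period
condition. *)
Lemma smooth_solution_phase c f : 0 < c -> smooth_single_lobe_solution c f ->
  let a := f 0 in let m := 2 * a / c ^+ 2 in
  [/\ 0 < a, 0 < m < 1, c * half_period m = pi &
   forall u, 0 <= u <= pi -> -1 <= - f u / a <= 1 /\
     c * period_int m (acos (- f u / a)) = pi - u].
Proof.
move=> c0 [Cf weq _ sl] a m; have pi0 := @pi_gt0 R.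
have [pf C2'] := Cf 2%N.
have C2 : class_C 2 (~` crests) f by move=> u _; exact: C2'.
have weq' u : (~` crests) u -> wave_eq c f u by move=> _.
have df u : is_derive u 1 f (derive1 f u).
  by have [d _] := C2' u I; apply: derivable_is_derive1; exact: (d 0%N).
have df2 u : is_derive u 1 (derive1 f) (derive1n 2 f u).
  by have [d _] := C2' u I; apply: derivable_is_derive1; exact: (d 1%N).
have cf : continuous f by move=> u; exact: is_derive_continuous (df u).
have c20 : 0 < c ^+ 2 by rewrite exprn_gt0.
have decr := sol_decr cf pf sl.
have en := sol_energy pf C2 weq' sl.
have d0 : derive1 f 0 = 0.
  have dn : is_derive (0 : R) 1 (fun u : R => - u) (- 1) by exact: (derN (der_id 0)).
  have := dercomp dn (df (- 0)).
  rewrite (_ : (fun t => f (- t)) = f); last by apply/funext => t; exact: sol_even sl t.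
  by move/is_derive_derive1E; rewrite oppr0; lra.
(* the first integral holds at the crest as well *)
have en0 : f 0 ^+ 2 = f pi ^+ 2.
  pose G u := (c ^+ 2 - 2 * f u) * derive1 f u ^+ 2 + f u ^+ 2.
  have dG v : v \in `[0, pi] -> is_derive v 1 G 0.
    by move=> _; exact: (energy_constant (df v) (df2 v) (weq v)).
  have := der_cst_cc (ltW pi0) dG.
  by rewrite /G d0 (sol_der_pi pf C2 sl) !expr0n !mulr0 !add0r => ->.
have f0pi : f pi < f 0 by apply: decr.
have fpiE : f pi = - a.
  have : (f 0 - f pi) * (f 0 + f pi) = 0.
    by rewrite (_ : _ * _ = f 0 ^+ 2 - f pi ^+ 2); [rewrite en0 subrr|ring].
  move/eqP; rewrite mulf_eq0 => /orP[/eqP|/eqP]; rewrite /a; lra.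
have a0 : 0 < a by move: f0pi; rewrite fpiE -/a; lra.
have fI u : 0 < u < pi -> - a < f u < a.
  by move=> /andP[u0 u1]; rewrite -fpiE /a !decr// ltW.
have enI u : 0 < u < pi -> (c ^+ 2 - 2 * f u) * derive1 f u ^+ 2 = a ^+ 2 - f u ^+ 2.
  move=> /andP[u0 u1]; have := en u; rewrite fpiE sqrrN => <-.
    by ring.
  by apply/andP; split; lra.
(* the crest lies below the critical level *)
have ac : 2 * a < c ^+ 2.
  have w0 : 0 <= c ^+ 2 - 2 * f 0.
    apply: (@ge0_at_right _ (fun u => c ^+ 2 - 2 * f u)).
      move=> u; apply: cvgB; first exact: cvg_cst.
      by apply: cvgM; [exact: cvg_cst|exact: cf].
    move=> u uI; have /andP[h2 h3] := fI u uI.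
    rewrite leNgt; apply/negP => w.
    have : (c ^+ 2 - 2 * f u) * derive1 f u ^+ 2 <= 0.
      by rewrite mulr_le0_ge0 ?sqr_ge0// ltW.
    rewrite enI//.
    have : 0 < (a - f u) * (a + f u) by rewrite mulr_gt0//; lra.
    rewrite (_ : _ * _ = a ^+ 2 - f u ^+ 2); [lra|ring].
  rewrite -subr_gt0 lt_neqAle w0 andbT; apply/eqP => h.
  have := weq 0; rewrite /wave_eq d0 -/a -h mul0r expr0n subr0 add0r; lra.
have m01 : 0 < m < 1.
  by rewrite /m divr_gt0 ?mulr_gt0//= ltr_pdivrMr// mul1r.
have data u : 0 < u < pi -> [/\ is_derive u 1 f (derive1 f u), derive1 f u < 0,
     - a < f u < a, 0 < c ^+ 2 - 2 * f u &
     (c ^+ 2 - 2 * f u) * derive1 f u ^+ 2 = a ^+ 2 - f u ^+ 2].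
  move=> uI; have w : 0 < c ^+ 2 - 2 * f u by have /andP[_ ?] := fI u uI; lra.
  split=> //; [|exact: fI|exact: enI].
  apply: (energy_slope_lt0 (fI u uI) w (enI u uI)).
  exact: (sol_der_le0 cf pf C2 sl uI).
have cfw : {within `[0, pi], continuous f} by exact: continuous_subspaceT.
have ph := phase_of_solution c0 a0 cfw erefl fpiE data.
split=> //.
- have := ph 0; rewrite lexx (ltW pi0) => /(_ isT).
  by rewrite -/a mulNr divff ?gt_eqF// acosN1 subr0.
- move=> u uI; split; last exact: ph.
  rewrite ler_pdivlMr// ler_pdivrMr// mulN1r mul1r lerN2 lerNl.
  move: uI => /andP[u0 u1].
  have h1 : f u <= f 0 by apply: (sol_le cf pf sl).
  have h2 : f pi <= f u by apply: (sol_le cf pf sl).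
  by rewrite -/a in h1; rewrite h1 -fpiE.
Qed.

Lemma even_periodic_eq f g : (forall u, f (- u) = f u) -> (forall u, g (- u) = g u) ->
  periodic f (2 * pi) -> periodic g (2 * pi) ->
  (forall u, 0 <= u <= pi -> f u = g u) -> f = g.
Proof.
move=> evf evg pf pg E; apply/funext => u.
have [k] := reduce_mod_period u; set v := u - _ => vpi.
have red (h : R -> R) : (forall u, h (- u) = h u) -> periodic h (2 * pi) -> h u = h `|v|.
  move=> evh ph; have -> : h u = h v by rewrite /v -mulrN -mulrNz (periodicz _ _ ph).
  by case: ger0P => // _; rewrite evh.
by rewrite (red f)// (red g)// E// normr_ge0.
Qed.

(** The period condition determines the parameter, since half_period is
injective on [0, 1]; the parameter determines the amplitude and the phase. *)
Lemma smooth_solution_unique c f g : 0 < c ->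
  smooth_single_lobe_solution c f -> smooth_single_lobe_solution c g -> f = g.
Proof.
move=> c0 Sf Sg.
have [a0 m01 Hm phf] := smooth_solution_phase c0 Sf.
have [b0 n01 Hn phg] := smooth_solution_phase c0 Sg.
have w01 (x : R) : 0 < x < 1 -> 0 <= x <= 1.
  by move=> /andP[h1 h2]; rewrite !ltW.
have cn : c != 0 by rewrite gt_eqF.
have mn : 2 * f 0 / c ^+ 2 = 2 * g 0 / c ^+ 2.
  apply: half_period_inj; [exact: w01|exact: w01|].
  by apply: (mulfI cn); rewrite Hm Hn.
have ab : f 0 = g 0.
  have e x : 2 * x / c ^+ 2 * (c ^+ 2 / 2) = x by field.
  by rewrite -[LHS]e mn e.
have [Cf _ _ [evf _]] := Sf; have [pf _] := Cf 0%N.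
have [Cg _ _ [evg _]] := Sg; have [pg _] := Cg 0%N.
apply: (even_periodic_eq evf evg pf pg) => u uI.
have [fI Pf] := phf u uI; have [gI Pg] := phg u uI.
rewrite -ab in gI Pg.
have : period_int (2 * f 0 / c ^+ 2) (acos (- f u / f 0)) =
       period_int (2 * f 0 / c ^+ 2) (acos (- g u / f 0)).
  by apply: (mulfI cn); rewrite Pf Pg.
set x := acos _; set y := acos _ => Pxy.
have xy : x = y.
  have [h|h|//] := ltgtP x y.
  + have := period_int_incr (w01 _ m01) (acos_ge0 fI) h (acos_lepi gI).
    by rewrite Pxy ltxx.
  + have := period_int_incr (w01 _ m01) (acos_ge0 gI) h (acos_lepi fI).
    by rewrite Pxy ltxx.
have : - f u / f 0 = - g u / f 0.
  by rewrite -[LHS]acosK ?in_itv// -/x xy acosK// in_itv.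
by move/(mulIf (invr_neq0 (lt0r_neq0 a0)))/oppr_inj.
Qed.

End solutions.

(** * Uniqueness at the critical speed *)

Section critical.
Context {R : realType}.
Notation mu := (@lebesgue_measure R).
Implicit Types (f g eta phi : R -> R) (a b c t u v x : R) (D : set R).

(** At this energy the first integral has the common factor c^2 / 2 - f.
Where that factor is zero, the wave equation itself gives the slope. *)
Lemma critical_slope c f : singular_single_lobe_solution c f ->
  f pi ^+ 2 = (c ^+ 2 / 2) ^+ 2 ->
  forall v, 0 < v < 2 * pi -> derive1 f v ^+ 2 = (c ^+ 2 / 2 + f v) / 2.
Proof.
move=> [[pf _] C2 weq _ sl] E v vI; set A := c ^+ 2 / 2 in E *.
have cA : c ^+ 2 = 2 * A by rewrite /A; field.
have en := sol_energy pf C2 weq sl vI.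
have [fA|fA] := eqVneq (f v) A.
  have := weq v (not_crest vI); rewrite /wave_eq fA cA subrr mul0r; lra.
have An : A - f v != 0 by rewrite subr_eq0 eq_sym.
have n2 : (2 : R) != 0 by rewrite pnatr_eq0.
apply: (mulfI (mulf_neq0 n2 An)).
have -> : 2 * (A - f v) * ((A + f v) / 2) = A ^+ 2 - f v ^+ 2 by field.
by move: en; rewrite E cA; lra.
Qed.

(** The square root of 8 (c^2 / 2 + f) has slope - 1 on ]0, pi[ and vanishes
at the trough. *)
Lemma critical_energy_solution c f : 0 < c -> singular_single_lobe_solution c f ->
  f pi ^+ 2 = (c ^+ 2 / 2) ^+ 2 ->
  forall u, 0 <= u <= pi -> f u = (pi - u) ^+ 2 / 8 - c ^+ 2 / 2.
Proof.
move=> c0 Sf E; have pi0 := @pi_gt0 R; have slope := critical_slope Sf E.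
have [Cf C2 weq _ sl] := Sf.
have cf := C_per0_continuous Cf; have pf : periodic f (2 * pi) by case: Cf.
set A := c ^+ 2 / 2 in E slope *.
have A0 : 0 < A by rewrite /A divr_gt0// exprn_gt0.
have fpi : f pi = - A.
  have := slope pi; rewrite (sol_der_pi pf C2 sl) expr0n /= => h.
  have : 0 = (A + f pi) / 2 by apply: h; apply/andP; split; lra.
  lra.
have fgt v : 0 < v < pi -> 0 < A + f v.
  move=> /andP[v0 v1]; have := sol_decr cf pf sl (ltW v0) v1 (lexx pi).
  by rewrite fpi; lra.
pose S v := Num.sqrt (8 * (A + f v)).
pose G v := S v + v.
have cG : continuous G.
  move=> v; apply: cvgD; last exact: cvg_id.
  apply: (@continuous_comp _ _ _ (fun v => 8 * (A + f v)) Num.sqrt).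
    apply: cvgM; first exact: cvg_cst.
    by apply: cvgD; [exact: cvg_cst|exact: cf].
  exact: sqrt_continuous.
have dG v : v \in `]0, pi[ -> is_derive v 1 G 0.
  rewrite in_itv/= => vI; have vI' : v \in `]0, pi[ by rewrite in_itv.
  have df := sol_der C2 (not_crest_pos vI').
  have f8 : 0 < 8 * (A + f v) by rewrite mulr_gt0// fgt.
  have dS := @dersqrt _ (fun v => 8 * (A + f v)) v _ f8 (derZ 8 (derD (derC A v) df)).
  apply: (is_derive_eq (derD dS (der_id v))).
  have Sp : 0 < S v by rewrite sqrtr_gt0.
  have f'0 := sol_der_le0 cf pf C2 sl vI.
  have SE : S v = - (4 * derive1 f v).
    apply/eqP; rewrite -(@eqrXn2 _ 2) ?(ltW Sp)//; last lra.
    rewrite sqr_sqrtr ?(ltW f8)// sqrrN exprMn slope; last first.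
      by case/andP: vI => ? ?; apply/andP; split; lra.
    by apply/eqP; field.
  have dn : derive1 f v != 0.
    by apply/eqP => d0; move: Sp; rewrite SE d0 mulr0 oppr0 ltxx.
  by rewrite -/(S v) SE; field.
move=> u /andP[u0 upi].
have cGu : {within `[u, pi], continuous G} by exact: continuous_subspaceT.
have dGu v : v \in `]u, pi[ -> is_derive v 1 G 0.
  move=> vI; have vI' : v \in `]0, pi[.
    by move: vI; rewrite !in_itv/= => /andP[v1 v2]; rewrite v2 andbT; lra.
  exact: dG.
have := der_cst upi cGu dGu.
rewrite /G {1}/S fpi subrr mulr0 sqrtr0 add0r => h.
have SE : S u = pi - u by lra.
have f8 : 0 <= 8 * (A + f u).
  have [->|un] := eqVneq u pi; first by rewrite fpi subrr mulr0.
  have := sol_decr cf pf sl u0 _ (lexx pi); rewrite lt_neqAle un upi => /(_ isT).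
  by rewrite fpi; lra.
by rewrite -SE sqr_sqrtr//; field.
Qed.

(** On ]0, pi[ the flux is the square root of (c^2 - 2 f) (f(pi)^2 - f^2),
an expression that is continuous up to the crest.  It is a primitive of
f + f'^2, so the integral constraint says that its value at the crest, counted
once from each side, is zero. *)
Lemma flux_at_crest c f : singular_single_lobe_solution c f ->
  (forall u, 0 < u <= pi -> 0 < c ^+ 2 - 2 * f u) ->
  (c ^+ 2 - 2 * f 0) * (f pi ^+ 2 - f 0 ^+ 2) = 0.
Proof.
move=> [Cf C2 weq [iF F0] sl] w0; have pi0 := @pi_gt0 R.
have cf := C_per0_continuous Cf; have pf : periodic f (2 * pi) by case: Cf.
have C1 := class_C_derive C2.
pose F u := f u + derive1 f u ^+ 2.
pose P u := (c ^+ 2 - 2 * f u) * (f pi ^+ 2 - f u ^+ 2).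
pose Q u := Num.sqrt (P u).
have cP : continuous P.
  move=> u; apply: cvgM.
    apply: cvgB; first exact: cvg_cst.
    by apply: cvgM; [exact: cvg_cst|exact: cf].
  apply: cvgB; first exact: cvg_cst.
  apply: (@continuous_comp _ _ _ f (fun x => x ^+ 2)); first exact: cf.
  exact: exprn_continuous.
have cQ : continuous Q.
  move=> u; apply: (@continuous_comp _ _ _ P Num.sqrt); first exact: cP.
  exact: sqrt_continuous.
have PE u : 0 < u < pi -> P u = ((c ^+ 2 - 2 * f u) * derive1 f u) ^+ 2.
  move=> /andP[u0 u1]; have uI : 0 < u < 2 * pi by apply/andP; split; lra.
  by rewrite /P -(sol_energy pf C2 weq sl uI); ring.
have QE u : 0 < u < pi -> Q u = - ((c ^+ 2 - 2 * f u) * derive1 f u).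
  move=> uI; have f'0 := sol_der_le0 cf pf C2 sl uI.
  have w := w0 u; rewrite /Q PE// sqrtr_sqr ler0_norm//.
  by rewrite mulr_ge0_le0// ltW// w//; case/andP: uI => -> /ltW.
have dQ u : 0 < u < pi -> is_derive u 1 Q (F u).
  move=> uI; have uI' : u \in `]0, pi[ by rewrite in_itv.
  have nu := not_crest_pos uI'.
  have df := sol_der C2 nu; have df2 := sol_der2 C2 nu.
  have d := derN (derM (derB (derC (c ^+ 2) u) (derZ 2 df)) df2).
  have : is_derive u 1 (fun u => - ((c ^+ 2 - 2 * f u) * derive1 f u)) (F u).
    apply: (is_derive_eq d); have := weq u nu; rewrite /wave_eq /F => h.
    transitivity (f u + derive1 f u ^+ 2 -
      ((c ^+ 2 - 2 * f u) * derive1n 2 f u - derive1 f u ^+ 2 + f u)); first by ring.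
    by rewrite h subr0.
  apply: near_eq_is_derive.
  have : \forall v \near u, v \in `]0, pi[ by exact: near_in_itvoo.
  by apply: filterS => v; rewrite in_itv/= => /QE.
have Fk u : f pi <= F u.
  by rewrite /F (le_trans (sol_ge cf pf sl u))// lerDl sqr_ge0.
have cF u : (~` crests) u -> {for u, continuous F}.
  move=> nu; have [_ c1] := C1 u nu.
  by apply: cvgD; [exact: cf|apply: cvgM; exact: c1].
have evF u : (~` crests) u -> F (- u) = F u.
  by move=> nu; rewrite /F (sol_even sl) (sol_der_odd C2 sl nu) sqrrN.
have dQ1 u : u \in `]0, pi[ -> is_derive u 1 Q (F u).
  by rewrite in_itv/=; exact: dQ.
(* on [- pi, 0] a primitive of the even function F is the odd reflection of Q *)
pose Q2 u := - Q (- u).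
have cN : continuous (fun u : R => - u).
  by move=> u; exact: (is_derive_continuous (derN (der_id u))).
have cQ2 : continuous Q2.
  move=> u; apply: cvgN; apply: (@continuous_comp _ _ _ (fun u => - u) Q).
    exact: cN.
  exact: cQ.
have dQ2 u : u \in `]- pi, 0[ -> is_derive u 1 Q2 (F u).
  move=> uI; have nu := not_crest_neg uI.
  have nuI : 0 < - u < pi.
    by move: uI; rewrite in_itv/= => /andP[? ?]; apply/andP; split; lra.
  have dn : is_derive u 1 (fun u : R => - u) (- 1) by exact: (derN (der_id u)).
  apply: (is_derive_eq (derN (dercomp dn (dQ _ nuI)))).
  by rewrite mulrN1 opprK evF.
have np : - pi < 0 :> R by lra.
have cw (h : R -> R) x y : continuous h -> {within `[x, y], continuous h}.
  exact: continuous_subspaceT.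
have [i1 e1] := FTC_lower_bounded np (fun u _ => Fk u)
  (fun u uI => cF u (not_crest_neg uI)) (cw _ _ _ cQ2) dQ2.
have [i2 e2] := FTC_lower_bounded pi0 (fun u _ => Fk u)
  (fun u uI => cF u (not_crest_pos uI)) (cw _ _ _ cQ) dQ1.
have [_ e3] := integrable_concat (ltW np) (ltW pi0) i1 i2.
have Qpi : Q pi = 0 by rewrite /Q /P subrr mulr0 sqrtr0.
have : Q 0 = 0.
  move: F0; rewrite -[X in X = _ -> _]/(\int[mu]_(u in `[- pi, pi]) F u).
  have Q20 : Q2 0 = - Q 0 by rewrite /Q2 oppr0.
  have Q2pi : Q2 (- pi) = 0 by rewrite /Q2 opprK Qpi oppr0.
  rewrite e3 e1 e2 Q20 Q2pi Qpi => h; lra.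
move/eqP; rewrite sqrtr_eq0 => P0.
apply/eqP; rewrite -/(P 0) eq_le P0/=.
by apply: (ge0_at_right cP) => u uI; rewrite PE ?sqr_ge0.
Qed.

(** Otherwise f + f'^2, which is at least f(pi), would have a positive
integral. *)
Lemma trough_le0 c f : singular_single_lobe_solution c f ->
  f pi <= 0.
Proof.
move=> [Cf C2 weq [iF F0] sl]; have pi0 := @pi_gt0 R.
have cf := C_per0_continuous Cf; have pf : periodic f (2 * pi) by case: Cf.
rewrite leNgt; apply/negP => fpi.
have ic : mu.-integrable period_cell (EFin \o cst (f pi)).
  apply: continuous_compact_integrable; first exact: segment_compact.
  by apply: continuous_subspaceT => y; exact: cst_continuous.
have : \int[mu]_(u in period_cell) (cst (f pi) u) <=
       \int[mu]_(u in period_cell) (f u + derive1 f u ^+ 2).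
  apply: le_Rintegral => //; first exact: measurable_itv.
  by move=> u _; rewrite (le_trans (sol_ge cf pf sl u))// lerDl sqr_ge0.
rewrite F0 Rintegral_cst//=; last exact: measurable_itv.
rewrite lebesgue_measure_itv/= lte_fin ifT; last lra.
rewrite -EFinD /= leNgt => /negP; apply.
by rewrite mulr_gt0//; lra.
Qed.

(** If the energy f(pi)^2 is not that of the critical level c^2 / 2, then
this level is not reached off the crest, and flux_at_crest leaves two cases:
the crest is at the critical level, or it is a turning point.  Both are
impossible. *)
Lemma critical_solution f : singular_single_lobe_solution c_star f ->
  in_W1infty f ->
  forall u, 0 <= u <= pi -> f u = (pi - u) ^+ 2 / 8 - c_star ^+ 2 / 2.
Proof.
move=> Sf Wf; have pi0 := @pi_gt0 R; have c0 := @c_star_gt0 R.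
set c := c_star in Sf c0 *.
have [E|EA] := eqVneq (f pi ^+ 2) ((c ^+ 2 / 2) ^+ 2).
  exact: critical_energy_solution.
exfalso; have fpi0 := trough_le0 Sf.
have [Cf C2 weq _ sl] := Sf.
have cf := C_per0_continuous Cf; have pf : periodic f (2 * pi) by case: Cf.
have C1 := class_C_derive C2.
have c20 : 0 < c ^+ 2 by rewrite exprn_gt0.
have en := sol_energy pf C2 weq sl.
have decr := sol_decr cf pf sl.
(* the critical level is not reached off the crest *)
have wn0 u : 0 < u <= pi -> f u != c ^+ 2 / 2.
  move=> /andP[u0 u1]; apply/eqP => fu; move/eqP : EA; apply.
  have uI : 0 < u < 2 * pi by apply/andP; split; lra.
  by rewrite -(en u uI) fu (_ : c ^+ 2 - 2 * (c ^+ 2 / 2) = 0) ?mul0r ?add0r//; field.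
have w0 u : 0 < u <= pi -> 0 < c ^+ 2 - 2 * f u.
  move=> /andP[u0 u1]; rewrite ltNge; apply/negP => h.
  have cfu : {within `[u, pi], continuous f} by exact: continuous_subspaceT.
  have fu : f pi <= f u by exact: sol_ge.
  have [|v vI fv] := @IVT _ f u pi (c ^+ 2 / 2) u1 cfu.
    by rewrite (min_idPr fu) (max_idPl fu); apply/andP; split; lra.
  move: vI; rewrite in_itv/= => /andP[v1 v2].
  have := wn0 v; rewrite fv eqxx => /(_ _)/negP; apply => //.
  by rewrite v2 andbT; lra.
have wc0 : 0 <= c ^+ 2 - 2 * f 0.
  apply: (@ge0_at_right _ (fun u => c ^+ 2 - 2 * f u)).
    move=> u; apply: cvgB; first exact: cvg_cst.
    by apply: cvgM; [exact: cvg_cst|exact: cf].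
  by move=> u /andP[u0 upi]; rewrite ltW// w0// u0 ltW.
have enI u : 0 < u < pi ->
    (c ^+ 2 - 2 * f u) * derive1 f u ^+ 2 = f pi ^+ 2 - f u ^+ 2.
  move=> /andP[u0 u1]; have uI : 0 < u < 2 * pi by apply/andP; split; lra.
  by rewrite -(en u uI); ring.
have /eqP := flux_at_crest Sf w0.
rewrite mulf_eq0 => /orP[/eqP fc|/eqP E0].
- (* the crest is at the critical level: the slope is unbounded *)
  have fA : f 0 = c ^+ 2 / 2 by lra.
  have Egt : (c ^+ 2 / 2) ^+ 2 < f pi ^+ 2.
    rewrite lt_neqAle eq_sym EA/= -subr_ge0.
    rewrite -fA; apply: (@ge0_at_right _ (fun u => f pi ^+ 2 - f u ^+ 2)).
      move=> u; apply: cvgB; first exact: cvg_cst.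
      apply: (@continuous_comp _ _ _ f (fun x => x ^+ 2)); first exact: cf.
      exact: exprn_continuous.
    move=> u uI; rewrite -enI// mulr_ge0 ?sqr_ge0// ltW// w0//.
    by case/andP: uI => -> /ltW.
  have [k kM] := W1infty_derivative_bound Cf (sol_even sl) (class_CW C2)
    (fun u uI => sol_der_le0 cf pf C2 sl uI) Wf.
  (* a nonnegative slope exceeding the bound k *)
  pose M := Num.max 0 k + 1.
  have M0 : 0 <= M by rewrite addr_ge0// le_max lexx.
  have kM' : k < M by rewrite /M ltr_pwDr// le_max lexx orbT.
  suff [d dI slope] : exists2 d, 0 < d < pi &
      forall u, 0 < u < d -> derive1 f u <= - M.
    by have := kM M d M0 dI slope; lra.
  have M20 : 0 < M ^+ 2 + 1 by rewrite ltr_wpDl ?sqr_ge0.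
  (* if f 0 - f u < ep, then f u > 0 and (c^2 - 2 f u) (M^2 + 1) < f(pi)^2 - f(0)^2 *)
  pose ep := Num.min (f 0) ((f pi ^+ 2 - f 0 ^+ 2) / (2 * (M ^+ 2 + 1))).
  have ep0 : 0 < ep.
    rewrite lt_min; apply/andP; split; first lra.
    by rewrite fA divr_gt0 ?subr_gt0// mulr_gt0.
  have /cvgrPdist_lt/(_ _ ep0)/nbhs_ballP[e /= e0 he] := cf 0.
  exists (Num.min e (pi / 2)).
    rewrite lt_min e0 divr_gt0//= gt_min; apply/orP; right; lra.
  move=> u; rewrite lt_min => /andP[u0 /andP[ue u1]].
  have upi : u < pi by lra.
  have uI : 0 < u < pi by rewrite u0.
  have := he u; rewrite /ball/= sub0r normrN gtr0_norm// => /(_ ue).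
  have fu : f u < f 0 by apply: decr => //; exact: ltW.
  rewrite gtr0_norm ?subr_gt0// lt_min => /andP[h1 h2].
  have w : 0 < c ^+ 2 - 2 * f u by apply: w0; rewrite u0 ltW.
  have w2 : (c ^+ 2 - 2 * f u) * (M ^+ 2 + 1) < f pi ^+ 2 - f 0 ^+ 2.
    have -> : c ^+ 2 - 2 * f u = 2 * (f 0 - f u) by rewrite fA; field.
    rewrite ltr_pdivlMr ?mulr_gt0// in h2.
    by rewrite mulrAC mulrC (_ : _ * _ = (f 0 - f u) * (2 * (M ^+ 2 + 1)))//; ring.
  have f2 : f u ^+ 2 < f 0 ^+ 2.
    by rewrite ltr_pXn2r// ?nnegrE; lra.
  have h3 : (c ^+ 2 - 2 * f u) * M ^+ 2 < (c ^+ 2 - 2 * f u) * derive1 f u ^+ 2.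
    rewrite enI//; move: w2; rewrite mulrDr mulr1; lra.
  rewrite ltr_pM2l// in h3.
  have f'0 := sol_der_le0 cf pf C2 sl uI.
  rewrite lerNr ltW//.
  have n0 : 0 <= - derive1 f u by lra.
  by rewrite -(ltr_pXn2r (ltn0Sn 1)) ?nnegrE// sqrrN.
- (* the crest is a turning point: the period is too long *)
  have f0pi : f pi < f 0 by apply: decr.
  have fpiE : f pi = - f 0.
    have : (f pi - f 0) * (f pi + f 0) = 0.
      by rewrite (_ : _ * _ = f pi ^+ 2 - f 0 ^+ 2)//; ring.
    by move/eqP; rewrite mulf_eq0 => /orP[/eqP|/eqP]; lra.
  have a0 : 0 < f 0 by lra.
  have wn : c ^+ 2 - 2 * f 0 != 0.
    apply/eqP => h; move/eqP : EA; apply; rewrite fpiE sqrrN; congr (_ ^+ 2); lra.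
  have ac : 2 * f 0 < c ^+ 2 by rewrite -subr_gt0 lt_neqAle eq_sym wn.
  have fI u : 0 < u < pi -> - f 0 < f u < f 0.
    by move=> /andP[u0 u1]; rewrite -fpiE !decr// ltW.
  have data u : 0 < u < pi -> [/\ is_derive u 1 f (derive1 f u), derive1 f u < 0,
       - f 0 < f u < f 0, 0 < c ^+ 2 - 2 * f u &
       (c ^+ 2 - 2 * f u) * derive1 f u ^+ 2 = f 0 ^+ 2 - f u ^+ 2].
    move=> uI; have uI' : u \in `]0, pi[ by rewrite in_itv.
    have w : 0 < c ^+ 2 - 2 * f u by apply: w0; case/andP: uI => -> /ltW.
    have e : (c ^+ 2 - 2 * f u) * derive1 f u ^+ 2 = f 0 ^+ 2 - f u ^+ 2.
      by rewrite enI// fpiE sqrrN.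
    have df := sol_der C2 (not_crest_pos uI').
    have f'0 := energy_slope_lt0 (fI u uI) w e (sol_der_le0 cf pf C2 sl uI).
    exact: And5 df f'0 (fI u uI) w e.
  have cfw : {within `[0, pi], continuous f} by exact: continuous_subspaceT.
  have := phase_of_solution c0 a0 cfw erefl fpiE data (u := 0).
  rewrite lexx (ltW pi0) => /(_ isT).
  rewrite mulNr divff ?gt_eqF// acosN1 subr0 -/(half_period _) => h0.
  have h : half_period (2 * f 0 / c ^+ 2) = half_period 1.
    by apply: (mulfI (lt0r_neq0 c0)); rewrite h0 /c c_star_half_period.
  have m01 : 0 <= 2 * f 0 / c ^+ 2 <= 1.
    apply/andP; split; last by rewrite ler_pdivrMr// mul1r ltW.
    by rewrite divr_ge0 ?(ltW c20)// mulr_ge0// ltW.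
  have o01 : 0 <= (1 : R) <= 1 by rewrite ler01 lexx.
  have := half_period_inj m01 o01 h => /(congr1 (fun x => x * c ^+ 2)).
  by rewrite mul1r divfK ?gt_eqF//; lra.
Qed.

End critical.

(** * Speeds and parameters *)

Section parameters.
Context {R : realType}.
Implicit Types (f g eta : R -> R) (c m u : R).

Lemma half_period_gt0 m : 0 <= m -> 0 < half_period m.
Proof.
move=> m0; have pi0 := @pi_gt0 R.
have p1 : - (3 * pi) < (0 : R) by lra.
have p2 : 0 <= pi / 2 :> R by lra.
have p3 : pi / 2 < 3 * pi :> R by lra.
have dx (t : R) : t \in `]0, pi / 2[ -> is_derive t 1 (fun x : R => x) ((fun=> 1) t).
  by move=> _; exact: der_id.
have cx : {within `[0, pi / 2 : R], continuous (fun x : R => x)}.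
  by apply: continuous_subspaceT => x; exact: (is_derive_continuous (der_id x)).
have dP t : t \in `]0, pi / 2[ -> is_derive t 1 (period_int m) (period_density m t).
  by rewrite in_itv/= => /andP[? ?]; apply: der_period_int; apply/andP; split; lra.
have h := der_le p2 cx (period_int_within p1 p3) dx dP.
have : pi / 2 - 0 <= period_int m (pi / 2) - period_int m 0.
  apply: h => t; rewrite in_itv/= => /andP[t0 t1].
  rewrite /period_density -[leLHS]sqrtr1 ler_wsqrtr// lerDl mulr_ge0//.
  by apply: cos_ge0_pihalf; apply/andP; split; lra.
have : period_int m (pi / 2) <= period_int m pi by apply: period_int_ndecr; lra.
by rewrite period_int0 /half_period; lra.
Qed.

Lemma speed_parameter c m0 m1 : 0 < c -> m0 <= m1 ->
  half_period m1 < pi / c < half_period m0 -> exists2 m, m0 < m < m1 & c * half_period m = pi.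
Proof.
move=> c0 m01 /andP[h1 h0].
have cH : {within `[m0, m1], continuous (@half_period R)}.
  by apply: continuous_subspaceT; exact: continuous_half_period.
have [|m mI Hm] := @IVT _ half_period m0 m1 (pi / c) m01 cH.
  have h10 : half_period m1 <= half_period m0 by apply: ltW; apply: lt_trans h1 h0.
  by rewrite (min_idPr h10) (max_idPl h10) !ltW.
exists m; last by rewrite Hm mulrC divfK// gt_eqF.
move: mI; rewrite in_itv/= => /andP[mm0 mm1]; rewrite !lt_neqAle mm0 mm1 !andbT.
by apply/andP; split; apply/eqP => E; move: h0 h1; rewrite -Hm E ltxx.
Qed.

Lemma sqrt2_gt1 : 1 < Num.sqrt (2 : R).
Proof. by have [] := @sqrt2_bound R; lra. Qed.

(** The bound on the amplitude comes from half_period_decr between 0 and m: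
m^2 pi / 16 <= half_period 0 - half_period m = pi (1 - 1 / c). *)
Lemma smooth_wave_of_speed c : 1 < c -> c < c_star ->
  exists eta, smooth_single_lobe_solution c eta /\
    forall u, `|eta u| <= 2 * c ^+ 2 * Num.sqrt (1 - c^-1).
Proof.
move=> c1 cs; have pi0 := @pi_gt0 R; have c0 : 0 < c by lra.
have [m /andP[m0 m1] cH] : exists2 m, 0 < m < 1 & c * half_period m = pi.
  apply: speed_parameter => //.
  rewrite half_period0 ltr_pdivrMr// ltr_pMr// c1 andbT ltr_pdivlMr// mulrC.
  by rewrite -[ltRHS](@c_star_half_period R) ltr_pM2r// half_period_gt0.
have m01 : 0 < m < 1 by rewrite m0.
have [eta [S bd]] := smooth_wave_exists c0 m01 cH; exists eta; split=> // u.
apply: le_trans (bd u) _.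
rewrite (_ : m * c ^+ 2 / 2 = 2 * c ^+ 2 * (m / 4)); last by field.
have c20 : 0 <= 2 * c ^+ 2 by apply: mulr_ge0 => //; exact: sqr_ge0.
rewrite ler_wpM2l//.
have := half_period_decr (lexx 0) (ltW m0) (ltW m1).
have -> : half_period m = pi / c by rewrite -cH mulrC mulKf// gt_eqF.
rewrite half_period0 expr0n subr0 => h.
have h2 : (m / 4) ^+ 2 <= 1 - c^-1.
  rewrite -(ler_pM2l pi0) mulrBr mulr1 (_ : pi * _ = m ^+ 2 * pi / 16)//.
  by field.
have m4 : 0 <= m / 4 by rewrite divr_ge0// ltW.
by rewrite -(ger0_norm m4) -sqrtr_sqr ler_wsqrtr.
Qed.

Lemma amplitude_bound_cvg :
  2 * c ^+ 2 * Num.sqrt (1 - c^-1) @[c --> (1 : R)^'+] --> (0 : R).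
Proof.
have -> : (0 : R) = 2 * 1 ^+ 2 * Num.sqrt (1 - 1^-1).
  by rewrite invr1 subrr sqrtr0 mulr0.
apply: cvg_at_right_filter; apply: cvgM.
  apply: cvgM; first exact: cvg_cst.
  exact: exprn_continuous.
apply: (@continuous_comp _ _ _ (fun c : R => 1 - c^-1) Num.sqrt).
  apply: cvgB; first exact: cvg_cst.
  by apply: cvgV; [exact: oner_neq0|exact: cvg_id].
exact: sqrt_continuous.
Qed.

Lemma one_lt_c_star : 1 < c_star :> R.
Proof.
have pi0 := @pi_gt0 R.
have := @half_period_decr R 0 1 (lexx 0) ler01 (lexx 1); rewrite half_period0 expr1n expr0n subr0 mul1r => h.
have H1p : 0 < half_period 1 :> R by apply: half_period_gt0; exact: ler01.
by rewrite -(ltr_pM2r H1p) c_star_half_period mul1r; lra.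
Qed.

Lemma c_starE : c_star = pi / half_period 1 :> R.
Proof. by rewrite half_period1. Qed.

(** By critical_slope the slope of the wave is bounded off the crests. *)
Lemma peaked_wave : exists2 eta : R -> R,
    singular_single_lobe_solution c_star eta /\ in_W1infty eta &
    forall u, - pi <= u -> u <= pi ->
      eta u = (pi ^+ 2 - 4 * pi * `|u| + 2 * u ^+ 2) / 16.
Proof.
have pi0 := @pi_gt0 R.
have [tau [tpi _ P _ S]] := singular_wave_exists c_star_gt0 (lexx 1) (@c_star_half_period R).
set eta := wrap _ in S; exists eta; last first.
  by move=> u u1 u2; apply: peaked_profile => //; apply/andP.
split=> //.
have etaE u : - pi <= u <= pi -> eta u = (pi ^+ 2 - 4 * pi * `|u| + 2 * u ^+ 2) / 16.
  exact: peaked_profile.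
have [Cf C2 weq _ sl] := S; have pf : periodic eta (2 * pi) by case: Cf.
have cE := @c_star_sqr R.
have Epi : eta pi ^+ 2 = (c_star ^+ 2 / 2) ^+ 2.
  rewrite etaE; last by apply/andP; split; lra.
  by rewrite ger0_norm ?(ltW pi0)// cE; field.
have slope := critical_slope S Epi.
apply: (bounded_derivative_in_W1infty (M := 1 + c_star ^+ 2 / 2) Cf (class_CW C2)) => u nu.
have [j uj] := reduce_off_crest nu.
rewrite -(periodicz j u (periodic_derive1 pf)).
have sE := slope _ uj; set v := u + _ in uj sE *.
have A0 : 0 <= c_star ^+ 2 / 2 :> R by rewrite divr_ge0// sqr_ge0.
have m1 : 0 < (1 : R) by exact: ltr01.
have /andP[_ ev] := wave_bound tau c_star_gt0 m1 v.
rewrite -/eta mul1r in ev.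
have h : `|derive1 eta v| ^+ 2 <= c_star ^+ 2 / 2.
  by rewrite real_normK ?num_real// sE; lra.
have := sqr_ge0 (`|derive1 eta v| - 1); rewrite sqrrB1 => h2.
have : 2 * `|derive1 eta v| <= c_star ^+ 2 / 2 + 1.
  by move: h2; rewrite mulr2n; lra.
by have := normr_ge0 (derive1 eta v); lra.
Qed.

End parameters.

Theorem theorem1 (R : realType) :
  exists2 c_infty : R, c_star < c_infty &
  [/\ (exists eta : R -> R -> R,
         (forall c, 1 < c -> c < c_star ->
            unique (smooth_single_lobe_solution c) (eta c)) /\
         (Linfty_norm (eta c) @[c --> (1 : R)^'+] --> 0%E)),
      (forall c : R, c_star < c -> c < c_infty ->
         exists (eta : R -> R) (A : R),
           [/\ singular_single_lobe_solution c eta, 0 < A &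
               eta = (fun u => c ^+ 2 / 2 - A * `|u| `^ (2 / 3))
                     +O_ (0 : R) (fun u => `|u| `^ (4 / 3))]) &
      (exists eta : R -> R,
         unique (fun f : R -> R =>
           singular_single_lobe_solution c_star f /\ in_W1infty f) eta /\
         (forall u, - pi <= u -> u <= pi ->
            eta u = (pi ^+ 2 - 4 * pi * `|u| + 2 * u ^+ 2) / 16))].
Proof.
have pi0 := @pi_gt0 R.
have s1 := @sqrt2_gt1 R.
have Hs0 : 0 < half_period (Num.sqrt 2) :> R by apply: half_period_gt0; lra.
have H10 : 0 < half_period 1 :> R by apply: half_period_gt0; exact: ler01.
exists (pi / half_period (Num.sqrt 2)).
  by rewrite c_starE ltr_pM2l// ltf_pV2// half_period1 half_period_sqrt2_lt.
split.
- have ex c : exists e : R -> R, 1 < c -> c < c_star ->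
      smooth_single_lobe_solution c e /\
      forall u, `|e u| <= 2 * c ^+ 2 * Num.sqrt (1 - c^-1).
    have [[c1 cs]|nc] := pselect (1 < c /\ c < c_star).
      by have [e eP] := smooth_wave_of_speed c1 cs; exists e.
    by exists (fun=> 0) => c1 cs; exfalso; apply: nc.
  have [eta etaP] := choice ex.
  exists eta; split.
    move=> c c1 cs; have [S _] := etaP c c1 cs; split=> // f Sf.
    apply: (@smooth_solution_unique _ c) => //; lra.
  pose B (c : R) := 2 * c ^+ 2 * Num.sqrt (1 - c^-1).
  apply: (@squeeze_cvge _ _ _ _ (fun=> 0%E) _ (fun c => (B c)%:E)).
  + near=> c; have c1 : 1 < c by near: c; exact: nbhs_right_gt.
    have cs : c < c_star.
      by near: c; apply: nbhs_right_lt; exact: one_lt_c_star.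
    have [_ bd] := etaP c c1 cs; rewrite Linfty_norm_ge0/=.
    apply: Linfty_norm_le => //.
    apply: mulr_ge0; last exact: sqrtr_ge0.
    by apply: mulr_ge0 => //; exact: sqr_ge0.
  + exact: cvg_cst.
  + by apply: cvg_EFin; [exact: nearW|exact: amplitude_bound_cvg].
- move=> c cs ci.
  have c0 : 0 < c by apply: lt_trans cs; exact: c_star_gt0.
  have [m /andP[m1 m2] cH] : exists2 m, 1 < m < Num.sqrt 2 & c * half_period m = pi.
    apply: speed_parameter => //; first exact: ltW.
    apply/andP; split; first by rewrite ltr_pdivlMr// mulrC -ltr_pdivlMr.
    by rewrite ltr_pdivrMr// mulrC -ltr_pdivrMr// -c_starE.
  have [tau [tpi mc P K0 S]] := singular_wave_exists c0 (ltW m1) cH.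
  have [A A0 asy] := crest_asymptotics c0 m1 tpi mc P K0.
  by exists (wrap (profile (m * c ^+ 2 / 2) tau)), A; split.
- have [eta [S W] etaE] := @peaked_wave R; exists eta; split=> //; split=> // f [Sf Wf].
  have [[pe _] _ _ _ [eve _]] := S; have [[pf _] _ _ _ [evf _]] := Sf.
  apply: (even_periodic_eq eve evf pe pf) => u uI; rewrite (critical_solution Sf Wf)//.
  have /andP[u0 u1] := uI; have um : - pi <= u by lra.
  by rewrite (etaE u um u1) ger0_norm// c_star_sqr; field.
Unshelve. all: by end_near. Qed.
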